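(* We have $\mathbb{D}_P\subseteq\mathbb{D}$, and for all $\Psi\in\mathbb{N}_{\mathbb{D}}$: (a) $\left[\mathcal{J}_\Psi,\frac{1}{\mathcal{I}_\Psi}\right]\in\mathbb{D}_2$; (b) $t\mapsto-\log\mathcal{J}_\Psi(t)\notin\mathbb{N}(\mathbb{R})$, but $t\mapsto\log\mathcal{I}_\Psi(t)=\phi_\Psi(t^2)\in\mathbb{N}(\mathbb{R})$, where $\phi_\Psi$ is a Bernstein function that belongs to the class $\mathbb{B}_J$, that is, it is of the form $\phi_\Psi(u)=\nu+\frac{\sigma^2}{2}u+\int_0^\infty(1-e^{-ur})\overline{\mu}(r)dr$, with the additional property that $r\mapsto r\overline{\mu}(r)$ is non-increasing on $(0,\infty)$; (c) writing $\mathcal{F}_\Psi(t)=\frac{\mathcal{J}_\Psi(t)}{\mathcal{I}_\Psi(t)}$, $t\in\mathbb{R}$, we have $\mathcal{F}_\Psi\in\mathbb{D}_S$, that is, $\mathcal{F}_\Psi(t)\mathcal{F}_\Psi(it)=1$ for all $t\in\mathbb{R}$.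
   Context: $\mathbb{P}_+$ is the set of continuous bounded positive-definite functions on $\mathbb{R}$ equal to $1$ at the origin, i.e. characteristic functions of real-valued random variables. For an analytic characteristic function $\mathcal{F}$, put $V\mathcal{F}(t)=1/\mathcal{F}(it)$, $t\in\mathbb{R}$, where $\mathcal{F}(it)$ is understood through analytic (meromorphic) continuation. $\mathbb{D}=\{\mathcal{F}\in\mathbb{P}_+:V\mathcal{F}\in\mathbb{P}_+\}$; $\mathbb{D}_2$ is the set of pairs $[\mathcal{F},V\mathcal{F}]\in\mathbb{P}_+\times\mathbb{P}_+$ with $\mathcal{F}(it)\cdot V\mathcal{F}(t)=1$ for all $t\in\mathbb{R}$; $\mathbb{D}_S=\{\mathcal{F}\in\mathbb{P}_+:\mathcal{F}=V\mathcal{F}\}$. $\mathbb{N}(\mathbb{R})$ is the set of continuous negative-definite functions on $\mathbb{R}$ (for $\mathcal{F}\in\mathbb{P}_+$, $-\log\mathcal{F}\in\mathbb{N}(\mathbb{R})$ means that $\mathcal{F}$ is the characteristic function of an infinitely divisible law). $\mathbb{N}$ is the set of functions $\Psi:[0,\infty)\to\mathbb{R}$ of the form $$\Psi(u)=-\kappa+au+\tfrac12\sigma^2u^2-\int_0^\infty(1-e^{-ur}-ur\mathbf{1}_{\{r<1\}})\mu(dr),$$ with $\kappa\ge0$, $a\in\mathbb{R}$, $\sigma^2\ge0$ and $\mu$ a non-negative Radon measure on $(0,\infty)$ with $\int_0^\infty\min(1,r^2)\mu(dr)<\infty$, excluding the case where simultaneously $\sigma=0$, $a+\int_0^1r\mu(dr)\le0$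 and $\int_0^\infty\min(1,r)\mu(dr)<\infty$. One has $\lim_{u\to\infty}\Psi(u)=\infty$. Put $\theta=\sup\{u\ge0:\Psi(u)=0\}$ and $\mathbb{N}_{\mathbb{D}}=\{\Psi\in\mathbb{N}:0\le\theta\le\frac12\}$. For $\Psi\in\mathbb{N}_{\mathbb{D}}$, $W_\Psi(1)=1$, $W_\Psi(n+1)=\prod_{k=1}^n\Psi(k)$ for $n\ge1$, and $$\mathcal{J}_\Psi(t)=\sum_{n=0}^\infty\frac{(-1)^n}{W_\Psi(n+1)}t^{2n},\qquad \mathcal{I}_\Psi(t)=\mathcal{J}_\Psi(it)=\sum_{n=0}^\infty\frac{t^{2n}}{W_\Psi(n+1)},$$ which are entire functions. $\mathbb{D}_P=\{\mathcal{J}_\Psi:\Psi\in\mathbb{N}_{\mathbb{D}}\}$. A Bernstein function is a function $\phi:(0,\infty)\to[0,\infty)$ with derivatives of all orders such that $(-1)^{n+1}\phi^{(n)}\ge0$ for all $n\ge1$. $\mathbb{B}_J$ is the set of Bernstein functions of the form $\phi(u)=\nu+\frac{\sigma^2}{2}u+\int_0^\infty(1-e^{-ur})\overline{\mu}(r)dr$ with $\nu,\sigma\ge0$ and $\overline{\mu}$ a non-negative and non-increasing function on $(0,\infty)$ with $\int_0^\infty\min(1,r)\overline{\mu}(r)dr<\infty$.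
   Formalization: The first claim of (b) is proved for Ψ not of the form Ψ(u)=au on [0,∞); for Ψ(u)=au, a>0, J_Ψ(t)=exp(-t²/a) is Gaussian and the claim fails. In (c) the product F(t)F(it)=1 is stated where J_Ψ(t)≠0; at zeros of J_Ψ, F(it) is a pole, and 1/F(it)=F(t) holds as a limit. *)

(* Defs.v *)
From HB Require Import structures.
From mathcomp Require Import all_boot all_order all_algebra.
From mathcomp Require Import all_classical all_reals all_analysis.
From mathcomp Require Export complex.

Set Implicit Arguments.
Unset Strict Implicit.
Unset Printing Implicit Defensive.

Import Order.TTheory GRing.Theory Num.Theory.
Import numFieldNormedType.Exports.

Local Open Scope classical_set_scope.
Local Open Scope ring_scope.
Local Open Scope complex_scope.

(* The complex numbers, with the topology of their modulus.  The order on C R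
   is partial: 0 <= z says that z is real and non-negative.  For M : C R -> C R,
   [derivable M z 1] is complex differentiability at z. *)
Notation C R := (R[i]^o).

Section CharacteristicFunctions.
Variable R : realType.
Implicit Types (F G psi : R -> C R) (M g h : C R -> C R).

Definition positive_definite F :=
  forall (n : nat) (t : 'I_n -> R) (c : 'I_n -> C R),
    0 <= \sum_(j < n) \sum_(k < n) F (t j - t k) * c j * (c k)^* .

Definition Pplus : set (R -> C R) :=
  [set F | [/\ continuous F,
               exists B : R, forall t : R, `|F t| <= B%:C,
               positive_definite F
             & F 0 = 1]].

(* Negative definiteness in the sense of Schoenberg. *)
Definition negative_definite psi :=
  forall (n : nat) (t : 'I_n -> R) (c : 'I_n -> C R),
    0 <= \sum_(j < n) \sum_(k < n)
           (psi (t j) + (psi (t k))^* - psi (t j - t k)) * c j * (c k)^* .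

Definition NR : set (R -> C R) :=
  [set psi | continuous psi /\ negative_definite psi].

Definition cexp (z : C R) : C R :=
  let: x +i* y := z in (expR x * cos y) +i* (expR x * sin y).

(* psi = log F: the continuous logarithm vanishing at 0.  It is unique, and it
   exists only if F has no zero and F 0 = 1. *)
Definition is_log F psi :=
  [/\ continuous psi, psi 0 = 0 & forall t, F t = cexp (psi t)].

Definition holomorphic_at M (z0 : C R) := \forall z \near z0, derivable M z 1.

(* The values of M at its poles and removable singularities are immaterial. *)
Definition meromorphic_on (O : set (C R)) M :=
  forall z0, O z0 -> exists g h,
    [/\ holomorphic_at g z0, holomorphic_at h z0
      & \forall z \near z0^', h z != 0 /\ M z = g z / h z].

(* G = V F, i.e. F is analytic at the origin and F(it) G(t) = 1 for all real t,
   where F(it) is the value of the meromorphic continuation M of F along the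
   imaginary axis.  The value 1/F(it) is taken as the limit of 1/M at it, so
   that it is 0 when M has a pole at it, and does not exist when M has a zero
   there.  M may be defined on any domain containing both axes. *)
Definition is_V F G :=
  exists (O : set (C R)) M,
    [/\ [/\ open O, connected O
          & forall t : R, O (t +i* 0) /\ O (0 +i* t)],
        meromorphic_on O M,
        holomorphic_at M 0,
        forall t : R, M (t +i* 0) = F t
      & forall t : R, (M z)^-1 @[z --> ((0 +i* t) : C R)^'] --> G t].

Definition D : set (R -> C R) :=
  [set F | Pplus F /\ exists2 G, is_V F G & Pplus G].

Definition D2 : set ((R -> C R) * (R -> C R)) :=
  [set FG | [/\ Pplus FG.1, Pplus FG.2 & is_V FG.1 FG.2]].

Definition DS : set (R -> C R) := [set F | Pplus F /\ is_V F F].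

End CharacteristicFunctions.

Section ClassN.
Variable R : realType.

(* A Radon measure mu on (0, +oo) is given as a Borel measure on the line that
   vanishes on (-oo, 0]; local finiteness on (0, +oo) follows from the
   integrability of min(1, r^2). *)
Definition levy_measure (mu : {measure set (measurableTypeR R) -> \bar R}) :=
  mu `]-oo, 0%R]%classic = 0%E /\
  (\int[mu]_(r in `]0%R, +oo[) (Num.min 1 (r ^+ 2))%:E < +oo)%E.

(* Functions on [0, +oo) are represented by functions on R, whose values on the
   negative half-line are unconstrained. *)
Definition classN : set (R -> R) :=
  [set Psi : R -> R | exists (kappa a sigma : R)
      (mu : {measure set (measurableTypeR R) -> \bar R}),
    [/\ 0 <= kappa, 0 <= sigma, levy_measure mu,
        forall u : R, 0 <= u ->
          Psi u = - kappa + a * u + 2^-1 * sigma ^+ 2 * u ^+ 2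
            - \int[mu]_(r in `]0, +oo[)
                (1 - expR (- (u * r)) - u * r * ((r : R) < 1)%R%:R)
      & ~ [/\ sigma = 0,
              (a%:E + \int[mu]_(r in `]0%R, 1%R[) (r : R)%:E <= 0)%E
            & (\int[mu]_(r in `]0%R, +oo[) (Num.min 1 r)%:E < +oo)%E]]].

(* For Psi in classN this set is bounded and non-empty: Psi 0 <= 0, Psi is
   continuous and tends to +oo. *)
Definition theta (Psi : R -> R) : R := sup [set u : R | 0 <= u /\ Psi u = 0].

Definition classND : set (R -> R) :=
  [set Psi | classN Psi /\ 0 <= theta Psi <= 2^-1].

Definition W (Psi : R -> R) (n : nat) : R := \prod_(1 <= k < n) Psi k%:R.

Definition JPsi (Psi : R -> R) (z : C R) : C R :=
  limn (series (fun n => (-1) ^+ n / (W Psi n.+1)%:C * z ^+ (2 * n)) : nat -> C R).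

Definition IPsi (Psi : R -> R) (z : C R) : C R := JPsi Psi ((0 +i* 1) * z).

Definition FPsi (Psi : R -> R) (z : C R) : C R := JPsi Psi z / IPsi Psi z.

Definition DP : set (R -> C R) :=
  [set F | exists2 Psi, classND Psi & F = fun t : R => JPsi Psi t%:C].

End ClassN.

Section Bernstein.
Variable R : realType.
Implicit Types phi mubar : R -> R.

Definition bernstein phi :=
  [/\ forall u : R, 0 < u -> 0 <= phi u,
      forall (n : nat) (u : R), 0 < u -> derivable (phi^`(n))%classic u 1
    & forall (n : nat) (u : R), (1 <= n)%N -> 0 < u ->
        0 <= (-1) ^+ n.+1 * (phi^`(n))%classic u].

(* The representation is required at u = 0 as well: phi is extended there by
   continuity, phi 0 = nu. *)
Definition BJ_representation phi (nu sigma : R) mubar :=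
  [/\ 0 <= nu /\ 0 <= sigma,
      forall r : R, 0 < r -> 0 <= mubar r,
      forall r s : R, 0 < r -> r <= s -> mubar s <= mubar r,
      (\int[lebesgue_measure]_(r in `]0%R, +oo[)
         (Num.min 1 r * mubar r)%:E < +oo)%E
    & forall u : R, 0 <= u ->
        (phi u)%:E = ((nu + sigma ^+ 2 / 2 * u)%:E
          + \int[lebesgue_measure]_(r in `]0%R, +oo[)
              ((1 - expR (- (u * r))) * mubar r)%:E)%E].

Definition BJ : set (R -> R) :=
  [set phi | bernstein phi /\
     exists nu sigma mubar, BJ_representation phi nu sigma mubar].

End Bernstein.

(* Main.v *)
Require Import Defs.
From mathcomp Require Import all_boot all_order all_algebra.
From mathcomp Require Import all_classical all_reals all_analysis.
From mathcomp Require Import measurable_realfun ring lra zify.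

Set Implicit Arguments.
Unset Strict Implicit.
Unset Printing Implicit Defensive.

Import Order.TTheory GRing.Theory Num.Theory.
Import numFieldNormedType.Exports.

Local Open Scope classical_set_scope.
Local Open Scope ring_scope.

(** * Moment sequences *)

(** Let I(x) be the entire series with coefficients 1/W(n+1), called [Iser], so that J(t) = I(-t^2)
    and the second member of the pair is 1/I(t^2). The theorem rests on three positivity statements.

    J is positive definite because (2n)!/W(n+1) is a Stieltjes moment sequence ([moment_W]): J(t) is
    then the mean of cos(t sqrt X) for some X >= 0 ([even_series_rpd]). With phi(u) = Psi(u)/(u -
    theta), these moments factor as 4^n times (1/2)_n/(1 - theta)_n times n!/(phi(1)...phi(n)). The
    middle factor is a Beta moment sequence because theta <= 1/2. The last one consists of the
    moments of the exponential functional of a subordinator, because phi is a Bernstein function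
    ([bernstein_shift], [moment_exponential_functional]).

    The functions 1/I(q) and I(cq)/I(q), with c < 1 a rational, are Laplace transforms of positive
    measures ([Iser_ratio_laplace]). On the integers they are transforms of passage times of a
    Markov chain whose upward jumps have size one ([eigen_ratio_laplace]), and I is a scaling limit
    of its eigenfunctions. At q = t^2 they become mixtures of Gaussians, so 1/I(t^2) and J(t)/I(t^2)
    are positive definite ([rpd_laplace]).

    The derivative of log I at u is the limit of (1 - I(cu)/I(u))/((1 - c)u) as c increases to 1.
    For a Laplace transform f, (f(0) - f(u))/u is the transform of a tail, hence of a nonincreasing
    density, and such transforms are closed under limits ([decreasing_density_lim]). Thus I'/I(u) =
    d + int e^{-ur} k(r) dr with k nonincreasing, and integration in u gives mubar(r) = k(r)/r
    ([logI_representation]). Read as kernels, the same limits make log I(t^2) negative definite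
    ([rnd_logI]).

    If -log J were negative definite, |J(h)|^4 <= |J(2h)| would hold, and the terms of order h^4
    would give Psi(2) <= 2 Psi(1) ([not_NR_log_JPsi]). But Psi(2) - 2 Psi(1) = kappa + sigma^2 + int
    (1 - e^{-r})^2 mu(dr) is nonnegative, and vanishes only for linear Psi ([levy_two_points],
    [levy_rigidity]).

    The relations on the imaginary axis come from J(it) = I(t^2) and from the zeros of entire
    functions being isolated ([is_V_JPsi], [is_V_FPsi]).

    Mixing measures are never constructed for the Laplace transforms and moments above: a positive
    mixture is a member of a [cone], and its properties are checked on the generators and propagated
    by induction. *)

Section Cone.
Variables (R : realType) (X : Type) (D : set X) (gen : set (X -> R)).

(** Stands for positive mixtures of [gen]: a measure on the generators is replaced by a derivation,
    and integration against it by induction. Convergence is asked on [D] only, so values off [D] are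
    immaterial. *)
Inductive cone : (X -> R) -> Prop :=
| cone_gen g : gen g -> cone g
| cone_zero : cone (fun _ => 0)
| cone_add f g : cone f -> cone g -> cone (fun x => f x + g x)
| cone_scale a f : 0 <= a -> cone f -> cone (fun x => a * f x)
| cone_lim (F : nat -> X -> R) f : (forall n, cone (F n)) ->
    (forall x, D x -> F n x @[n --> \oo] --> f x) -> cone f.

Lemma cone_ext f g : (forall x, D x -> f x = g x) -> cone f -> cone g.
Proof.
move=> fg cf; apply: (cone_lim (F := fun _ => f)) => // x Dx.
by rewrite -fg//; exact: cvg_cst.
Qed.

Lemma cone_sum I (r : seq I) (P : pred I) (F : I -> X -> R) :
  (forall i, P i -> cone (F i)) -> cone (fun x => \sum_(i <- r | P i) F i x).
Proof.
move=> cF; elim: r => [|i r IH].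
  by apply: cone_ext cone_zero => x _; rewrite big_nil.
have [Pi|nPi] := boolP (P i).
  apply: cone_ext (cone_add (cF i Pi) IH) => x _.
  by rewrite big_cons Pi.
by apply: cone_ext IH => x _; rewrite big_cons (negbTE nPi).
Qed.

(** The product is bilinear and continuous in each factor: induct on [f] and, once [f] is a
    generator, on [g]. *)
Lemma cone_mul f g : (forall f g, gen f -> gen g -> gen (fun x => f x * g x)) ->
  cone f -> cone g -> cone (fun x => f x * g x).
Proof.
move=> gm cf; elim: cf g => {f}[f gf|g _|f1 f2 _ IH1 _ IH2 g cg|a f a0 _ IH g cg|
  F f _ IH Ff g cg].
- move=> g; elim=> {g}[g gg||g1 g2 _ IH1 _ IH2|a g a0 _ IH|F g _ IH Fg].
  + by apply: cone_gen; exact: gm.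
  + by apply: cone_ext cone_zero => x _; rewrite mulr0.
  + by apply: cone_ext (cone_add IH1 IH2) => x _; rewrite mulrDr.
  + by apply: cone_ext (cone_scale a0 IH) => x _; rewrite mulrCA.
  + apply: (cone_lim IH) => x Dx.
    by apply: cvgM; [exact: cvg_cst|exact: Fg].
- by apply: cone_ext cone_zero => x _; rewrite mul0r.
- by apply: cone_ext (cone_add (IH1 _ cg) (IH2 _ cg)) => x _; rewrite mulrDl.
- by apply: cone_ext (cone_scale a0 (IH _ cg)) => x _; rewrite mulrA.
- apply: (cone_lim (fun n => IH n _ cg)) => x Dx.
  by apply: cvgM; [exact: Ff|exact: cvg_cst].
Qed.

End Cone.

Section Moments.
Variable R : realType.
Implicit Types x y s : nat -> R.

(** Stieltjes moment sequences: a geometric sequence is the moment sequence of a point mass on [0,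
    +oo). *)
Definition moment_cone : (nat -> R) -> Prop :=
  cone setT [set s | exists2 a : R, 0 <= a & s = fun n => a ^+ n].

Lemma moment_geom a : 0 <= a -> moment_cone (fun n => a ^+ n).
Proof. by move=> a0; apply: cone_gen; exists a. Qed.

(** Moments of independent variables multiply. *)
Lemma moment_mul x y : moment_cone x -> moment_cone y ->
  moment_cone (fun n => x n * y n).
Proof.
apply: cone_mul => f g [a a0 ->] [b b0 ->]; exists (a * b); first exact: mulr_ge0.
by apply/funext => n; rewrite exprMn.
Qed.

Definition ndiff x n := x n - x n.+1.

Lemma diffD x y : ndiff (fun n => x n + y n) = (fun n => ndiff x n + ndiff y n).
Proof. by apply/funext => n; rewrite /ndiff; ring. Qed.

Lemma diffZ a x : ndiff (fun n => a * x n) = (fun n => a * ndiff x n).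
Proof. by apply/funext => n; rewrite /ndiff; ring. Qed.

Lemma iter_ndiffD m x y n :
  iter m ndiff (fun n => x n + y n) n = iter m ndiff x n + iter m ndiff y n.
Proof.
elim: m x y n => [//|m IH] x y n.
by rewrite !iterSr diffD IH.
Qed.

Lemma iter_ndiffZ m a x n :
  iter m ndiff (fun n => a * x n) n = a * iter m ndiff x n.
Proof. by elim: m x n => [//|m IH] x n; rewrite !iterSr diffZ IH. Qed.

Lemma iter_ndiffE m x n :
  iter m ndiff x n = \sum_(j < m.+1) (-1) ^+ j *+ 'C(m, j) * x (n + j)%N.
Proof.
elim: m n => [|m IH] n.
  by rewrite big_ord1 /= addn0 bin0 mulr1n expr0 mul1r.
rewrite iterS /ndiff !IH.
rewrite big_ord_recl [in RHS]big_ord_recl !bin0 !addn0 -!addrA; congr (_ + _).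
under [in RHS]eq_bigr do rewrite /= /bump /= add1n binS mulrnDr mulrDl.
rewrite big_split /=; congr (_ + _).
  rewrite [in RHS]big_ord_recr /= bin_small// mulr0n mul0r addr0.
  by apply: eq_bigr => i _; rewrite /bump /= add1n.
rewrite -sumrN; apply: eq_bigr => i _.
by rewrite addnS addSn exprS mulN1r mulNrn mulNr.
Qed.

(** The identity is the sum of the commuting operators [ndiff] and shift; this is the binomial
    expansion of its M-th power. *)
Lemma diff_shift x n M :
  x n = \sum_(i < M.+1) 'C(M, i)%:R * iter (M - i) ndiff x (n + i)%N.
Proof.
elim: M => [|M IH]; first by rewrite big_ord1 bin0 mul1r /= addn0.
rewrite {}IH.
have step i : (i <= M)%N -> iter (M - i) ndiff x (n + i)%N =
   iter (M.+1 - i) ndiff x (n + i)%N + iter (M - i) ndiff x (n + i.+1)%N.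
  by move=> iM; rewrite subSn// iterS /ndiff addnS subrK.
under eq_bigr => i _ do rewrite step ?mulrDr -1?ltnS //.
rewrite big_split /= [in RHS]big_ord_recl [X in X + _]big_ord_recl.
rewrite !bin0 -!addrA; congr (_ + _).
under [in RHS]eq_bigr do rewrite /= /bump /= add1n binS natrD mulrDl.
rewrite big_split /=; congr (_ + _).
rewrite [in RHS]big_ord_recr /= bin_small// mul0r addr0.
by apply: eq_bigr => i _; rewrite /bump /= add1n.
Qed.

(** The horizon [K] serves arguments whose auxiliary constant controls finitely many terms only, as
    in [cm_seq_inv]. *)
Definition cm_upto K x := forall m n, (n + m <= K)%N -> 0 <= iter m ndiff x n.

Definition cm_seq x := forall m n, 0 <= iter m ndiff x n.

Lemma cm_seq_upto x : (forall K, cm_upto K x) -> cm_seq x.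
Proof. by move=> H m n; exact: (H (n + m)%N m n). Qed.

Lemma cm_uptoW K L x : (L <= K)%N -> cm_upto K x -> cm_upto L x.
Proof. by move=> LK H m n nm; apply: H; exact: leq_trans LK. Qed.

Lemma cm_upto_diff K x : cm_upto K.+1 x -> cm_upto K (ndiff x).
Proof. by move=> H m n nm; rewrite -iterSr; apply: H; rewrite addnS. Qed.

Lemma iter_ndiff_shift m x n :
  iter m ndiff (fun n => x n.+1) n = iter m ndiff x n.+1.
Proof. by elim: m n => //= m IH n; rewrite /ndiff !IH. Qed.

Lemma cm_upto_shift K x : cm_upto K.+1 x -> cm_upto K (fun n => x n.+1).
Proof. by move=> H m n nm; rewrite iter_ndiff_shift; apply: H. Qed.

Lemma cm_upto_rec K x : (forall n, (n <= K)%N -> 0 <= x n) ->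
  (forall L, K = L.+1 -> cm_upto L (ndiff x)) -> cm_upto K x.
Proof.
move=> x0 xd [|m] n; first by rewrite addn0; exact: x0.
rewrite addnS; case: K x0 xd => // K x0 xd nm.
by rewrite iterSr; exact: (xd K erefl).
Qed.

Lemma cm_uptoD K x y : cm_upto K x -> cm_upto K y ->
  cm_upto K (fun n => x n + y n).
Proof. by move=> cx cy m n nm; rewrite iter_ndiffD addr_ge0// ?cx ?cy. Qed.

Lemma cm_uptoZ K a x : 0 <= a -> cm_upto K x -> cm_upto K (fun n => a * x n).
Proof. by move=> a0 cx m n nm; rewrite iter_ndiffZ mulr_ge0// cx. Qed.

(** Leibniz rule: the difference of x y is (ndiff x) y plus (shift x)(ndiff y), where the horizon is
    shorter by one. *)
Lemma cm_uptoM K x y : cm_upto K x -> cm_upto K y ->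
  cm_upto K (fun n => x n * y n).
Proof.
elim: K x y => [|K IH] x y cx cy; apply: cm_upto_rec => //.
- by move=> n nK; rewrite mulr_ge0//; [apply: (cx 0%N)|apply: (cy 0%N)]; rewrite addn0.
- by move=> n nK; rewrite mulr_ge0//; [apply: (cx 0%N)|apply: (cy 0%N)]; rewrite addn0.
move=> L [<-].
rewrite (_ : ndiff _ = fun n => ndiff x n * y n + x n.+1 * ndiff y n); last first.
  by apply/funext => n; rewrite /ndiff; ring.
by apply: cm_uptoD; apply: IH; [exact: cm_upto_diff|exact: cm_uptoW cy|
  exact: cm_upto_shift|exact: cm_upto_diff].
Qed.

Lemma cm_seqM x y : cm_seq x -> cm_seq y -> cm_seq (fun n => x n * y n).
Proof.
move=> cx cy; apply: cm_seq_upto => K.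
by apply: cm_uptoM => m n _; [exact: cx|exact: cy].
Qed.

Lemma cm_uptoX K x i : cm_upto K x -> cm_upto K (fun n => x n ^+ i).
Proof.
move=> cx; elim: i => [|i IH].
  apply: cm_upto_rec => [n _|L _ m n nm]; first by rewrite expr0.
  rewrite (_ : ndiff _ = fun n => 0 * ndiff x n); first by rewrite iter_ndiffZ mul0r.
  by apply/funext => k; rewrite /ndiff !expr0 subrr mul0r.
rewrite (_ : (fun n => _) = fun n => x n * x n ^+ i); first exact: cm_uptoM.
by apply/funext => n; rewrite exprS.
Qed.

Lemma limr_ge0 (u : nat -> R) l : u n @[n --> \oo] --> l ->
  (\forall n \near \oo, 0 <= u n) -> 0 <= l.
Proof.
move=> ul u0; have cu : cvgn u by apply/cvg_ex; exists l.
by rewrite -(cvg_lim _ ul)//; apply: limr_ge.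
Qed.

Lemma cvg_sum_seq I (r : seq I) (P : pred I) (F : nat -> I -> R) (f : I -> R) :
  (forall i, P i -> F n i @[n --> \oo] --> f i) ->
  \sum_(i <- r | P i) F n i @[n --> \oo] --> \sum_(i <- r | P i) f i.
Proof.
move=> H.
elim: r => [|i r IH].
  rewrite big_nil; under eq_fun do rewrite big_nil; exact: cvg_cst.
rewrite big_cons; under eq_fun do rewrite big_cons.
by case: (boolP (P i)) => Pi //; apply: cvgD => //; exact: H.
Qed.

Lemma cvg_iter_ndiff m (F : nat -> nat -> R) x n :
  (forall k, (n <= k <= n + m)%N -> F i k @[i --> \oo] --> x k) ->
  iter m ndiff (F i) n @[i --> \oo] --> iter m ndiff x n.
Proof.
move=> H; under eq_fun do rewrite iter_ndiffE; rewrite iter_ndiffE.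
apply: cvg_sum_seq => j _; apply: cvgM; first exact: cvg_cst.
by apply: H; rewrite leq_addr leq_add2l -ltnS ltn_ord.
Qed.

Lemma cm_upto_lim K (F : nat -> nat -> R) x :
  (\forall i \near \oo, cm_upto K (F i)) ->
  (forall k, (k <= K)%N -> F i k @[i --> \oo] --> x k) -> cm_upto K x.
Proof.
move=> cF Fx m n nm; apply: (@limr_ge0 (fun i => iter m ndiff (F i) n)).
  by apply: cvg_iter_ndiff => k /andP[_ kn]; apply: Fx; exact: leq_trans nm.
by apply: filterS cF => i; exact.
Qed.

End Moments.

(** * Hausdorff's moment theorem *)

Section Hausdorff.
Variable R : realType.
Implicit Types x y s : nat -> R.

(** Drawing n times from N items, k of them marked, with or without replacement, differs by O(1/N).
    The induction on n compares the factors k/N and (k - n)/(N - n). *)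
Lemma ffact_ratio_cvg n N k : (n < N)%N -> (k <= N)%N ->
  `|(k%:R / N%:R) ^+ n - (k ^_ n)%:R / (N ^_ n)%:R| <= (n * n)%:R / (N - n)%:R :> R.
Proof.
elim: n => [|n IH] nN kN.
  by rewrite expr0 !ffactn0 divr1 subrr normr0 mul0r.
have nN' := ltnW nN.
have N0 : 0 < N%:R :> R by rewrite ltr0n (leq_ltn_trans _ nN).
have Nn0 : 0 < (N - n)%:R :> R by rewrite ltr0n subn_gt0.
have NSn0 : 0 < (N - n.+1)%:R :> R by rewrite ltr0n subn_gt0.
have fN0 : 0 < (N ^_ n)%:R :> R by rewrite ltr0n ffact_gt0 ltnW.
rewrite !ffactnSr exprSr [(k ^_ n * _)%:R]natrM [(N ^_ n * _)%:R]natrM -mulf_div.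
set p := k%:R / N%:R; set s := (k - n)%:R / (N - n)%:R.
set r := (k ^_ n)%:R / _.
have p01 : 0 <= p <= 1.
  by rewrite /p divr_ge0//= ler_pdivrMr// mul1r ler_nat.
have s0 : 0 <= s by rewrite divr_ge0.
have r01 : 0 <= r <= 1.
  rewrite /r divr_ge0//= ler_pdivrMr// mul1r ler_nat.
  rewrite !ffact_prod; apply: leq_prod => i _; exact: leq_sub2r.
have pr := IH nN' kN; rewrite -/p -/r in pr.
have ps : `|p - s| <= n%:R / (N - n)%:R.
  rewrite /p /s; have [kn|nk] := leqP k n.
    rewrite (eqP (_ : (k - n)%N == 0%N)) ?subn_eq0// mul0r subr0 ger0_norm ?divr_ge0//.
    rewrite ler_pM ?invr_ge0 ?ler_nat// lef_pV2 ?posrE// ler_nat leq_subr//.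
  rewrite !natrB ?(ltnW nk) 1?ltnW//.
  have Nn0' : 0 < N%:R - n%:R :> R by rewrite -natrB// ltnW.
  have -> : k%:R / N%:R - (k%:R - n%:R) / (N%:R - n%:R) =
     n%:R * (N%:R - k%:R) / N%:R / (N%:R - n%:R) :> R.
    by field; rewrite gt_eqF// gt_eqF.
  have kN' : k%:R <= N%:R :> R by rewrite ler_nat.
  rewrite ger0_norm; last first.
    by apply: divr_ge0; [apply: divr_ge0 => //; apply: mulr_ge0 => //; rewrite subr_ge0|exact: ltW].
  rewrite ler_pM2r ?invr_gt0// ler_pdivrMr// ler_wpM2l//.
  by rewrite lerBlDr lerDl.
have -> : p ^+ n * p - r * s = (p ^+ n - r) * p + r * (p - s) by ring.
apply: (le_trans (ler_normD _ _)); rewrite (normrM (p ^+ n - r)) (normrM r).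
apply: (@le_trans _ _ ((n * n)%:R / (N - n)%:R + n%:R / (N - n)%:R)).
  apply: lerD.
    by case/andP: p01 => p0 p1; rewrite -[leRHS]mulr1 ler_pM// ger0_norm.
  case/andP: r01 => r0 r1; by rewrite -[leRHS]mul1r ler_pM// ger0_norm.
rewrite -mulrDl -natrD ler_pM ?invr_ge0// ?ler_nat.
  by nia.
by rewrite lef_pV2 ?posrE// ler_nat leq_sub2l.
Qed.

Lemma bin_sub_mul N k n : (n <= k)%N -> (k <= N)%N ->
  ('C(N - n, k - n) * 'C(N, n) = 'C(N, k) * 'C(k, n))%N.
Proof.
move=> nk kN; have nN := leq_trans nk kN.
apply/eqP; rewrite -(eqn_pmul2r (_ : 0 < n`! * (k - n)`! * (N - k)`!)%N); last first.
  by rewrite !muln_gt0 !fact_gt0.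
have e1 := bin_fact nN; have e2 := bin_fact kN; have e3 := bin_fact nk.
have := bin_fact (leq_sub2r n kN); rewrite subnBA// subnK// => e4.
apply/eqP; transitivity ('C(N, n) * (n`! * ('C(N - n, k - n) * ((k - n)`! * (N - k)`!))))%N.
  by nia.
by rewrite e4 e1 -e2 -e3; nia.
Qed.

(** The weights 'C(N, k) ndiff^(N - k) x k have exact factorial moments: this is [diff_shift] of
    order N - n, rearranged with [bin_sub_mul]. *)
Lemma bin_ndiff x n N : (n <= N)%N ->
  \sum_(k < N.+1) 'C(N, k)%:R * iter (N - k) (@ndiff R) x k * 'C(k, n)%:R = 'C(N, n)%:R * x n.
Proof.
move=> nN; rewrite (diff_shift x n (N - n)) mulr_sumr.
rewrite -(big_mkord xpredT
  (fun i => 'C(N, n)%:R * ('C(N - n, i)%:R * iter (N - n - i) (@ndiff R) x (n + i)%N))).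
rewrite -(big_mkord xpredT
  (fun k => 'C(N, k)%:R * iter (N - k) (@ndiff R) x k * 'C(k, n)%:R)).
rewrite (big_cat_nat (n := n)) //=; last exact: leqW.
rewrite [X in X + _ = _](_ : _ = 0) ?add0r; last first.
  rewrite big_nat; apply: big1 => k /andP[_ kn].
  by rewrite (bin_small kn) mulr0n mulr0.
have shift (G : nat -> R) : \sum_(n <= i < N.+1) G i = \sum_(0 <= i < N.+1 - n) G (i + n)%N.
  by rewrite -{1}[n]add0n big_addn.
rewrite shift subSn//; apply: eq_big_nat => i /andP[_ iN].
have inN : (n + i <= N)%N by move: iN nN; lia.
rewrite -subnDA (addnC n i) mulrAC mulrA; congr (_ * _).
rewrite -!natrM; congr (_%:R).
have := @bin_sub_mul N (n + i) n (leq_addr _ _) inN.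
by rewrite addKn (addnC n i) => <-; rewrite mulnC.
Qed.

(** The weights are nonnegative with total mass x 0, and their factorial moments reproduce x n;
    passing to power moments costs [ffact_ratio_cvg]. *)
Lemma hausdorff_approx x n N : cm_seq x -> (n < N)%N ->
  `|\sum_(k < N.+1) 'C(N, k)%:R * iter (N - k) (@ndiff R) x k * (k%:R / N%:R) ^+ n - x n|
    <= x 0%N * ((n * n)%:R / (N - n)%:R).
Proof.
move=> cx nN; have nN' := ltnW nN.
pose lam k := 'C(N, k)%:R * iter (N - k) (@ndiff R) x k.
have lam0 k : 0 <= lam k by rewrite mulr_ge0// cx.
have x0E : x 0%N = \sum_(k < N.+1) lam k.
  by rewrite (diff_shift x 0 N); apply: eq_bigr.
have xnE : x n = \sum_(k < N.+1) lam k * ((k ^_ n)%:R / (N ^_ n)%:R).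
  have C0 : 'C(N, n)%:R != 0 :> R by rewrite pnatr_eq0 -lt0n bin_gt0.
  have F0 : n`!%:R != 0 :> R by rewrite pnatr_eq0 -lt0n fact_gt0.
  apply: (mulfI C0); rewrite -bin_ndiff// mulr_sumr; apply: eq_bigr => k _.
  by rewrite -!bin_ffact !natrM /lam; field; rewrite C0 F0.
rewrite xnE x0E -sumrB mulr_suml; apply: (le_trans (ler_norm_sum _ _ _)).
apply: ler_sum => k _; rewrite -/(lam k) -mulrBr normrM (ger0_norm (lam0 k)) ler_wpM2l//.
by apply: ffact_ratio_cvg => //; rewrite -ltnS ltn_ord.
Qed.

Lemma cvg_const_div_nat (a : R) n : a / (N - n)%:R @[N --> \oo] --> (0 : R).
Proof.
rewrite -(cvg_shiftn n.+1).
under eq_fun do rewrite addnS subSn ?leq_addl// addnK.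
by have := cvgM (cvg_cst a) (@cvg_harmonic R); rewrite mulr0; exact.
Qed.

(** The representing measure is approximated by the weights of [hausdorff_approx] placed at the
    points k/N. *)
Lemma moment_cm x : cm_seq x -> moment_cone x.
Proof.
move=> cx.
apply: (cone_lim (F := fun N n => \sum_(k < N.+1) 'C(N, k)%:R *
   iter (N - k) (@ndiff R) x k * (k%:R / N%:R) ^+ n)).
  move=> N; apply: cone_sum => k _; apply: cone_scale.
    by rewrite mulr_ge0// cx.
  by apply: moment_geom; rewrite divr_ge0.
move=> n _; apply/cvgrPdistC_le => e e0.
have := @cvg_const_div_nat (x 0%N * (n * n)%:R) n.
move=> /cvgr0_norm_le/(_ _ e0) => h.
near=> N.
apply: (le_trans (hausdorff_approx cx _)); first by near: N; exact: nbhs_infty_gt.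
rewrite mulrA; apply: (le_trans (ler_norm _)).
by near: N.
Unshelve. all: by end_near.
Qed.

End Hausdorff.

(** * Completely monotone and Bernstein sequences *)

Section BernsteinSequences.
Variable R : realType.
Implicit Types x y s : nat -> R.

Lemma cm_seq_geom (a : R) : 0 <= a <= 1 -> cm_seq (fun n => a ^+ n).
Proof.
move=> /andP[a0 a1] m n.
suff -> : iter m (@ndiff R) (fun n => a ^+ n) n = (1 - a) ^+ m * a ^+ n.
  by rewrite mulr_ge0 ?exprn_ge0// subr_ge0.
elim: m n => [|m IH] n; first by rewrite expr0 mul1r.
by rewrite /= /ndiff !IH !exprS; ring.
Qed.

Lemma cm_seqD x y : cm_seq x -> cm_seq y -> cm_seq (fun n => x n + y n).
Proof. by move=> cx cy m n; rewrite iter_ndiffD addr_ge0. Qed.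

Lemma cm_seqZ a x : 0 <= a -> cm_seq x -> cm_seq (fun n => a * x n).
Proof. by move=> a0 cx m n; rewrite iter_ndiffZ mulr_ge0. Qed.

Lemma cm_seq_sum I (r : seq I) (F : I -> nat -> R) :
  (forall i, cm_seq (F i)) -> cm_seq (fun n => \sum_(i <- r) F i n).
Proof.
move=> cF; elim: r => [|i r IH].
  rewrite (_ : (fun _ => _) = (fun n => 0 * 1 ^+ n)).
    by apply: cm_seqZ => //; apply: cm_seq_geom; rewrite ler01 lexx.
  by apply/funext => n; rewrite big_nil mul0r.
rewrite (_ : (fun _ => _) = (fun n => F i n + \sum_(i <- r) F i n)).
  exact: cm_seqD.
by apply/funext => n; rewrite big_cons.
Qed.

Lemma cm_seq_lim (F : nat -> nat -> R) x : (forall i, cm_seq (F i)) ->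
  (forall k, F i k @[i --> \oo] --> x k) -> cm_seq x.
Proof.
move=> cF Fx; apply: cm_seq_upto => K.
by apply: (@cm_upto_lim _ _ F) => [|k _]; [apply: nearW => i m n _; exact: cF|exact: Fx].
Qed.

(* The ratios are the moments of a Beta law. *)
Definition pochhammer (a : R) n := \prod_(i < n) (a + i%:R).

Lemma pochhammer_gt0 a n : 0 < a -> 0 < pochhammer a n.
Proof. by move=> a0; apply: prodr_gt0 => i _; rewrite ltr_wpDr. Qed.

Lemma pochhammerSl a n : pochhammer a n.+1 = a * pochhammer (a + 1) n.
Proof.
rewrite /pochhammer big_ord_recl addr0; congr (_ * _).
by apply: eq_bigr => i _; rewrite /= /bump /= -addrA -natr1 [1 + _]addrC.
Qed.

Lemma pochhammerSr a n : pochhammer a n.+1 = pochhammer a n * (a + n%:R).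
Proof. by rewrite /pochhammer big_ord_recr. Qed.

(** The difference of (a)_n/(b)_n is (b - a)/b times (a)_n/(b + 1)_n, so the family is stable under
    [ndiff]. *)
Lemma cm_seq_beta a b : 0 < a -> a <= b ->
  cm_seq (fun n => pochhammer a n / pochhammer b n).
Proof.
move=> a0 + m; elim: m b => [|m IH] b ab n.
  by rewrite /= divr_ge0 ?ltW ?pochhammer_gt0// (lt_le_trans a0).
have b0 := lt_le_trans a0 ab.
rewrite iterSr (_ : ndiff _ =
    fun n => (b - a) / b * (pochhammer a n / pochhammer (b + 1) n)).
  rewrite iter_ndiffZ mulr_ge0 ?IH//; last by rewrite ler_wpDr.
  by rewrite divr_ge0 ?subr_ge0// ltW.
apply/funext => k; rewrite /ndiff !pochhammerSr.
have := pochhammerSl b k; rewrite pochhammerSr.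
have pb0 := pochhammer_gt0 k b0.
have bk0 : 0 < b + k%:R by rewrite ltr_wpDr.
have b10 : 0 < b + 1 by rewrite ltr_wpDr.
have pb10 := pochhammer_gt0 k b10.
move=> E; have -> : pochhammer (b + 1) k = pochhammer b k * (b + k%:R) / b.
  by rewrite E [b * _]mulrC mulfK ?gt_eqF.
by field; rewrite !gt_eqF.
Qed.

(* The restriction of a Bernstein function to the integers has the following
   property; it is the sequence analogue of nonnegativity with a completely
   monotone derivative. *)
Definition bernstein_seq y := 0 <= y 0%N /\ cm_seq (fun n => y n.+1 - y n).

Lemma bernstein_seq_ge0 y n : bernstein_seq y -> 0 <= y n.
Proof.
move=> [y0 dy]; elim: n => [//|n IH].
by have := dy 0%N n; rewrite /= subr_ge0; exact: le_trans.
Qed.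

Lemma cvg_geom (a : R) : `|a| < 1 -> a ^+ n @[n --> \oo] --> 0.
Proof. exact: cvg_expr. Qed.

(** With c an upper bound of 1 + y, the inverse is the geometric series c^-1 sum_j (1 - (1 +
    y)/c)^j, and its ratio is completely monotone because y has completely monotone increments. *)
Lemma cm_seq_inv y : bernstein_seq y -> cm_seq (fun n => (1 + y n)^-1).
Proof.
move=> by_; have y0 n := bernstein_seq_ge0 n by_.
apply: cm_seq_upto => K.
(* Bounds 1 + y n for n <= K only; y may be unbounded. *)
pose c := 1 + \sum_(k < K.+1) y k.
have yc n : (n <= K)%N -> 1 + y n <= c.
  move=> nK; rewrite lerD2l (bigD1 (inord n)) //= inordK// lerDl.
  by apply: sumr_ge0.
have c1 : 1 <= c by rewrite lerDl sumr_ge0.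
have c0 : 0 < c by apply: lt_le_trans c1.
pose w n := c^-1 * (c - (1 + y n)).
have cw : cm_upto K w.
  apply: cm_uptoZ; first by rewrite invr_ge0 ltW.
  apply: cm_upto_rec; first by move=> n nK; rewrite subr_ge0 yc.
  move=> L _ m n _.
  rewrite (_ : ndiff _ = fun n => y n.+1 - y n); last first.
    by apply/funext => k; rewrite /ndiff; ring.
  by case: by_ => _; exact.
apply: (@cm_upto_lim _ K (fun i n => c^-1 * \sum_(j < i) w n ^+ j)).
  apply: nearW => i; apply: cm_uptoZ; first by rewrite invr_ge0 ltW.
  elim: i => [|i IH].
    rewrite (_ : (fun _ => _) = fun n => 0 * w n).
      exact: cm_uptoZ.
    by apply/funext => n; rewrite big_ord0 mul0r.
  rewrite (_ : (fun _ => _) = fun n => \sum_(j < i) w n ^+ j + w n ^+ i).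
    by apply: cm_uptoD => //; exact: cm_uptoX.
  by apply/funext => n; rewrite big_ord_recr.
move=> k kK.
have y1 : 0 < 1 + y k by rewrite ltr_wpDr.
have w1 : `|w k| < 1.
  rewrite ger0_norm; last by rewrite mulr_ge0 ?subr_ge0 ?yc// invr_ge0 ltW.
  by rewrite /w mulrBr mulVf ?gt_eqF// gtrBl mulr_gt0// invr_gt0.
have -> : (1 + y k)^-1 = c^-1 * (1 - w k)^-1.
  have -> : 1 - w k = (1 + y k) / c by rewrite /w; field; rewrite gt_eqF.
  by rewrite invf_div mulKf// gt_eqF.
apply: cvgM; first exact: cvg_cst.
rewrite (_ : (fun i => \sum_(j < i) w k ^+ j) = series (geometric 1 (w k))).
  by rewrite -div1r; exact: cvg_geometric_series.
apply/funext => i; rewrite /series /= big_mkord.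
by apply: eq_bigr => j _; rewrite /geometric /= mul1r.
Qed.

(* An upward recursion step: if [s] is the moment sequence of [Y] and [x] that of
   [X], then the result is the moment sequence of [h + X * Y]. *)
Definition affine_moments h x s n := \sum_(k < n.+1) 'C(n, k)%:R * h ^+ (n - k) * (x k * s k).

(** Once x and s are multiplied, only the binomial transform remains, and it turns a^n into (h +
    a)^n. *)
Lemma moment_affine h x s : 0 <= h -> moment_cone x -> moment_cone s ->
  moment_cone (affine_moments h x s).
Proof.
move=> h0 mx ms.
suff H z : moment_cone z ->
    moment_cone (fun n => \sum_(k < n.+1) 'C(n, k)%:R * h ^+ (n - k) * z k).
  exact: H (moment_mul mx ms).
elim=> {z}[z [a a0 ->]||f g _ IH1 _ IH2|a f a0 _ IH|F f _ IH Ff].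
- apply: cone_ext (moment_geom (addr_ge0 h0 a0)) => n _.
  by rewrite exprDn; apply: eq_bigr => i _; rewrite -mulrA mulr_natl.
- apply: cone_ext (cone_zero _ _) => n _.
  by rewrite big1// => i _; rewrite mulr0.
- apply: cone_ext (cone_add IH1 IH2) => n _.
  by rewrite -big_split; apply: eq_bigr => i _; rewrite mulrDr.
- apply: cone_ext (cone_scale a0 IH) => n _.
  by rewrite mulr_sumr; apply: eq_bigr => i _; rewrite mulrCA.
- apply: (cone_lim IH) => n _; apply: cvg_sum_seq => i _.
  by apply: cvgM; [exact: cvg_cst|exact: Ff].
Qed.

End BernsteinSequences.

(** * Exponential functionals *)

Section Perpetuity.
Variable R : realType.
Implicit Types x y s : nat -> R.

(* The sequence [M] of moments of the perpetuity [S = h + X * S]. *)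
Lemma moment_perpetuity h x : 0 <= h -> moment_cone x -> x 0%N = 1 ->
    (forall n, 0 <= x n) -> (forall n, x n.+1 < 1) ->
  exists M, [/\ moment_cone M, M 0%N = 1 & forall n, M n.+1 * (1 - x n.+1) =
    \sum_(k < n.+1) 'C(n.+1, k)%:R * h ^+ (n.+1 - k) * (x k * M k)].
Proof.
move=> h0 mx x01 x0 x1.
(* Moments of the iterates of S |-> h + X S started at 0, whose moments are 0^n. They increase with
   N, and are bounded by induction on n. *)
pose s N := iter N (affine_moments h x) (fun n => 0 ^+ n).
have sS N n : s N.+1 n = affine_moments h x (s N) n by [].
have s0 N n : 0 <= s N n.
  elim: N n => [|N IH] n; first exact: exprn_ge0.
  rewrite sS; apply: sumr_ge0 => k _.
  by rewrite mulr_ge0// ?mulr_ge0// exprn_ge0.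
have smono N n : s N n <= s N.+1 n.
  elim: N n => [|N IH] n.
    case: n => [|n]; last by rewrite (_ : s 0%N n.+1 = 0) ?s0// /s /= expr0n.
    by rewrite sS /affine_moments big_ord1 bin0 mul1r expr0 mul1r x01 mul1r.
  rewrite !sS; apply: ler_sum => k _; rewrite ler_wpM2l//.
    by rewrite mulr_ge0// exprn_ge0.
  by rewrite ler_wpM2l.
have nd n : nondecreasing_seq (s ^~ n) by apply/nondecreasing_seqP => N.
have cs n : cvgn (s ^~ n).
  elim/ltn_ind: n => n IH; apply: nondecreasing_is_cvgn => //.
  case: n IH => [|n] IH.
    exists 1 => _ [N _ <-].
    elim: N => [|N IHN]; first by rewrite /s /= expr0.
    by rewrite sS /affine_moments big_ord1 bin0 mul1r expr0 mul1r x01 mul1r.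
  pose L k := limn (s ^~ k).
  pose B := \sum_(k < n.+1) 'C(n.+1, k)%:R * h ^+ (n.+1 - k) * (x k * L k).
  have x1' : 0 < 1 - x n.+1 by rewrite subr_gt0.
  have L0 k : (k < n.+1)%N -> 0 <= L k.
    by move=> kn; apply: (limr_ge0 (IH _ kn)); exact: nearW.
  have B0 : 0 <= B.
    apply: sumr_ge0 => k _.
    by rewrite mulr_ge0// ?mulr_ge0// ?exprn_ge0// L0.
  (* The fixed point of s |-> B + x n.+1 s, where [B] collects the limits of the lower moments. *)
  exists (B / (1 - x n.+1)) => _ [N _ <-].
  elim: N => [|N IHN]; first by rewrite /s /= expr0n /= divr_ge0// ltW.
  rewrite sS /affine_moments big_ord_recr /= binn subnn expr0 !mul1r.
  apply: (@le_trans _ _ (B + x n.+1 * (B / (1 - x n.+1)))).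
    apply: lerD; last by rewrite ler_wpM2l.
    apply: ler_sum => k _; rewrite ler_wpM2l//.
      by rewrite mulr_ge0// exprn_ge0.
    by rewrite ler_wpM2l//; exact: (nondecreasing_cvgn_le (nd k) (IH _ (ltn_ord k)) N).
  rewrite le_eqVlt; apply/orP; left; apply/eqP.
  by field; rewrite gt_eqF.
exists (fun n => limn (s ^~ n)); split.
- apply: (cone_lim (F := s)); last by move=> n _; exact: cs.
  elim=> [|N IH]; first exact: moment_geom.
  exact: moment_affine.
- apply: cvg_lim => //; rewrite (_ : (fun _ => _) = fun=> 1); first exact: cvg_cst.
  apply/funext; elim=> [|N IHN]; first by rewrite /s /= expr0.
  by rewrite sS /affine_moments big_ord1 bin0 mul1r expr0 mul1r x01 mul1r.
- move=> n.
  rewrite mulrBr mulr1; apply/eqP; rewrite subr_eq; apply/eqP.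
  have hl : s N.+1 n.+1 @[N --> \oo] --> limn (s ^~ n.+1).
    by have : s ^~ n.+1 @ \oo --> limn (s ^~ n.+1) by []; rewrite -cvg_shiftS.
  have hr : s N.+1 n.+1 @[N --> \oo] --> \sum_(k < n.+1) 'C(n.+1, k)%:R *
      h ^+ (n.+1 - k) * (x k * limn (s ^~ k)) + x n.+1 * limn (s ^~ n.+1).
    rewrite (_ : (fun N => s N.+1 n.+1) = fun N => \sum_(k < n.+1)
        'C(n.+1, k)%:R * h ^+ (n.+1 - k) * (x k * s N k) + x n.+1 * s N n.+1).
      apply: cvgD.
        apply: cvg_sum_seq => k _; apply: cvgM; first exact: cvg_cst.
        by apply: cvgM; [exact: cvg_cst|exact: (cs k)].
      by apply: cvgM; [exact: cvg_cst|exact: (cs n.+1)].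
    apply/funext => N; rewrite sS /affine_moments big_ord_recr /=.
    by rewrite binn subnn expr0 !mul1r.
  by rewrite [_ * x _]mulrC; exact: (cvg_unique (@Rhausdorff R) hl hr).
Qed.

(* The moments of the exponential functional of a subordinator with Laplace
   exponent interpolating [y] (Carmona, Petit and Yor). *)
Lemma moment_exponential_functional y : bernstein_seq y ->
    (forall n, 0 < y n.+1) ->
  moment_cone (fun n => n`!%:R / \prod_(k < n) y k.+1).
Proof.
move=> by_ y0; have yge0 n := bernstein_seq_ge0 n by_.
pose h i : R := i.+1%:R^-1.
have h0 i : 0 < h i by rewrite invr_gt0 ltr0n.
(* Moments of exp(-xi) for the subordinator xi at an exponential time of mean [h i]. The mass lost
   by killing at rate y 0 is put at the point 0, whose moments 0^n vanish for n > 0. *)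
pose X i n := (1 + h i * y n)^-1 + (1 - (1 + h i * y 0%N)^-1) * 0 ^+ n.
have hy0 i n : 0 < 1 + h i * y n by rewrite ltr_wpDr// mulr_ge0// ltW.
have XS i n : X i n.+1 = (1 + h i * y n.+1)^-1 by rewrite /X expr0n /= mulr0 addr0.
have X0 i : X i 0%N = 1 by rewrite /X expr0 mulr1 addrCA subrr addr0.
have mX i : moment_cone (X i).
  apply: cone_add.
    apply: moment_cm; apply: cm_seq_inv; split.
      by rewrite mulr_ge0// ltW.
    rewrite (_ : (fun _ => _) = fun n => h i * (y n.+1 - y n)).
      by apply: cm_seqZ; [exact: ltW|case: by_].
    by apply/funext => n; rewrite mulrBr.
  apply: cone_scale; last exact: moment_geom.
  by rewrite subr_ge0 invf_le1// lerDl mulr_ge0// ltW.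
have Xge0 i n : 0 <= X i n.
  by case: n => [|n]; rewrite ?X0// XS invr_ge0 ltW.
have Xlt1 i n : X i n.+1 < 1.
  by rewrite XS invf_lt1// ltrDl mulr_gt0.
have /choice[M HM] i := moment_perpetuity (ltW (h0 i)) (mX i) (X0 i) (Xge0 i) (Xlt1 i).
have hto0 : h i @[i --> \oo] --> (0 : R) by exact: cvg_harmonic.
have Xto1 n : X i n @[i --> \oo] --> (1 : R).
  case: n => [|n].
    by under eq_fun do rewrite X0; exact: cvg_cst.
  under eq_fun do rewrite XS.
  have h1 : 1 + h i * y n.+1 @[i --> \oo] --> (1 : R).
    have := cvgD (cvg_cst (1 : R)) (cvgM hto0 (cvg_cst (y n.+1))).
    by rewrite mul0r addr0; exact.
  by have := cvgV (oner_neq0 R) h1; rewrite invr1; exact.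
apply: (cone_lim (F := M)); first by move=> i; case: (HM i).
move=> n _; elim/ltn_ind: n => -[|n] IH.
  rewrite big_ord0 fact0 divr1.
  rewrite (_ : (fun _ => _) = fun=> 1); first exact: cvg_cst.
  by apply/funext => i; case: (HM i).
have ME i : M i n.+1 = \sum_(k < n.+1) 'C(n.+1, k)%:R * h i ^+ (n - k) *
    (X i k * M i k) * ((1 + h i * y n.+1) / y n.+1).
  have [_ _ /(_ n)] := HM i; rewrite XS.
  have -> : 1 - (1 + h i * y n.+1)^-1 = h i * y n.+1 / (1 + h i * y n.+1).
    by field; rewrite gt_eqF.
  move=> E; have hy1 : 0 < h i * y n.+1 by rewrite mulr_gt0.
  have -> : M i n.+1 = (M i n.+1 * (h i * y n.+1 / (1 + h i * y n.+1))) *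
    ((1 + h i * y n.+1) / (h i * y n.+1)).
    by field; rewrite !gt_eqF.
  rewrite E mulr_suml; apply: eq_bigr => k _.
  rewrite subSn; last by rewrite -ltnS.
  by rewrite exprS; field; rewrite !gt_eqF.
under eq_fun do rewrite ME.
pose E k := k`!%:R / \prod_(j < k) y j.+1.
(* As h tends to 0 only the term k = n survives, which gives the recursion E n.+1 = n.+1 E n / y
   n.+1. *)
rewrite (_ : _ / _ = \sum_(k < n.+1) 'C(n.+1, k)%:R * 0 ^+ (n - k) *
    (1 * E k) * ((1 + 0 * y n.+1) / y n.+1)).
  apply: cvg_sum_seq => k _; apply: cvgM; [apply: cvgM; [apply: cvgM|apply: cvgM]|].
  - exact: cvg_cst.
  - apply: (@cvg_comp _ _ _ h (fun a : R => a ^+ (n - k)) _ _ _ hto0).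
    exact: exprn_continuous.
  - exact: Xto1.
  - exact: IH.
  - apply: cvgM; last exact: cvg_cst.
    apply: cvgD; first exact: cvg_cst.
    by apply: cvgM => //; exact: cvg_cst.
rewrite [RHS]big_ord_recr /= [X in _ = X + _]big1 ?add0r; last first.
  move=> k _;rewrite expr0n subn_eq0 leqNgt ltn_ord /=.
  by rewrite mulr0 !mul0r.
rewrite subnn expr0 mulr1 !mul1r mul0r addr0 binSn /E big_ord_recr /= factS natrM.
have P0 : 0 < \prod_(j < n) y j.+1 by apply: prodr_gt0.
by field; rewrite !gt_eqF.
Qed.
End Perpetuity.

(** * Positive definiteness of even series *)

Section RealPositiveDefinite.
Variable R : realType.

Definition rpd (F : R -> R) := forall (n : nat) (t c : 'I_n -> R),
  0 <= \sum_(j < n) \sum_(k < n) F (t j - t k) * c j * c k.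

(** For m n = a^n the form is the square of sum_p a^p v p. *)
Lemma hankel_psd (m : nat -> R) N (v : nat -> R) : moment_cone m ->
  0 <= \sum_(p < N) \sum_(q < N) m (p + q)%N * v p * v q.
Proof.
elim=> {m}[m [a a0 ->]||f g _ IH1 _ IH2|a f a0 _ IH|F f _ IH Ff].
- rewrite (_ : \sum_(p < N) _ = (\sum_(p < N) a ^+ p * v p) ^+ 2); first exact: sqr_ge0.
  rewrite expr2 mulr_suml; apply: eq_bigr => p _; rewrite mulr_sumr.
  by apply: eq_bigr => q _; rewrite exprD; ring.
- by rewrite big1// => p _; rewrite big1// => q _; rewrite !mul0r.
- rewrite (_ : \sum_(p < N) _ = \sum_(p < N) \sum_(q < N) f (p + q)%N * v p * v q +
      \sum_(p < N) \sum_(q < N) g (p + q)%N * v p * v q); first exact: addr_ge0.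
  rewrite -big_split; apply: eq_bigr => p _; rewrite -big_split.
  by apply: eq_bigr => q _ /=; ring.
- rewrite (_ : \sum_(p < N) _ = a * \sum_(p < N) \sum_(q < N) f (p + q)%N * v p * v q).
    exact: mulr_ge0.
  rewrite mulr_sumr; apply: eq_bigr => p _; rewrite mulr_sumr.
  by apply: eq_bigr => q _ /=; ring.
- apply: (@limr_ge0 _ (fun i => \sum_(p < N) \sum_(q < N) F i (p + q)%N * v p * v q)).
    apply: cvg_sum_seq => p _; apply: cvg_sum_seq => q _.
    by do 2! (apply: cvgM; last exact: cvg_cst); exact: Ff.
  exact: nearW.
Qed.

Lemma moment_shift (m : nat -> R) : moment_cone m -> moment_cone (fun n => m n.+1).
Proof.
elim=> {m}[m [a a0 ->]||f g _ IH1 _ IH2|a f a0 _ IH|F f _ IH Ff].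
- apply: cone_ext (cone_scale a0 (moment_geom a0)) => n _.
  by rewrite exprS.
- exact: cone_zero.
- exact: cone_add.
- exact: cone_scale.
- by apply: (cone_lim IH) => n _; exact: Ff.
Qed.

Lemma sum_triangle (F : nat -> nat -> R) M :
  \sum_(r < M) \sum_(p < r.+1) F p (r - p)%N =
  \sum_(p < M) \sum_(q < M | (p + q < M)%N) F p q.
Proof.
transitivity (\sum_(r < M) \sum_(p < M | (p <= r)%N) F p (r - p)%N).
  apply: eq_bigr => r _.
  by rewrite (big_ord_widen_cond M predT (fun p => F p (r - p)%N)).
rewrite (exchange_big_dep predT)//=; apply: eq_bigr => p _.
rewrite -(big_mkord (fun r => (p <= r)%N) (fun r => F p (r - p)%N)).
rewrite -(big_mkord (fun q => (p + q < M)%N) (F p)).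
rewrite (big_cat_nat (n := p))//=; last exact: ltnW.
rewrite big_nat_cond big1 ?add0r; last by move=> i /andP[/andP[_ ip]]; rewrite leqNgt ip.
rewrite [RHS](big_cat_nat (n := (M - p)%N))//= ?leq_subr//.
rewrite [X in _ = _ + X]big_nat_cond [X in _ = _ + X]big1 ?addr0; last first.
  by move=> i /andP[/andP[h1 _] h2]; move: h1 h2 (ltn_ord p); lia.
rewrite big_nat_cond [RHS]big_nat_cond.
rewrite -{1}[nat_of_ord p]add0n big_addn; apply: eq_big => i.
  by move: (ltn_ord p) => pM; apply/idP/idP; lia.
by rewrite addnK.
Qed.

(** The index pairs of the square of side M outside the triangle p + q < M all lie in the triangle p
    + q < 2M. *)
Lemma cauchy_square (F : nat -> nat -> R) M :
  `|\sum_(p < M) \sum_(q < M) F p q - \sum_(r < M) \sum_(p < r.+1) F p (r - p)%N| <=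
  \sum_(r < 2 * M) \sum_(p < r.+1) `|F p (r - p)%N| -
    \sum_(r < M) \sum_(p < r.+1) `|F p (r - p)%N|.
Proof.
rewrite sum_triangle !(sum_triangle (fun p q => `|F p q|)).
apply: (@le_trans _ _ (\sum_(p < M) \sum_(q < M) `|F p q| -
    \sum_(p < M) \sum_(q < M | (p + q < M)%N) `|F p q|)).
  rewrite -!sumrB; apply: (le_trans (ler_norm_sum _ _ _)); apply: ler_sum => p _.
  have canc (u v : R) : u + v - u = v by rewrite addrAC subrr add0r.
  rewrite 2!(bigID (fun q : 'I_M => (p + q < M)%N) predT)/= !canc.
  exact: ler_norm_sum.
rewrite lerD2r.
have MM : (M <= 2 * M)%N by rewrite mul2n -addnn leq_addr.
rewrite (big_ord_widen _ (fun p => \sum_(q < M) `|F p q|) MM).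
rewrite [leRHS](bigID (fun p : 'I_(2 * M) => (p < M)%N))/= ler_wpDr//.
  by apply: sumr_ge0 => p _; apply: sumr_ge0.
apply: ler_sum => p pM; rewrite (big_ord_widen _ (fun q => `|F p q|) MM).
rewrite [leRHS](bigID (fun q : 'I_(2 * M) => (q < M)%N))/= ler_wpDr//.
  by apply: sumr_ge0.
rewrite le_eqVlt; apply/orP; left; apply/eqP; apply: eq_bigl => q.
by apply/idP/andP => [qM|[]//]; split=> //; move: pM qM; lia.
Qed.

End RealPositiveDefinite.

Section EvenSeriesPositiveDefinite.
Variable R : realType.
Variable a : nat -> R.
Hypothesis a0 : forall n, 0 <= a n.
Hypothesis ca : forall x, cvgn (pseries a x).

(** [A] r is the r-th derivative at 0 of t |-> sum_n a n (-t^2)^n, and [F] is the double Taylor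
    expansion of its value at s - t in powers of s and -t. *)
Let A r : R := if odd r then 0 else (-1) ^+ r./2 * (r`!%:R * a r./2).
Let F s t p q : R := A (p + q)%N * (s ^+ p / p`!%:R) * ((- t) ^+ q / q`!%:R).

Let diag s t r : \sum_(p < r.+1) F s t p (r - p)%N = A r / r`!%:R * (s - t) ^+ r.
Proof.
rewrite exprDn mulr_sumr [RHS](reindex_inj rev_ord_inj)/=.
apply: eq_bigr => p _; rewrite /F.
have pr : (p <= r)%N by rewrite -ltnS.
rewrite subSS subnKC// subKn// bin_sub//.
have rf0 : r`!%:R != 0 :> R by rewrite pnatr_eq0 -lt0n fact_gt0.
have pf0 : p`!%:R != 0 :> R by rewrite pnatr_eq0 -lt0n fact_gt0.
have rpf0 : (r - p)`!%:R != 0 :> R by rewrite pnatr_eq0 -lt0n fact_gt0.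
have := bin_fact pr => /(congr1 (fun n => n%:R : R)).
rewrite !natrM => E.
rewrite -mulr_natr -E.
have b0 : 'C(r, p)%:R != 0 :> R by rewrite pnatr_eq0 -lt0n bin_gt0.
by field; rewrite rpf0 pf0 b0.
Qed.

Let A_even n : A (2 * n) = (-1) ^+ n * ((2 * n)`!%:R * a n).
Proof. by rewrite /A mul2n odd_double doubleK. Qed.

Let A_odd n : A (2 * n).+1 = 0.
Proof. by rewrite /A mul2n /= odd_double. Qed.

Let sum2 (f : nat -> R) M : \sum_(r < 2 * M) f r = \sum_(n < M) (f (2 * n)%N + f (2 * n).+1).
Proof.
elim: M => [|M IH]; first by rewrite !big_ord0.
by rewrite mulnS add2n !big_ord_recr /= IH addrA.
Qed.

Let triangle_cvg s t : \sum_(r < 2 * M) \sum_(p < r.+1) F s t p (r - p)%N @[M --> \oo] -->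
  limn (pseries a (- (s - t) ^+ 2)).
Proof.
rewrite (_ : (fun _ => _) = pseries a (- (s - t) ^+ 2)); first exact: ca.
apply/funext => M; rewrite (sum2 (fun r => \sum_(p < r.+1) F s t p (r - p)%N)) /pseries /series /= big_mkord.
apply: eq_bigr => n _; rewrite !diag A_even A_odd !mul0r addr0.
have f0 : (2 * n)`!%:R != 0 :> R by rewrite pnatr_eq0 -lt0n fact_gt0.
rewrite [in RHS]exprNn -exprM; move: ((s - t) ^+ (2 * n)) ((-1) ^+ n) => z z1.
by field.
Qed.

Let abs_cvg s t :
  cvgn (fun M => \sum_(r < 2 * M) \sum_(p < r.+1) `|F s t p (r - p)%N|).
Proof.
rewrite (_ : (fun _ => _) = pseries a ((`|s| + `|t|) ^+ 2)); first exact: ca.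
apply/funext => M; rewrite (sum2 (fun r => \sum_(p < r.+1) `|F s t p (r - p)%N|)) /pseries /series /= big_mkord.
apply: eq_bigr => n _.
have absF p q : `|F s t p q| = `|A (p + q)%N| * (`|s| ^+ p / p`!%:R) *
    ((- - `|t|) ^+ q / q`!%:R).
  rewrite /F !normrM !normfV !normrX normrN opprK.
  by rewrite !(@ger0_norm _ (_ `!)%:R).
rewrite [X in _ + X]big1 ?addr0; last first.
  move=> p _; rewrite absF subnKC; last by rewrite -ltnS.
  by rewrite A_odd normr0 !mul0r.
have f0 : (2 * n)`!%:R != 0 :> R by rewrite pnatr_eq0 -lt0n fact_gt0.
transitivity (a n * \sum_(p < (2 * n).+1) (2 * n)`!%:R * (`|s| ^+ p / p`!%:R) *
    ((- - `|t|) ^+ (2 * n - p) / (2 * n - p)`!%:R)).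
  rewrite mulr_sumr; apply: eq_bigr => p _; rewrite absF subnKC; last by rewrite -ltnS.
  rewrite A_even normrM normrX normrN1 expr1n mul1r.
  by rewrite ger0_norm ?mulr_ge0//; ring.
congr (_ * _); rewrite opprK -exprM exprDn.
rewrite [RHS](reindex_inj rev_ord_inj)/=.
apply: eq_bigr => p _.
have pr : (p <= 2 * n)%N by rewrite -ltnS.
rewrite subSS subKn// bin_sub//.
have pf0 : p`!%:R != 0 :> R by rewrite pnatr_eq0 -lt0n fact_gt0.
have rpf0 : (2 * n - p)`!%:R != 0 :> R by rewrite pnatr_eq0 -lt0n fact_gt0.
have := bin_fact pr => /(congr1 (fun n => n%:R : R)); rewrite !natrM => E.
have f0' : 2%:R * n%:R = 2%:R * n%:R :> R by [].
rewrite -mulr_natr -E.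
by field; rewrite rpf0 pf0.
Qed.

(** The triangular sums converge to the value at s - t, and absolute convergence at (|s| + |t|)^2
    allows squares in place of triangles. *)
Let square_cvg s t : \sum_(p < 2 * M) \sum_(q < 2 * M) F s t p q @[M --> \oo] -->
  limn (pseries a (- (s - t) ^+ 2)).
Proof.
pose T M := \sum_(r < 2 * M) \sum_(p < r.+1) F s t p (r - p)%N.
pose B M := \sum_(r < 2 * M) \sum_(p < r.+1) `|F s t p (r - p)%N|.
have cB := @abs_cvg s t.
have B0 : B (2 * M)%N - B M @[M --> \oo] --> (0 : R).
  have cB2 : B (2 * M)%N @[M --> \oo] --> limn B.
    apply: (@cvg_comp _ _ _ (fun M => (2 * M)%N) B _ _ _ _ cB) => P [N _ NP].
    exists N => // k /= Nk; apply: NP => /=.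
    by rewrite (leq_trans Nk)// mul2n -addnn leq_addr.
  by rewrite -(subrr (limn B)); apply: cvgB.
have D0 : \sum_(p < 2 * M) \sum_(q < 2 * M) F s t p q - T M @[M --> \oo] --> (0 : R).
  apply/cvgr0Pnorm_le => e e0; move/cvgr0_norm_le : B0 => /(_ _ e0).
  apply: filterS => M; apply: le_trans; apply: le_trans (ler_norm _).
  exact: cauchy_square.
rewrite -[limn _]add0r (_ : (fun M => _) = (fun M =>
  (\sum_(p < 2 * M) \sum_(q < 2 * M) F s t p q - T M) + T M)).
  exact: cvgD D0 (@triangle_cvg s t).
by apply/funext => M; rewrite subrK.
Qed.

(** Truncate the double series to a square. As [A] vanishes at odd indices, even and odd powers
    separate, and the form becomes the Hankel form of m at [v] plus that of the shifted sequence at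
    [w]. *)
Lemma even_series_rpd : moment_cone (fun n => (2 * n)`!%:R * a n) ->
  rpd (fun t => limn (pseries a (- t ^+ 2))).
Proof.
move=> mm N t c.
pose m n := (2 * n)`!%:R * a n.
apply: (@limr_ge0 _ (fun M => \sum_(j < N) \sum_(k < N)
   (\sum_(p < 2 * M) \sum_(q < 2 * M) F (t j) (t k) p q) * c j * c k)).
  apply: cvg_sum_seq => j _; apply: cvg_sum_seq => k _.
  by do 2! (apply: cvgM; last exact: cvg_cst); exact: square_cvg.
apply: nearW => M.
(* The factor (-1)^i absorbs the sign (-1)^(i + l) of [A]. *)
pose v i := \sum_(j < N) c j * ((-1) ^+ i * t j ^+ (2 * i) / (2 * i)`!%:R).
pose w i := \sum_(j < N) c j * ((-1) ^+ i * t j ^+ (2 * i).+1 / (2 * i).+1`!%:R).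
rewrite (_ : \sum_(j < N) _ = \sum_(i < M) \sum_(l < M) m (i + l)%N * v i * v l +
    \sum_(i < M) \sum_(l < M) m (i + l).+1 * w i * w l).
  apply: addr_ge0; first exact: (@hankel_psd _ m).
  exact: (@hankel_psd _ (fun n => m n.+1) M w (moment_shift mm)).
pose e p := \sum_(j < N) c j * (t j ^+ p / p`!%:R).
pose e' p := \sum_(j < N) c j * ((- t j) ^+ p / p`!%:R).
transitivity (\sum_(p < 2 * M) \sum_(q < 2 * M) A (p + q)%N * e p * e' q).
  transitivity (\sum_(j < N) \sum_(k < N) \sum_(p < 2 * M) \sum_(q < 2 * M)
      F (t j) (t k) p q * c j * c k).
    apply: eq_bigr => j _; apply: eq_bigr => k _.
    rewrite !mulr_suml; apply: eq_bigr => p _; rewrite !mulr_suml.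
    by apply: eq_bigr.
  transitivity (\sum_(p < 2 * M) \sum_(j < N) \sum_(k < N) \sum_(q < 2 * M)
      F (t j) (t k) p q * c j * c k).
    by rewrite [RHS]exchange_big; apply: eq_bigr => j _; rewrite [RHS]exchange_big.
  apply: eq_bigr => p _.
  transitivity (\sum_(q < 2 * M) \sum_(j < N) \sum_(k < N)
      F (t j) (t k) p q * c j * c k).
    by rewrite [RHS]exchange_big; apply: eq_bigr => j _; rewrite [RHS]exchange_big.
  apply: eq_bigr => q _.
  rewrite /e /e' -mulrA mulr_suml mulr_sumr; apply: eq_bigr => j _.
  rewrite !mulr_sumr; apply: eq_bigr => k _.
  by rewrite /F; ring.
rewrite (sum2 (fun p => \sum_(q < 2 * M) A (p + q)%N * e p * e' q)) -big_split.
apply: eq_bigr => i _ /=.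
rewrite !(sum2 (fun q => A (_ + q)%N * _ * e' q)) -!big_split; apply: eq_bigr => l _ /=.
have s2 k : (-1) ^+ k * (-1) ^+ k = 1 :> R by rewrite -expr2 sqrr_sign.
have e1 k : e (2 * k)%N = (-1) ^+ k * v k.
  rewrite /e /v mulr_sumr; apply: eq_bigr => j _.
  by rewrite [RHS]mulrCA; congr (_ * _); rewrite -!mulrA [RHS]mulrA s2 mul1r.
have e2 k : e' (2 * k)%N = (-1) ^+ k * v k.
  rewrite -e1 /e /e'; apply: eq_bigr => j _.
  by rewrite exprNn exprM sqrrN expr1n expr1n mul1r.
have e3 k : e (2 * k).+1 = (-1) ^+ k * w k.
  rewrite /e /w mulr_sumr; apply: eq_bigr => j _.
  by rewrite [RHS]mulrCA; congr (_ * _); rewrite -!mulrA [RHS]mulrA s2 mul1r.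
have e4 k : e' (2 * k).+1 = - ((-1) ^+ k * w k).
  rewrite -e3 /e /e' -sumrN; apply: eq_bigr => j _.
  by rewrite exprNn exprS exprM sqrrN expr1n expr1n mulr1 mulN1r !mulNr mulrN.
have A0 p : A (2 * p) = (-1) ^+ p * m p.
  exact: A_even.
have A1 := A_odd.
rewrite !addnS !addSn -!mulnDr !A1 !mul0r !addr0 !add0r.
have A2 : A (2 * (i + l)).+2 = A (2 * (i + l).+1) by rewrite mulnS.
rewrite A2 !A0 e1 e2 e3 e4 exprS !exprD.
transitivity (((-1) ^+ i * (-1) ^+ i) * ((-1) ^+ l * (-1) ^+ l) *
  (m (i + l)%N * v i * v l + m (i + l).+1 * w i * w l)); first by ring.
by rewrite !s2 !mul1r.
Qed.

End EvenSeriesPositiveDefinite.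

(** * Lévy–Khintchine functions *)

Section LevyKhintchine.
Variable R : realType.
Variables (kappa a sigma : R) (mu : {measure set (measurableTypeR R) -> \bar R}).
Variable Psi : R -> R.
Let D : set (measurableTypeR R) := `]0%R, +oo[%classic.
Let g u r : R := 1 - expR (- (u * r)) - u * r * ((r : R) < 1)%R%:R.
Hypothesis kappa0 : 0 <= kappa.
Hypothesis levy_mu : levy_measure mu.
Hypothesis PsiE : forall u : R, 0 <= u -> Psi u = - kappa + a * u + 2^-1 * sigma ^+ 2 * u ^+ 2
   - \int[mu]_(r in D) g u r.

Let mD : measurable D. Proof. exact: measurable_itv. Qed.

Lemma measurable_ltr1 : measurable_fun setT (fun r : R => (r < 1)%R%:R : R).
Proof.
rewrite (_ : (fun _ => _) = \1_(`]-oo, 1[%classic)).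
  by apply: measurable_indic; exact: measurable_itv.
apply/funext => r; rewrite indicE; congr (_%:R); congr nat_of_bool.
by apply/idP/idP; rewrite inE/= in_itv.
Qed.

Lemma measurable_expRN u : measurable_fun setT (fun r : R => expR (- (u * r))).
Proof.
apply: measurableT_comp => //; apply: measurableT_comp => //.
Qed.

Let mg u : measurable_fun setT (g u).
Proof.
apply: measurable_funB; first apply: measurable_funB => //.
  exact: measurable_expRN.
by apply: measurable_funM; [apply: measurable_funM|exact: measurable_ltr1].
Qed.

Let min1 : mu.-integrable D (fun r => (Num.min 1 (r ^+ 2))%:E).
Proof.
apply/integrableP; split.
  apply/measurable_EFinP; apply: measurable_funTS.
  by apply: measurable_minr => //; apply: measurable_funX.
case: levy_mu => _; apply: le_lt_trans; apply: ge0_le_integral => //.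
- apply: measurableT_comp => //; apply/measurable_EFinP; apply: measurable_funTS.
  by apply: measurable_minr => //; apply: measurable_funX.
- apply/measurable_EFinP; apply: measurable_funTS.
  by apply: measurable_minr => //; apply: measurable_funX.
- by move=> r _; rewrite lee_fin ger0_norm// le_min ler01 sqr_ge0.
Qed.

Lemma expRN_le_quad (y : R) : 0 <= y -> expR (- y) <= 1 - y + y ^+ 2.
Proof.
move=> y0; rewrite expRN; have h := expR_ge1Dx y.
have y1 : 0 < 1 + y by rewrite ltr_wpDr.
apply: (@le_trans _ _ (1 + y)^-1); first by rewrite lef_pV2 ?posrE ?expR_gt0.
rewrite -[leLHS]mul1r ler_pdivrMr//.
have -> : (1 - y + y ^+ 2) * (1 + y) = 1 + y ^+ 3 by ring.
by rewrite lerDl exprn_ge0.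
Qed.

(** Second-order Taylor bound below 1, boundedness above 1. Uniformity in u <= U makes it a
    dominating function for continuity under the integral sign. *)
Lemma levy_integrand_bound U u r : 0 <= u <= U -> 0 < r ->
  `|g u r| <= (1 + U ^+ 2) * Num.min 1 (r ^+ 2).
Proof.
move=> /andP[u0 uU] r0; rewrite /g.
have ur0 : 0 <= u * r by rewrite mulr_ge0// ltW.
have U0 := le_trans u0 uU.
have [r1|r1] := ltP r 1.
  rewrite mulr1 min_r; last by rewrite expr_le1// ltW.
  rewrite ler0_norm; last first.
    by have := expR_ge1Dx (- (u * r)); lra.
  have := expRN_le_quad ur0.
  have : (u * r) ^+ 2 <= U ^+ 2 * r ^+ 2.
    by rewrite exprMn ler_wpM2r ?sqr_ge0// ler_sqr.
  have := sqr_ge0 r; nra.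
rewrite mulr0 subr0 min_l; last by rewrite expr_ge1// ltW.
rewrite mulr1 ger0_norm ?subr_ge0; last by rewrite expR_le1; lra.
by have := expR_gt0 (- (u * r)); have := sqr_ge0 U; lra.
Qed.

Let ig U : mu.-integrable D (fun r => ((1 + U ^+ 2) * Num.min 1 (r ^+ 2))%:E).
Proof.
under eq_fun do rewrite EFinM.
exact: integrableZl.
Qed.

Lemma levy_integrable u : 0 <= u -> mu.-integrable D (EFin \o g u).
Proof.
move=> u0; apply: (le_integrable mD _ _ (ig u)).
  by apply/measurable_EFinP; exact: measurable_funTS (mg u).
move=> r; rewrite /D /= in_itv /= andbT => r0.
rewrite lee_fin [leRHS]ger0_norm; last first.
  by rewrite mulr_ge0// ?addr_ge0// ?sqr_ge0// le_min ler01 sqr_ge0.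
by apply: levy_integrand_bound => //; rewrite u0 lexx.
Qed.

Lemma levy_sum n (w u : 'I_n -> R) : (forall i, 0 <= u i) ->
  mu.-integrable D (EFin \o (fun r => \sum_(i < n) w i * g (u i) r)) /\
  \sum_(i < n) w i * Psi (u i) = - kappa * \sum_(i < n) w i +
    a * \sum_(i < n) w i * u i +
    2^-1 * sigma ^+ 2 * \sum_(i < n) w i * u i ^+ 2 -
    \int[mu]_(r in D) (\sum_(i < n) w i * g (u i) r).
Proof.
move=> u0.
suff [H1 H2] : mu.-integrable D (EFin \o (fun r => \sum_(i < n) w i * g (u i) r)) /\
    \int[mu]_(r in D) (\sum_(i < n) w i * g (u i) r) =
    \sum_(i < n) w i * \int[mu]_(r in D) g (u i) r.
  split => //; rewrite H2 !mulr_sumr -!big_split -sumrB /=; apply: eq_bigr => i _.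
  by rewrite PsiE//; ring.
have iw i : mu.-integrable D (EFin \o (fun r => w i * g (u i) r)).
  have := integrableZl mD (w i) (levy_integrable (u0 i)).
  by under eq_fun do rewrite -EFinM.
elim: (index_enum _) => [|i s [IH1 IH2]].
  rewrite big_nil; split.
    rewrite (_ : _ \o _ = cst 0%E); first exact: integrable0.
    by apply/funext => r /=; rewrite big_nil.
  rewrite (_ : (fun _ => _) = cst 0); first by rewrite Rintegral_cst// mul0r.
  by apply/funext => r; rewrite big_nil.
have E : (fun r => \sum_(j <- i :: s) w j * g (u j) r) =
    (fun r => w i * g (u i) r + \sum_(j <- s) w j * g (u j) r).
  by apply/funext => r; rewrite big_cons.
rewrite E; split.
  have := integrableD mD (iw i) IH1.
  by rewrite (_ : (_ \+ _)%E = EFin \o (fun r => w i * g (u i) r + \sum_(j <- s) w j * g (u j) r)).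
rewrite RintegralD// IH2 big_cons; congr (_ + _).
by rewrite RintegralZl//; exact: levy_integrable.
Qed.

(** The conditions on the weights cancel kappa, the drift and the compensator; the Gaussian term and
    the integral of sum_i w i exp(-u i r) remain, both nonnegative. *)
Lemma levy_positive n (w u : 'I_n -> R) : (forall i, 0 <= u i) ->
  \sum_(i < n) w i = 0 -> \sum_(i < n) w i * u i = 0 ->
  0 <= \sum_(i < n) w i * u i ^+ 2 ->
  (forall r, 0 < r -> 0 <= \sum_(i < n) w i * expR (- (u i * r))) ->
  0 <= \sum_(i < n) w i * Psi (u i).
Proof.
move=> u0 w0 wu0 wu2 we; have [H ->] := levy_sum w u0.
rewrite w0 wu0 !mulr0 !add0r -mulN1r -RintegralZl//.
apply: addr_ge0; first by rewrite mulr_ge0// mulr_ge0// ?invr_ge0// sqr_ge0.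
apply: Rintegral_ge0 => r; rewrite /D /= in_itv/= andbT => r0.
rewrite mulN1r oppr_ge0 (_ : \sum_(i < n) _ = \sum_(i < n) w i - \sum_(i < n) w i * expR (- (u i * r)) -
   (\sum_(i < n) w i * u i) * (r * (r < 1)%R%:R)).
  by rewrite w0 wu0 mul0r subr0 sub0r oppr_le0; exact: we.
rewrite mulr_suml -!sumrB; apply: eq_bigr => i _.
by rewrite /g; ring.
Qed.

Lemma levy_continuous : continuous (fun u : R => Psi `|u|).
Proof.
move=> u0.
rewrite (_ : (fun _ => _) = fun u : R => (- kappa + a * `|u| + 2^-1 * sigma ^+ 2 * `|u| ^+ 2)
   - \int[mu]_(r in D) g `|u| r); last by apply/funext => u; rewrite PsiE.
have cn : `|x| @[x --> u0] --> `|u0| by exact: norm_continuous.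
apply: cvgB.
  apply: cvgD; first apply: cvgD; first exact: cvg_cst.
    by apply: cvgM => //; exact: cvg_cst.
  apply: cvgM; first exact: cvg_cst.
  by rewrite expr2; under eq_fun do rewrite expr2; exact: cvgM.
pose U := `|u0| + 1.
apply: (@continuity_under_integral _ _ _ mu (fun u => g `|u|) D mD (- U) U _ _
   (fun r => (1 + U ^+ 2) * Num.min 1 (r ^+ 2))).
- by move=> u _; exact: levy_integrable.
- apply: aeW => r _ u _; rewrite /g.
  have cu : `|x| @[x --> u] --> `|u| by exact: norm_continuous.
  apply: cvgB; last by do 2! (apply: cvgM; last exact: cvg_cst).
  apply: cvgB; first exact: cvg_cst.
  apply: continuous_cvg; first exact: continuous_expR.
  by apply: cvgN; apply: cvgM => //; exact: cvg_cst.
- exact: ig.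
- move=> u; rewrite /= in_itv /= => /andP[u1 u2].
  apply: aeW => r; rewrite /D /= in_itv/= andbT => r0.
  apply: levy_integrand_bound => //; rewrite normr_ge0 ler_norml.
  by rewrite !ltW.
- rewrite inE /= in_itv /= /U; apply/andP; split.
    by rewrite ltrNl ltr_pwDr// -normrN ler_norm.
  by rewrite ltr_pwDr// ler_norm.
Qed.

End LevyKhintchine.

Section FatouLim.
Local Open Scope ereal_scope.
Context d (T : measurableType d) (R : realType).
Variables (mu : {measure set T -> \bar R}) (D : set T) (mD : measurable D).

Lemma fatou_lim (f : nat -> T -> \bar R) (F : T -> \bar R) (v : nat -> \bar R) l :
  (forall n, measurable_fun D (f n)) -> (forall n x, D x -> 0 <= f n x) ->
  (forall x, D x -> f n x @[n --> \oo] --> F x) ->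
  (forall n, \int[mu]_(x in D) f n x <= v n) -> v n @[n --> \oo] --> l ->
  \int[mu]_(x in D) F x <= l.
Proof.
move=> mf f0 fF fv vl.
rewrite (_ : \int[mu]_(x in D) F x = \int[mu]_(x in D) limn_einf (f ^~ x)); last first.
  apply: eq_integral => x; rewrite inE => Dx.
  by rewrite is_cvg_limn_einfE; [rewrite (cvg_lim _ (fF x Dx))|apply/cvg_ex; exists (F x); exact: fF].
apply: (le_trans (fatou mu mD mf f0)).
rewrite limn_einf_lim -(cvg_lim _ vl)//; apply: lee_lim.
- exact: is_cvg_einfs.
- by apply/cvg_ex; exists l.
- apply: nearW => n; apply: le_trans (fv n).
  by rewrite /einfs; apply: ereal_inf_lbound; exists n => /=.
Qed.
End FatouLim.

Section LevyKhintchine.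
Variable R : realType.
Variables (kappa a sigma : R) (mu : {measure set (measurableTypeR R) -> \bar R}).
Variable Psi : R -> R.
Let D : set (measurableTypeR R) := `]0%R, +oo[%classic.
Let g u r : R := 1 - expR (- (u * r)) - u * r * ((r : R) < 1)%R%:R.
Hypothesis kappa0 : 0 <= kappa.
Hypothesis sigma0 : 0 <= sigma.
Hypothesis levy_mu : levy_measure mu.
Hypothesis PsiE : forall u : R, 0 <= u -> Psi u = - kappa + a * u + 2^-1 * sigma ^+ 2 * u ^+ 2
   - \int[mu]_(r in D) g u r.

Let mD : measurable D. Proof. exact: measurable_itv. Qed.
Let A : set (measurableTypeR R) := `]0%R, 1%R[%classic.
Let B : set (measurableTypeR R) := `[1%R, +oo[%classic.
Let mA : measurable A. Proof. exact: measurable_itv. Qed.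
Let mB : measurable B. Proof. exact: measurable_itv. Qed.
Let ABD : A `|` B = D.
Proof.
apply/seteqP; split => r; rewrite /A /B /D /= !in_itv /= !andbT.
  by move=> [/andP[]//|]; apply: lt_le_trans.
by move=> r0; have [r1|r1] := ltP r 1; [left; rewrite r0|right].
Qed.
Let AB : [disjoint A & B].
Proof.
apply/disj_setPLR => r; rewrite /A /B /= !in_itv /= andbT.
by move=> /andP[_ r1]; apply/negP; rewrite -ltNge.
Qed.

Let ig u : 0 <= u -> mu.-integrable D (EFin \o g u).
Proof. by move=> u0; exact: levy_integrable. Qed.

Let mmin : measurable_fun setT (fun r : R => (Num.min 1 (r ^+ 2))%:E).
Proof. by apply/measurable_EFinP; apply: measurable_minr => //; apply: measurable_funX. Qed.

Let muB : (mu B < +oo)%E.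
Proof.
case: levy_mu => _; apply: le_lt_trans.
rewrite -[mu B]mul1e -integral_cst// -/D -ABD.
apply: (@le_trans _ _ (\int[mu]_(r in B) (Num.min 1 (r ^+ 2))%:E)%E).
  apply: ge0_le_integral => //.
  - exact: measurable_funTS.
  - move=> r; rewrite /B /= in_itv /= andbT => r1.
    by rewrite lee_fin min_l// expr_ge1// (le_trans _ r1).
apply: ge0_subset_integral => //.
- exact: measurableU.
- exact: measurable_funTS.
- by move=> r _; rewrite lee_fin le_min ler01 sqr_ge0.
Qed.

Let M := fine (mu B).

(** Jumps above 1 contribute at most their finite mass [M], so Psi u <= 0 bounds the contribution of
    the jumps below 1. *)
Lemma levy_small_jumps u : 0 <= u -> Psi u <= 0 ->
  (\int[mu]_(r in A) (- g u r)%:E <=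
    (kappa + M - a * u - 2^-1 * sigma ^+ 2 * u ^+ 2)%:E)%E.
Proof.
move=> u0 Pu.
have igA : mu.-integrable A (EFin \o g u).
  by apply: (integrableS mD) (ig u0) => //; rewrite -ABD; exact: subsetUl.
have igB : mu.-integrable B (EFin \o g u).
  by apply: (integrableS mD) (ig u0) => //; rewrite -ABD; exact: subsetUr.
have E : \int[mu]_(r in D) g u r = \int[mu]_(r in A) g u r + \int[mu]_(r in B) g u r.
  rewrite -Rintegral_setU// ?ABD//; exact: ig.
have LB : \int[mu]_(r in B) g u r <= M.
  apply: (@le_trans _ _ (\int[mu]_(r in B) (cst 1 r))).
    apply: le_Rintegral => //.
      apply/integrableP; split; first by apply/measurable_EFinP; exact: measurable_cst.
      rewrite (eq_integral (cst 1%E)); first by rewrite integral_cst// mul1e.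
      by move=> r _; rewrite /= normr1.
    move=> r; rewrite /B /= in_itv /= andbT => r1.
    rewrite /g ltNge r1 /= mulr0 subr0 lerBlDr lerDl; exact: expR_ge0.
  by rewrite Rintegral_cst// mul1r.
have -> : (\int[mu]_(r in A) (- g u r)%:E)%E = (- \int[mu]_(r in A) g u r)%:E.
  have iN : mu.-integrable A (fun r => (-1 * g u r)%:E).
    have := integrableZl mA (-1) igA.
    by under eq_fun do rewrite -EFinM.
  transitivity (\int[mu]_(r in A) (-1 * g u r)%:E)%E.
    by apply: eq_integral => r _; rewrite mulN1r.
  rewrite -[LHS]fineK; last exact: integrable_fin_num.
  by rewrite -/(Rintegral _ _ _) RintegralZl// mulN1r.
rewrite lee_fin; move: Pu; rewrite PsiE// E; lra.
Qed.

Lemma levy_small_jumps_ge0 u r : 0 <= u -> A r -> 0 <= - g u r.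
Proof.
rewrite /A /= in_itv /= => u0 /andP[r0 r1].
by rewrite /g r1 mulr1; have := expR_ge1Dx (- (u * r)); lra.
Qed.

(** If Psi never becomes positive, the quadratic term must vanish, and dividing by u and letting u
    grow gives, by Fatou, int_0^1 r mu(dr) <= -a. This is the case that [classN] excludes. *)
Lemma levy_nonpos_degenerate : (forall u, 0 < u -> Psi u <= 0) ->
  [/\ sigma = 0,
      (a%:E + \int[mu]_(r in `]0%R, 1%R[) (r : R)%:E <= 0)%E
    & (\int[mu]_(r in `]0%R, +oo[) (Num.min 1 r)%:E < +oo)%E].
Proof.
move=> P0.
have M0 : 0 <= M by rewrite fine_ge0.
have bnd u : 0 < u -> (\int[mu]_(r in A) (- g u r)%:E <=
    (kappa + M - a * u - 2^-1 * sigma ^+ 2 * u ^+ 2)%:E)%E.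
  by move=> u0; apply: levy_small_jumps; [exact: ltW|exact: P0].
have bnd0 u : 0 < u -> 2^-1 * sigma ^+ 2 * u ^+ 2 <= kappa + M - a * u.
  move=> u0; rewrite -subr_ge0 -lee_fin; apply: le_trans (bnd u u0).
  by apply: integral_ge0 => r Ar; rewrite lee_fin levy_small_jumps_ge0// ltW.
have s0 : sigma = 0.
  apply/eqP; rewrite eq_le sigma0 andbT leNgt; apply/negP => sp.
  pose s := 2^-1 * sigma ^+ 2.
  have sgt : 0 < s by rewrite mulr_gt0 ?invr_gt0// exprn_gt0.
  (* At u = K/s + 1 the quadratic term is at least K u, which exceeds kappa + M - a u. *)
  pose K := `|a| + kappa + M + 1.
  have K1 : 1 <= K by rewrite /K; have := normr_ge0 a; move: kappa0 M0; lra.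
  have u1 : 1 <= K / s + 1 by rewrite lerDr divr_ge0 ?ltW//; lra.
  have u0 : 0 < K / s + 1 by lra.
  have := bnd0 _ u0; rewrite -/s.
  set u := K / s + 1 in u1 u0 *.
  have su : K <= s * u by rewrite /u mulrDr mulr1 mulrC divfK ?gt_eqF// lerDl ltW.
  have : K * u <= s * u ^+ 2 by rewrite expr2 mulrA ler_wpM2r// ltW.
  have : - a * u <= `|a| * u by rewrite (ler_wpM2r (ltW u0))// -[`|a|]normrN ler_norm.
  have : kappa + M + 1 <= (kappa + M + 1) * u by rewrite ler_peMr//; move: kappa0 M0; lra.
  by rewrite /K; nra.
have IA : (\int[mu]_(r in A) (r : R)%:E <= (- a)%:E)%E.
  apply: (@fatou_lim _ _ _ mu A mA (fun n r => (- g n.+1%:R r / n.+1%:R)%:E) _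
    (fun n => ((kappa + M) / n.+1%:R - a)%:E)).
  - move=> n; apply/measurable_EFinP; apply: measurable_funM => //.
    apply: measurable_funN; apply/measurable_EFinP.
    by apply: measurable_int (integrableS mD mA _ (ig _)) => //; rewrite -ABD; exact: subsetUl.
  - by move=> n r Ar; rewrite lee_fin divr_ge0// levy_small_jumps_ge0.
  - move=> r Ar; apply: cvg_EFin; first exact: nearW.
    have E n : fine (- g n.+1%:R r / n.+1%:R)%:E =
       r - (1 - expR (- (n.+1%:R * r))) / n.+1%:R.
      move: Ar; rewrite /A /= in_itv /= => /andP[r0 r1].
      have : n.+1%:R != 0 :> R by rewrite pnatr_eq0.
      by rewrite /g r1 mulr1 /=; move: (n.+1%:R) => y y0; field.
    rewrite (_ : _ \o _ = fun n => r - (1 - expR (- (n.+1%:R * r))) / n.+1%:R); last first.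
      by apply/funext => n; rewrite -E.
    suff h : (1 - expR (- (n.+1%:R * r))) / n.+1%:R @[n --> \oo] --> (0 : R).
      by have := cvgB (cvg_cst r) h; rewrite subr0; exact.
    apply: (@squeeze_cvgr _ _ _ _ (fun=> 0) (fun n => n.+1%:R^-1)).
    + apply: nearW => n; move: Ar; rewrite /A /= in_itv /= => /andP[r0 r1].
      have nr : 0 <= n.+1%:R * r by rewrite mulr_ge0// ltW.
      rewrite divr_ge0 ?subr_ge0 ?expR_le1 ?oppr_le0//=.
      rewrite ler_pdivrMr// mulVf ?pnatr_eq0// lerBlDr lerDl; exact: expR_ge0.
    + exact: cvg_cst.
    + exact: cvg_harmonic.
  - move=> n; have n0 : 0 < n.+1%:R :> R by rewrite ltr0n.
    have := bnd _ n0; rewrite s0 expr0n /= mulr0 mul0r subr0 => h.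
    rewrite (_ : \int[mu]_(x in A) _ = (n.+1%:R^-1)%:E * \int[mu]_(r in A) (- g n.+1%:R r)%:E)%E.
      rewrite (_ : (kappa + M) / _ - a = n.+1%:R^-1 * (kappa + M - a * n.+1%:R)); last first.
        by move: (n.+1%:R) n0 => y y0; field; rewrite gt_eqF.
      by rewrite EFinM lee_pmul2l// lte_fin invr_gt0.
    rewrite -ge0_integralZl//.
    + by apply: eq_integral => r _; rewrite -EFinM mulrC.
    + apply/measurable_EFinP; apply: measurable_funN; apply/measurable_EFinP.
      by apply: measurable_int (integrableS mD mA _ (ig _)) => //; rewrite -ABD; exact: subsetUl.
    + by move=> r Ar; rewrite lee_fin levy_small_jumps_ge0.
  - apply: cvg_EFin; first exact: nearW.
    rewrite (_ : _ \o _ = fun n => (kappa + M) / n.+1%:R - a)//.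
    have := cvgB (cvgM (cvg_cst (kappa + M)) (@cvg_harmonic R)) (cvg_cst a).
    by rewrite mulr0 sub0r; exact.
split => //.
  by rewrite -/A (le_trans (leeD2l _ IA))// -EFinD subrr.
rewrite -/D -ABD ge0_integral_setU//.
- rewrite lte_add_pinfty//.
    apply: (@le_lt_trans _ _ (\int[mu]_(r in A) (r : R)%:E)%E).
      apply: ge0_le_integral => //.
      + move=> r; rewrite /A /= in_itv /= => /andP[r0 _].
        by rewrite lee_fin le_min ler01 ltW.
      + by apply/measurable_EFinP; apply: measurable_funTS; apply: measurable_minr.
      + by move=> r _; rewrite lee_fin ge_min lexx orbT.
    by apply: (le_lt_trans IA); rewrite ltry.
  apply: le_lt_trans muB; rewrite -[mu B]mul1e -integral_cst//.
  apply: ge0_le_integral => //.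
  + move=> r; rewrite /B /= in_itv /= andbT => r1.
    by rewrite lee_fin le_min ler01 (le_trans _ r1).
  + by apply/measurable_EFinP; apply: measurable_funTS; apply: measurable_minr.
  + by move=> r _; rewrite lee_fin ge_min lexx.
- by apply/measurable_EFinP; apply: measurable_funTS; apply: measurable_minr.
- move=> r; rewrite ABD /D /= in_itv /= andbT => r0.
  by rewrite lee_fin le_min ler01 ltW.
Qed.

(** In g 2 r - 2 g 1 r the compensators cancel and -(1 - exp(-r))^2 is left. *)
Lemma levy_two_points :
  mu.-integrable D (fun r => ((1 - expR (- r)) ^+ 2)%:E) /\
  Psi 2 - 2 * Psi 1 = kappa + sigma ^+ 2 + \int[mu]_(r in D) (1 - expR (- r)) ^+ 2.
Proof.
pose w (i : 'I_2) : R := if val i == 0%N then 1 else -2.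
pose u (i : 'I_2) : R := if val i == 0%N then 2 else 1.
have u0 i : 0 <= u i by rewrite /u; case: ifP.
have [H E] := levy_sum levy_mu PsiE w u0.
have gE : (fun r => \sum_(i < 2) w i * g (u i) r) = fun r => -1 * (1 - expR (- r)) ^+ 2.
  apply/funext => r; rewrite !big_ord_recl !big_ord0 /w /u /g /= !mul1r addr0.
  have -> : expR (- (2 * r)) = expR (- r) ^+ 2.
    by rewrite -expRM_natr; congr expR; ring.
  by ring.
rewrite -/g gE in H E.
have H' : mu.-integrable D (fun r => ((1 - expR (- r)) ^+ 2)%:E).
  have := integrableZl mD (-1) H.
  by under eq_fun do rewrite -EFinM mulrA mulrNN !mul1r.
have E' : \int[mu]_(r in D) (-1 * (1 - expR (- r)) ^+ 2) =
    - \int[mu]_(r in D) (1 - expR (- r)) ^+ 2.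
  by rewrite RintegralZl// mulN1r.
rewrite E' opprK in E; split => //.
have -> : Psi 2 - 2 * Psi 1 = \sum_(i < 2) w i * Psi (u i).
  by rewrite !big_ord_recl big_ord0 /w /u /=; ring.
by rewrite E !big_ord_recl !big_ord0 /w /u /=; field.
Qed.

Lemma levy_two_points_ge0 : 0 <= Psi 2 - 2 * Psi 1.
Proof.
have [H ->] := levy_two_points.
apply: addr_ge0; first by rewrite addr_ge0// sqr_ge0.
by apply: Rintegral_ge0 => r _; exact: sqr_ge0.
Qed.

(** The three nonnegative terms of [levy_two_points] all vanish, and the strict positivity of (1 -
    exp(-r))^2 for r > 0 leaves no jumps. *)
Lemma levy_rigidity : Psi 2 = 2 * Psi 1 -> forall u, 0 <= u -> Psi u = a * u.
Proof.
move=> P21; have [H' E] := levy_two_points; rewrite P21 subrr in E.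
have I0 : 0 <= \int[mu]_(r in D) (1 - expR (- r)) ^+ 2.
  by apply: Rintegral_ge0 => r _; exact: sqr_ge0.
have s2 := sqr_ge0 sigma.
have k0 : kappa = 0 by move: E kappa0 I0 s2; lra.
have sg0 : sigma ^+ 2 = 0 by move: E kappa0 I0 s2; lra.
have iz : \int[mu]_(r in D) (1 - expR (- r)) ^+ 2 = 0 by move: E kappa0 I0 s2; lra.
have ae0 : ae_eq mu D (fun r => ((1 - expR (- r)) ^+ 2)%:E) (cst 0%E).
  apply/ae_eq_integral_abs => //; first exact: measurable_int H'.
  under eq_integral do rewrite abse_EFin (ger0_norm (sqr_ge0 _)).
  have := integrable_fin_num mD H' => fi.
  by rewrite -(fineK fi) -/(Rintegral _ _ _) iz.
move=> u u0; rewrite PsiE// k0 sg0 oppr0 mulr0 mul0r add0r addr0.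
rewrite (_ : \int[mu]_(r in D) g u r = 0) ?subr0//.
rewrite /Rintegral (ae_eq_integral (cst 0%E))//; first by rewrite integral0.
- exact: measurable_int (ig u0).
- apply: filterS ae0 => r h Dr; have := h Dr.
  move=> /= [] /eqP; rewrite sqrf_eq0 subr_eq0 => /eqP e.
  have : expR (- r) < 1.
    by move: Dr; rewrite /D /= in_itv /= andbT => r0; rewrite expR_lt1 oppr_lt0.
  by rewrite -e ltxx.
Qed.

End LevyKhintchine.

(** * Riemann sums of exponentials *)

Section ExponentialAverages.
Variable R : realType.

Lemma expR_slope_cvg (v r : R) : 0 < r ->
  (1 - expR (- (v * (r / n.+1%:R)))) / (r / n.+1%:R) @[n --> \oo] --> v.
Proof.
move=> r0; pose h n : R := r / n.+1%:R.
have h0 n : 0 < h n by rewrite divr_gt0.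
have hc : h n @[n --> \oo] --> (0 : R).
  have := cvgM (cvg_cst r) (@cvg_harmonic R); rewrite mulr0; exact.
have vh : 1 + v * h n @[n --> \oo] --> (1 : R).
  by have := cvgD (cvg_cst (1 : R)) (cvgM (cvg_cst v) hc); rewrite mulr0 addr0; exact.
apply: (@squeeze_cvgr _ _ _ _ (fun n => v / (1 + v * h n)) (fun n => v)).
- near=> n; rewrite -/(h n).
  have p1 : 0 < 1 + v * h n by near: n; apply: (cvgr_gt _ vh); exact: ltr01.
  apply/andP; split.
    rewrite ler_pdivlMr// mulrAC ler_pdivrMr//.
    have : expR (- (v * h n)) <= (1 + v * h n)^-1.
      by rewrite expRN lef_pV2 ?posrE ?expR_gt0// expR_ge1Dx.
    rewrite -[(_)^-1]mul1r ler_pdivlMr//; lra.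
  rewrite ler_pdivrMr//.
  by have := expR_ge1Dx (- (v * h n)); lra.
- by have := cvgM (cvg_cst v) (cvgV (oner_neq0 R) vh); rewrite invr1 mulr1; exact.
- exact: cvg_cst.
Unshelve. all: by end_near.
Qed.

(** Riemann sums, here geometric, of the integral of exp(-v s) over [0, r]. They place this integral
    in cones generated by exponentials without integrating cone members. *)
Lemma expR_average_cvg (v r : R) : v != 0 -> 0 < r ->
  r / n.+1%:R * \sum_(j < n.+1) expR (- (v * (j%:R * (r / n.+1%:R)))) @[n --> \oo] -->
  (1 - expR (- (v * r))) / v.
Proof.
move=> v0 r0.
have E n : r / n.+1%:R * \sum_(j < n.+1) expR (- (v * (j%:R * (r / n.+1%:R)))) =
   (1 - expR (- (v * r))) / ((1 - expR (- (v * (r / n.+1%:R)))) / (r / n.+1%:R)).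
  set h := r / n.+1%:R.
  have h0 : 0 < h by rewrite divr_gt0.
  pose q := expR (- (v * h)).
  have q1 : 1 - q != 0.
    rewrite subr_eq0 /q -expR0 eq_sym (inj_eq (@expR_inj R)) oppr_eq0 mulf_neq0//.
    by rewrite gt_eqF.
  have -> : \sum_(j < n.+1) expR (- (v * (j%:R * h))) = \sum_(j < n.+1) q ^+ j.
    apply: eq_bigr => j _; rewrite /q -expRM_natl.
    by congr expR; rewrite mulrN mulrCA mulr_natl.
  have -> : expR (- (v * r)) = q ^+ n.+1.
    have : n.+1%:R != 0 :> R by rewrite pnatr_eq0.
    rewrite /q -expRM_natl /h; move: (n.+1%:R) => y y0; congr expR.
    by field.
  have -> : 1 - q ^+ n.+1 = (1 - q) * \sum_(j < n.+1) q ^+ j.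
    by rewrite -opprB subrX1 -mulNr opprB.
  rewrite -/q; move: (\sum_(j < _) _) => s.
  by field; rewrite q1 gt_eqF.
under eq_fun do rewrite E.
apply: cvgM; first exact: cvg_cst.
by apply: cvgV => //; exact: expR_slope_cvg.
Qed.

End ExponentialAverages.

(** * Zeros, differences and the Wiener-Hopf factor of Psi *)

Section LaplaceExponents.
Variable R : realType.
Variable Psi : R -> R.

(* Second and higher alternating differences, convexity, and divided
   differences at a zero all are instances of this positivity. *)
Definition levy_pos (f : R -> R) := forall n (w u : 'I_n -> R), (forall i, 0 <= u i) ->
  \sum_(i < n) w i = 0 -> \sum_(i < n) w i * u i = 0 ->
  0 <= \sum_(i < n) w i * u i ^+ 2 ->
  (forall r, 0 < r -> 0 <= \sum_(i < n) w i * expR (- (u i * r))) ->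
  0 <= \sum_(i < n) w i * f (u i).

Hypothesis pos : levy_pos Psi.
Hypothesis Psi0 : Psi 0 <= 0.
Hypothesis cPsi : continuous (fun u : R => Psi `|u|).
Variable u1 : R.
Hypothesis u1_gt0 : 0 < u1.
Hypothesis Psi_u1 : 0 < Psi u1.

(** Psi is convex with Psi 0 <= 0, so Psi u / u is nondecreasing. The weights are those of the
    convexity inequality at 0, x, y. *)
Lemma levy_star x y : 0 <= x -> x <= y -> y * Psi x <= x * Psi y.
Proof.
move=> x0 xy; have y0 := le_trans x0 xy.
pose w (i : 'I_3) : R := nth 0 [:: y - x; - y; x] i.
pose u (i : 'I_3) : R := nth 0 [:: 0; x; y] i.
have : 0 <= \sum_(i < 3) w i * Psi (u i).
  apply: pos.
  - by case=> -[|[|[|]]].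
  - by rewrite !big_ord_recl big_ord0 /w /=; ring.
  - by rewrite !big_ord_recl big_ord0 /w /u /=; ring.
  - rewrite !big_ord_recl big_ord0 /w /u /=.
    rewrite (_ : _ + _ = x * y * (y - x)); last by ring.
    by rewrite mulr_ge0 ?mulr_ge0 ?subr_ge0.
  - move=> r r0; rewrite !big_ord_recl big_ord0 /w /u /= mul0r oppr0 expR0 addr0 mulr1.
    (* The tangent at x to s |-> exp(-s r), evaluated at 0 and at y. *)
    have h1 := expR_ge1Dx (x * r).
    have h2 := expR_ge1Dx (- (y - x) * r).
    have ep := expR_gt0 (- (x * r)).
    have E1 : expR (- (x * r)) * expR (x * r) = 1 by rewrite -expRD addNr expR0.
    have E2 : expR (- (y * r)) = expR (- (x * r)) * expR (- (y - x) * r).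
      by rewrite -expRD; congr expR; ring.
    have k1 : expR (- (x * r)) * (1 + x * r) <= 1 by rewrite -[leRHS]E1 ler_pM2l.
    have k2 : expR (- (x * r)) * (1 + - (y - x) * r) <= expR (- (y * r)).
      by rewrite E2 ler_pM2l.
    have yx : 0 <= y - x by rewrite subr_ge0.
    have := ler_wpM2l yx k1; have := ler_wpM2l x0 k2; nra.
rewrite !big_ord_recl big_ord0 /w /u /= => h.
have : (y - x) * Psi 0 <= 0 by rewrite mulr_ge0_le0 ?subr_ge0.
by move: h; lra.
Qed.

Lemma levy_pos_beyond u : u1 <= u -> 0 < Psi u.
Proof.
move=> uu; have := levy_star (ltW u1_gt0) uu.
have u0 : 0 < u by exact: lt_le_trans uu.
move=> h; rewrite -(pmulr_rgt0 _ u1_gt0); apply: lt_le_trans h.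
by rewrite mulr_gt0.
Qed.

Lemma levy_IVT a b : 0 <= a -> a <= b -> Psi a <= 0 -> 0 <= Psi b ->
  exists2 c, a <= c <= b & Psi c = 0.
Proof.
move=> a0 ab Pa Pb.
have h : Num.min (Psi `|a|) (Psi `|b|) <= 0 <= Num.max (Psi `|a|) (Psi `|b|).
  by rewrite (ger0_norm a0) (ger0_norm (le_trans a0 ab)) ge_min Pa le_max Pb orbT.
have [c] := @IVT R (fun u => Psi `|u|) a b 0 ab (continuous_subspaceT cPsi) h.
rewrite in_itv /= => /andP[ac cb]; rewrite ger0_norm; last exact: le_trans ac.
move=> Pc.
by exists c; rewrite ?ac.
Qed.

Let S := [set u : R | 0 <= u /\ Psi u = 0].

Let ubS : ubound S u1.
Proof.
move=> u [u0 Pu]; rewrite leNgt; apply/negP => uu.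
by have := levy_pos_beyond (ltW uu); rewrite Pu ltxx.
Qed.

Let supS : has_sup S.
Proof.
split; last by exists u1; exact: ubS.
have [c /andP[c0 _] Pc] := levy_IVT (lexx 0) (ltW u1_gt0) Psi0 (ltW Psi_u1).
by exists c.
Qed.

Lemma theta_ge0 : 0 <= theta Psi.
Proof.
have [c [c0 Pc]] := supS.1.
by apply: (le_trans c0); apply: ub_le_sup => //; exact: supS.2.
Qed.

Lemma theta_le u : 0 <= u -> Psi u = 0 -> u <= theta Psi.
Proof. by move=> u0 Pu; apply: ub_le_sup => //; exact: supS.2. Qed.

Lemma Psi_theta : Psi (theta Psi) = 0.
Proof.
apply/eqP; apply: contrapT => /negP P0.
have th0 := theta_ge0.
have : \forall u \near theta Psi, Psi `|u| != 0.
  have c0 : Psi `|x| @[x --> theta Psi] --> Psi `|theta Psi| by exact: cPsi.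
  by apply: (cvgr_neq0 _ c0); rewrite ger0_norm.
move=> /nbhs_ballP[e /= e0 he].
have [u [u0 Pu]] := sup_adherent e0 supS.
rewrite -/(theta Psi) => ul; have uth := theta_le u0 Pu.
have /= := he u; rewrite ger0_norm// Pu eqxx; move=> /(_ _)/negP; apply => //.
by rewrite /ball /= ger0_norm ?subr_ge0//; move: ul; lra.
Qed.

Lemma Psi_gt0 u : theta Psi < u -> 0 < Psi u.
Proof.
move=> thu; have th0 := theta_ge0; have u0 := le_lt_trans th0 thu.
rewrite ltNge; apply/negP => Pu.
have [uu|uu] := leP u u1.
  have [c /andP[uc _] Pc] := levy_IVT (ltW u0) uu Pu (ltW Psi_u1).
  have := theta_le (le_trans (ltW u0) uc) Pc.
  by rewrite leNgt (lt_le_trans thu).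
by have := levy_pos_beyond (ltW uu); rewrite ltNge Pu.
Qed.

Lemma Psi_le0 u : 0 <= u -> u < theta Psi -> Psi u <= 0.
Proof.
move=> u0 uth; have := levy_star u0 (ltW uth); rewrite Psi_theta mulr0.
by rewrite pmulr_rle0// (le_lt_trans u0).
Qed.

Let c m j : R := (-1) ^+ j.+1 *+ 'C(m, j).

Lemma alternating_sum m (x : nat -> R) n :
  \sum_(j < m.+1) c m j * x (n + j)%N = - iter m (@ndiff R) x n.
Proof.
rewrite iter_ndiffE -sumrN; apply: eq_bigr => j _.
by rewrite /c exprS mulN1r mulNrn mulNr.
Qed.

Lemma iter_ndiff_cst m (a : R) n : iter m.+1 (@ndiff R) (fun=> a) n = 0.
Proof.
rewrite iterSr (_ : ndiff _ = fun k => 0 * a).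
  by rewrite (iter_ndiffZ m 0 (fun=> a)) mul0r.
by apply/funext => k; rewrite /ndiff subrr mul0r.
Qed.

Lemma iter_ndiff_affine m (a : R) n :
  iter m.+1 (@ndiff R) (fun k => k%:R + a) n = - (m == 0%N)%:R.
Proof.
rewrite iterSr (_ : ndiff _ = fun=> -1); last first.
  by apply/funext => k; rewrite /ndiff -natr1; ring.
by case: m => [//|m]; rewrite iter_ndiff_cst oppr0.
Qed.

(** Differences of order at least two annihilate affine functions and are nonnegative on u^2 and on
    exponentials, so [levy_pos] applies. *)
Lemma levy_alternating m k : 0 <= iter m.+2 (@ndiff R) (fun n => Psi n%:R) k.
Proof.
pose w (j : 'I_m.+3) := - c m.+2 j; pose u (j : 'I_m.+3) : R := (k + j)%:R.
have wT T : \sum_(j < m.+3) w j * T (u j) = iter m.+2 (@ndiff R) (fun n => T n%:R) k.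
  rewrite -[RHS]opprK -alternating_sum -sumrN; apply: eq_bigr => j _.
  by rewrite /w mulNr.
rewrite -wT; apply: pos.
- by move=> j; rewrite /u.
- transitivity (\sum_(j < m.+3) w j * (cst 1 (u j))); last by rewrite (wT (cst 1)) iter_ndiff_cst.
  by apply: eq_bigr => j _; rewrite mulr1.
- rewrite (wT id) (_ : (fun _ => _) = fun n : nat => n%:R + 0 :> R).
    by rewrite iter_ndiff_affine oppr0.
  by apply/funext => n; rewrite addr0.
- rewrite (wT (fun x => x ^+ 2)) iterSr (_ : ndiff _ = fun n => -2 * (n%:R + 2^-1)).
    rewrite iter_ndiffZ iter_ndiff_affine mulrNN mulr_ge0//.
  by apply/funext => n; rewrite /ndiff -natr1; field.
- move=> r r0; rewrite (wT (fun x => expR (- (x * r)))).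
  rewrite (_ : (fun _ => _) = fun n => expR (- r) ^+ n).
    by apply: cm_seq_geom; rewrite expR_ge0 expR_le1 oppr_le0 ltW.
  by apply/funext => n; rewrite -expRM_natl; congr expR; ring.
Qed.

Section Shift.
Variable d : R.
Hypothesis d0 : 0 <= d.
Hypothesis dth : d != theta Psi.
Hypothesis th1 : theta Psi < 1.

Let ne n : n%:R + d - theta Psi != 0.
Proof.
case: n => [|n]; first by rewrite add0r subr_eq0.
rewrite gt_eqF// subr_gt0 (lt_le_trans th1)// -natr1.
by rewrite -addrA addrCA lerDl addr_ge0.
Qed.

(** The quotient is exp(-theta r) times the integral of exp(-(n + d - theta) s) over s in [0, r],
    and each integrand is geometric in n with ratio exp(-s). *)
Let cm_divided_expR r : 0 < r -> cm_seq (fun n =>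
  (expR (- (theta Psi * r)) - expR (- ((n%:R + d) * r))) / (n%:R + d - theta Psi)).
Proof.
move=> r0.
rewrite (_ : (fun _ => _) = fun n => expR (- (theta Psi * r)) *
    ((1 - expR (- ((n%:R + d - theta Psi) * r))) / (n%:R + d - theta Psi))); last first.
  apply/funext => n; rewrite mulrA mulrBr mulr1 -expRD; congr ((_ - expR _) / _).
  by ring.
apply: cm_seqZ; first exact: expR_ge0.
apply: (@cm_seq_lim _ (fun N n => r / N.+1%:R * \sum_(j < N.+1)
    expR (- ((n%:R + d - theta Psi) * (j%:R * (r / N.+1%:R)))))); last first.
  by move=> k; exact: expR_average_cvg.
move=> N; apply: cm_seqZ; first by rewrite divr_ge0// ltW.
apply: cm_seq_sum => j.
rewrite (_ : (fun _ => _) = fun n => expR (- ((d - theta Psi) * (j%:R * (r / N.+1%:R)))) *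
   expR (- (j%:R * (r / N.+1%:R))) ^+ n); last first.
  by apply/funext => n; rewrite -expRM_natl -expRD; congr expR; ring.
apply: cm_seqZ; first exact: expR_ge0.
apply: cm_seq_geom; rewrite expR_ge0 expR_le1 oppr_le0.
by rewrite mulr_ge0// divr_ge0// ltW.
Qed.

(** Psi(u)/(u - theta) is the Wiener-Hopf factor of Psi. Since Psi vanishes at theta it is a divided
    difference, so the alternating differences of its increments are combinations of values of Psi
    covered by [levy_pos]. *)
Lemma bernstein_shift : bernstein_seq (fun n => Psi (n%:R + d) / (n%:R + d - theta Psi)).
Proof.
split.
  rewrite add0r; have [dl|dg] := ltP d (theta Psi).
    by rewrite -mulrNN mulr_ge0 ?oppr_ge0 ?Psi_le0// invr_le0 subr_le0 ltW.
  have dg' : theta Psi < d by rewrite lt_neqAle eq_sym dth.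
  by rewrite divr_ge0 ?subr_ge0// ltW// Psi_gt0.
pose y (n : nat) := Psi (n%:R + d) / (n%:R + d - theta Psi).
suff H : cm_seq (fun n => y n.+1 - y n) by exact: H.
move=> m n.
have -> : iter m (@ndiff R) (fun n => y n.+1 - y n) n = - iter m.+1 (@ndiff R) y n.
  rewrite iterSr (_ : (fun _ => _) = fun n => -1 * ndiff y n).
    by rewrite iter_ndiffZ mulN1r.
  by apply/funext => k; rewrite /ndiff; ring.
(* The extra node theta, with index m.+2, takes the weight that makes all weights sum to 0; a
   function T then enters only through T(u) - T(theta). *)
pose uj j : R := (n + j)%:R + d.
pose wj j := c m.+1 j / (uj j - theta Psi).
pose w (i : 'I_m.+3) := if (i < m.+2)%N then wj i else - \sum_(j < m.+2) wj j.
pose u (i : 'I_m.+3) := if (i < m.+2)%N then uj i else theta Psi.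
have wT T : \sum_(i < m.+3) w i * T (u i) =
    - iter m.+1 (@ndiff R) (fun k => (T (k%:R + d) - T (theta Psi)) / (k%:R + d - theta Psi)) n.
  rewrite -alternating_sum big_ord_recr /= {2}/w {2}/u /= ltnn.
  rewrite mulNr mulr_suml -sumrB; apply: eq_bigr => j _.
  by rewrite /w /u /= ltn_ord /wj /uj; ring.
rewrite (_ : - _ = \sum_(i < m.+3) w i * Psi (u i)); last first.
  rewrite wT Psi_theta; congr (- iter _ _ _ _).
  by apply/funext => k; rewrite subr0.
apply: pos.
- move=> i; rewrite /u; case: ifP => _; last exact: theta_ge0.
  by rewrite /uj addr_ge0.
- transitivity (\sum_(i < m.+3) w i * cst 1 (u i)).
    by apply: eq_bigr => i _; rewrite mulr1.
  rewrite wT (_ : (fun _ => _) = fun=> 0) ?iter_ndiff_cst ?oppr0//.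
  by apply/funext => k; rewrite subrr mul0r.
- rewrite (wT id) (_ : (fun _ => _) = fun=> 1) ?iter_ndiff_cst ?oppr0//.
  by apply/funext => k; rewrite divff.
- rewrite (wT (fun x => x ^+ 2)) (_ : (fun _ => _) = fun k => k%:R + (d + theta Psi)).
    by rewrite iter_ndiff_affine opprK.
  by apply/funext => k; rewrite subr_sqr mulrAC divff// mul1r addrA.
- move=> r r0; rewrite (wT (fun x => expR (- (x * r)))).
  rewrite (_ : (fun _ => _) = fun k => -1 * ((expR (- (theta Psi * r)) -
      expR (- ((k%:R + d) * r))) / (k%:R + d - theta Psi))).
    rewrite (iter_ndiffZ m.+1 (-1)) mulN1r opprK; exact: cm_divided_expR.
  by apply/funext => k; rewrite mulN1r -[RHS]mulNr opprB.
Qed.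

End Shift.
End LaplaceExponents.

(** * The moment sequence attached to Psi *)

Section ClassND.
Variable R : realType.
Variable Psi : R -> R.
Hypothesis ND : classND Psi.

Lemma classND_regular : [/\ levy_pos Psi, Psi 0 <= 0, continuous (fun u : R => Psi `|u|)
  & exists2 u1 : R, 0 < u1 & 0 < Psi u1].
Proof.
have [[kappa [a [sigma [mu [kappa0 sigma0 levy_mu PsiE nondeg]]]]] _] := ND.
split.
- by move=> n w u; exact: (levy_positive levy_mu PsiE).
- rewrite PsiE// mulr0 expr0n /= mulr0 !addr0.
  rewrite (_ : Rintegral _ _ _ = 0) ?subr0 ?oppr_le0//.
  rewrite (_ : (fun r : R => _) = cst 0); first by rewrite Rintegral_cst// mul0r.
  by apply/funext => r; rewrite !mul0r oppr0 expR0 !subrr addr0.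
- exact: (levy_continuous levy_mu PsiE).
- apply: contrapT => H; apply: nondeg.
  apply: (levy_nonpos_degenerate kappa0 sigma0 levy_mu PsiE) => u u0.
  by rewrite leNgt; apply/negP => Pu; apply: H; exists u.
Qed.

Lemma classND_rigid : 0 <= Psi 2 - 2 * Psi 1 /\
  (Psi 2 = 2 * Psi 1 -> exists a : R, forall u : R, 0 <= u -> Psi u = a * u).
Proof.
have [[kappa [a [sigma [mu [kappa0 sigma0 levy_mu PsiE nondeg]]]]] _] := ND.
split; first exact: (levy_two_points_ge0 kappa0 levy_mu PsiE).
by move=> H; exists a; exact: (levy_rigidity kappa0 levy_mu PsiE H).
Qed.

Let th := theta Psi.
Let th0 : 0 <= th. Proof. by case: ND => _ /andP[]. Qed.
Let th2 : th <= 2^-1. Proof. by case: ND => _ /andP[]. Qed.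
Let th1 : th < 1. Proof. by apply: (le_lt_trans th2); rewrite invf_lt1// ltr1n. Qed.

Lemma classND_gt0 u : th < u -> 0 < Psi u.
Proof.
have [pos P0 cP [u1 u10 Pu1]] := classND_regular.
exact: (Psi_gt0 pos P0 cP u10 Pu1).
Qed.

Lemma classND_nat_gt0 n : 0 < Psi n.+1%:R.
Proof. by apply: classND_gt0; apply: (lt_le_trans th1); rewrite ler1n. Qed.

Lemma classND_linear_growth n : n.+1%:R * Psi 1 <= Psi n.+1%:R.
Proof.
have [pos P0 cP [u1 u10 Pu1]] := classND_regular.
have h := levy_star pos P0 ler01 (_ : 1 <= n.+1%:R).
by apply: le_trans (h _) _; rewrite ?ler1n// mul1r.
Qed.

Lemma WS n : W Psi n.+2 = W Psi n.+1 * Psi n.+1%:R.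
Proof. by rewrite /W big_nat_recr. Qed.

Lemma W1 : W Psi 1 = 1. Proof. by rewrite /W big_geq. Qed.

Lemma W_gt0 n : 0 < W Psi n.+1.
Proof. by elim: n => [|n IH]; rewrite ?W1// WS mulr_gt0// classND_nat_gt0. Qed.

(** Write (2n)! = 4^n n! (1/2)_n and W n.+1 = (1 - theta)_n prod_k phi(k) with phi(u) = Psi(u)/(u -
    theta). The sequence is the product of the moments of the constant 4, of a Beta law and of an
    exponential functional. *)
Lemma moment_W : moment_cone (fun n => (2 * n)`!%:R / W Psi n.+1).
Proof.
have [pos P0 cP [u1 u10 Pu1]] := classND_regular.
(* For theta = 0 the factor phi has no value at u = 0; the argument is shifted by 1/(i + 1) and the
   shift removed in the limit. *)
pose d i : R := if th == 0 then i.+1%:R^-1 else 0.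
have d0 i : 0 <= d i by rewrite /d; case: ifP.
have dth i : d i != th.
  rewrite /d; case: ifPn => [/eqP ->|]; last by rewrite eq_sym.
  by rewrite invr_eq0 pnatr_eq0.
have dc : d i @[i --> \oo] --> (0 : R).
  rewrite /d; case: (th == 0); [exact: cvg_harmonic|exact: cvg_cst].
have ne k x : 0 <= x -> 0 < k.+1%:R + x - th.
  by move=> x0; rewrite subr_gt0 (lt_le_trans th1)// -natr1 -addrA addrCA lerDl addr_ge0.
pose E n := n`!%:R / \prod_(k < n) (Psi k.+1%:R / (k.+1%:R - th)).
have mE : moment_cone E.
  apply: (cone_lim (F := fun i n => n`!%:R / \prod_(k < n)
     (Psi (k.+1%:R + d i) / (k.+1%:R + d i - th)))).
    move=> i.
    apply: (moment_exponential_functional (bernstein_shift pos P0 cP u10 Pu1 (d0 i) (dth i) th1)).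
    move=> n; rewrite divr_gt0 ?ne// classND_gt0//.
    by rewrite -subr_gt0 ne.
  move=> n _; apply: cvgM; first exact: cvg_cst.
  apply: cvgV.
    rewrite gt_eqF//; apply: prodr_gt0 => k _; rewrite divr_gt0 ?classND_nat_gt0//.
    by have := ne k 0 (lexx _); rewrite addr0.
  elim: n => [|n IH].
    by rewrite big_ord0; under eq_fun do rewrite big_ord0; exact: cvg_cst.
  rewrite big_ord_recr; under eq_fun do rewrite big_ord_recr.
  apply: cvgM => //=.
  have c1 : n.+1%:R + d i @[i --> \oo] --> (n.+1%:R : R).
    by have := cvgD (cvg_cst (n.+1%:R : R)) dc; rewrite addr0; exact.
  apply: cvgM.
    have : Psi `|x| @[x --> (n.+1%:R : R)] --> Psi `|n.+1%:R| by exact: cP.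
    rewrite ger0_norm// => h.
    rewrite (_ : (fun i => _) = (fun x => Psi `|x|) \o (fun i => n.+1%:R + d i)).
      exact: cvg_comp c1 h.
    by apply/funext => i /=; rewrite ger0_norm// addr_ge0.
  apply: cvgV; first by rewrite gt_eqF//; have := ne n 0 (lexx _); rewrite addr0.
  by apply: cvgB => //; exact: cvg_cst.
(* The bound theta <= 1/2 enters here, as 1/2 <= 1 - theta. *)
have mB : moment_cone (fun n => pochhammer 2^-1 n / pochhammer (1 - th) n).
  apply: moment_cm; apply: cm_seq_beta; first by rewrite invr_gt0.
  by move: th2; lra.
have m4 : moment_cone (fun n => 4 ^+ n : R) by exact: moment_geom.
apply: cone_ext (moment_mul m4 (moment_mul mB mE)) => n _.
elim: n => [|n IH].
  by rewrite W1 /pochhammer /E !big_ord0 fact0 expr0; field.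
rewrite mulnS add2n WS 2!factS !natrM.
have -> : ((2 * n)`!%:R : R) = W Psi n.+1 * (4 ^+ n * (pochhammer 2^-1 n / pochhammer (1 - th) n * E n)).
  by rewrite IH mulrC divfK// gt_eqF// W_gt0.
rewrite exprS !pochhammerSr /E big_ord_recr /= factS natrM.
have w0 := W_gt0 n; have p0 := classND_nat_gt0 n.
have t0 : 0 < n.+1%:R - th by have := ne n 0 (lexx _); rewrite addr0.
have t1 : 0 < 1 - th by rewrite subr_gt0.
have pp := pochhammer_gt0 n t1.
have pr0 : 0 < \prod_(k < n) (Psi k.+1%:R / (k.+1%:R - th)).
  apply: prodr_gt0 => k _; rewrite divr_gt0 ?classND_nat_gt0//.
  by have := ne k 0 (lexx _); rewrite addr0.
have -> : 1 - th + n%:R = n.+1%:R - th by rewrite -natr1; ring.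
move: (\prod_(k < n) _) pr0 (pochhammer (1 - th) n) pp (pochhammer 2^-1 n)
  (W Psi n.+1) w0 => z z0 y y0 x w w0.
have -> : (2 * n).+2%:R = 2 * n.+1%:R :> R by rewrite -natrM mulnS.
have -> : (2 * n).+1%:R = 2 * (2^-1 + n%:R) :> R.
  by rewrite -natr1 natrM; field.
move: (Psi _) p0 (n.+1%:R - th) t0 => p p0 t t0.
by field; rewrite !gt_eqF.
Qed.

End ClassND.

(** * Laplace transforms *)

Section CompletelyMonotone.
Variable R : realType.
Implicit Types f g : R -> R.

(** Laplace transforms of finite measures on [0, +oo]: [f 0] is the total mass, and a mass at
    infinity is seen only at q = 0. *)
Definition laplace_cone : (R -> R) -> Prop :=
  cone [set q : R | 0 <= q] [set f | exists2 r : R, 0 <= r & f = fun q => expR (- (r * q))].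

Lemma laplace_exp r : 0 <= r -> laplace_cone (fun q => expR (- (r * q))).
Proof. by move=> r0; apply: cone_gen; exists r. Qed.

Lemma laplace_cst a : 0 <= a -> laplace_cone (fun=> a).
Proof.
move=> a0; apply: cone_ext (cone_scale a0 (laplace_exp (lexx 0))) => q _.
by rewrite mul0r oppr0 expR0 mulr1.
Qed.

Lemma laplace_mul f g : laplace_cone f -> laplace_cone g ->
  laplace_cone (fun q => f q * g q).
Proof.
apply: cone_mul => {}f {}g [a a0 ->] [b b0 ->]; exists (a + b); first exact: addr_ge0.
by apply/funext => q; rewrite -expRD; congr expR; ring.
Qed.

Lemma laplace_pow f i : laplace_cone f -> laplace_cone (fun q => f q ^+ i).
Proof.
move=> cf; elim: i => [|i IH]; first exact: laplace_cst.
by apply: cone_ext (laplace_mul cf IH) => q _; rewrite exprS.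
Qed.

Lemma laplace_dilate s f : 0 <= s -> laplace_cone f -> laplace_cone (fun q => f (s * q)).
Proof.
move=> s0; elim=> {f}[f [r r0 ->]||f g _ IH1 _ IH2|a f a0 _ IH|F f _ IH Ff].
- by apply: cone_ext (laplace_exp (mulr_ge0 r0 s0)) => q _; rewrite mulrA.
- exact: cone_zero.
- exact: cone_add.
- exact: cone_scale.
- by apply: (cone_lim IH) => q q0; apply: Ff; rewrite /= mulr_ge0.
Qed.

(** The integral of exp(-(c + b q) s) over s > 0, as a limit of Riemann sums on [0, i + 1]. *)
Lemma laplace_inv_affine c b : 0 < c -> 0 <= b -> laplace_cone (fun q => (c + b * q)^-1).
Proof.
move=> c0 b0.
have cq q : 0 <= q -> 0 < c + b * q by move=> q0; rewrite ltr_wpDr// mulr_ge0.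
apply: (cone_lim (F := fun i q => (1 - expR (- ((c + b * q) * i.+1%:R))) / (c + b * q))).
  move=> i.
  apply: (cone_lim (F := fun n q => i.+1%:R / n.+1%:R *
      \sum_(j < n.+1) expR (- ((c + b * q) * (j%:R * (i.+1%:R / n.+1%:R)))))); last first.
    by move=> q q0; apply: expR_average_cvg; rewrite ?gt_eqF ?cq.
  move=> n; apply: cone_scale; first exact: divr_ge0.
  apply: cone_sum => j _.
  have h0 : 0 <= j%:R * (i.+1%:R / n.+1%:R) :> R by rewrite mulr_ge0// divr_ge0.
  apply: cone_ext (cone_scale (expR_ge0 (- (c * (j%:R * (i.+1%:R / n.+1%:R)))))
     (laplace_exp (mulr_ge0 b0 h0))) => q _.
  by rewrite -expRD; congr expR; ring.
move=> q q0 /=; have cq0 := cq q q0.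
suff h : expR (- ((c + b * q) * i.+1%:R)) @[i --> \oo] --> (0 : R).
  by have := cvgM (cvgB (cvg_cst (1 : R)) h) (cvg_cst (c + b * q)^-1);
    rewrite subr0 mul1r; exact.
apply: (@squeeze_cvgr _ _ _ _ (fun=> 0) (fun i => (c + b * q)^-1 * i.+1%:R^-1)).
- apply: nearW => i; rewrite expR_ge0 /= expRN -invfM.
  have p : 0 < (c + b * q) * i.+1%:R by rewrite mulr_gt0.
  rewrite lef_pV2 ?posrE ?expR_gt0//.
  by apply: le_trans (expR_ge1Dx _); rewrite lerDr.
- exact: cvg_cst.
- by have := cvgM (cvg_cst (c + b * q)^-1) (@cvg_harmonic R); rewrite mulr0; exact.
Qed.

(** Neumann series around 1/(c + b q); its ratio g/(c + b q) is below 1 since g <= A < c. *)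
Lemma laplace_resolvent c b A g : 0 <= A -> A < c -> 0 <= b -> laplace_cone g ->
  (forall q, 0 <= q -> 0 <= g q <= A) -> laplace_cone (fun q => (c + b * q - g q)^-1).
Proof.
move=> A0 Ac b0 cg g0A; have c0 := le_lt_trans A0 Ac.
pose E q := (c + b * q)^-1.
have cE : laplace_cone E by exact: laplace_inv_affine.
apply: (cone_lim (F := fun i q => E q * \sum_(j < i) (g q * E q) ^+ j)).
  move=> i; apply: laplace_mul => //; apply: cone_sum => j _.
  by apply: laplace_pow; exact: laplace_mul.
move=> q q0; have /andP[g0 gA] := g0A q q0.
have cq : 0 < c + b * q by rewrite ltr_wpDr// mulr_ge0.
have gc : g q < c + b * q by apply: (le_lt_trans gA); apply: (lt_le_trans Ac); rewrite lerDl mulr_ge0.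
have w1 : `|g q * E q| < 1.
  rewrite ger0_norm; last by rewrite mulr_ge0// invr_ge0 ltW.
  by rewrite /E ltr_pdivrMr// mul1r.
rewrite (_ : (fun i => _) = fun i => E q * series (geometric 1 (g q * E q)) i); last first.
  apply/funext => i; rewrite /series /= big_mkord; congr (_ * _).
  by apply: eq_bigr => j _; rewrite /geometric /= mul1r.
have -> : (c + b * q - g q)^-1 = E q * (1 / (1 - g q * E q)).
  have -> : 1 - g q * E q = (c + b * q - g q) / (c + b * q).
    by rewrite /E; field; rewrite gt_eqF.
  by rewrite /E div1r invf_div mulrA mulVf ?gt_eqF// mul1r.
by apply: cvgM; [exact: cvg_cst|exact: cvg_geometric_series].
Qed.

End CompletelyMonotone.

(* For [c] with nonnegative alternating differences of order at least two, the
   operator sending the falling factorial [x ^_ n] to [c n * (x ^_ n.-1)] is the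
   generator of a Markov chain on the integers whose upward jumps have size one,
   and [eigen x] is its eigenfunction; thus the ratios below are Laplace
   transforms of first passage times. *)
Section SkipFreeChain.
Variable R : realType.
Variable c : nat -> R.
Hypothesis c0 : c 0%N = 0.
Hypothesis c_gt0 : forall n, 0 < c n.+1.
Hypothesis c_alt : forall m k, 0 <= iter m.+2 (@ndiff R) c k.

Definition eigen_coef n : R := n`!%:R / \prod_(k < n) c k.+1.

Definition eigen (x : nat) (q : R) : R :=
  \sum_(n < x.+1) 'C(x, n)%:R * eigen_coef n * q ^+ n.

(** For y > 0, row y divided by y is the generator row of the state y - 1: the entry k = y is the
    jump up, k = y - 1 is the diagonal, and the others are jumps down, nonnegative by [c_alt]. *)
Let rate y k : R := 'C(y, k)%:R * iter (y - k) (@ndiff R) c k.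

Lemma eigen_coef_gt0 n : 0 < eigen_coef n.
Proof.
by rewrite divr_gt0 ?ltr0n ?fact_gt0//; apply: prodr_gt0.
Qed.

Lemma eigen_coefS n : c n.+1 * eigen_coef n.+1 = n.+1%:R * eigen_coef n.
Proof.
rewrite /eigen_coef big_ord_recr /= factS natrM.
have : 0 < \prod_(k < n) c k.+1 by apply: prodr_gt0.
move: (\prod_(k < n) _) => z z0.
by field; rewrite !gt_eqF.
Qed.

Lemma eigenE x y q : (x <= y)%N ->
  eigen x q = \sum_(n < y.+1) 'C(x, n)%:R * eigen_coef n * q ^+ n.
Proof.
move=> xy; rewrite /eigen.
rewrite (big_ord_widen y.+1 (fun n => 'C(x, n)%:R * eigen_coef n * q ^+ n))//.
rewrite big_mkcond; apply: eq_bigr => n _; case: ifPn => //.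
by rewrite -leqNgt => xn; rewrite bin_small// mulr0n !mul0r.
Qed.

Lemma eigen_gt0 x q : 0 <= q -> 0 < eigen x q.
Proof.
move=> q0; rewrite /eigen big_ord_recl bin0 expr0 mulr1 mul1r ltr_wpDr ?eigen_coef_gt0//.
apply: sumr_ge0 => n _.
by rewrite mulr_ge0 ?exprn_ge0// mulr_ge0// ltW// eigen_coef_gt0.
Qed.

Lemma eigen_le x y q : 0 <= q -> (x <= y)%N -> eigen x q <= eigen y q.
Proof.
move=> q0 xy; rewrite (eigenE q xy); apply: ler_sum => n _.
rewrite ler_wpM2r ?exprn_ge0// ler_wpM2r ?ler_nat ?leq_bin2l//.
by rewrite ltW// eigen_coef_gt0.
Qed.

(** By [bin_ndiff] the rates act on k |-> 'C(k, n) as multiplication by c n, and [eigen_coefS] turns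
    this into the eigenvalue equation at state x, with eigenvalue q. *)
Lemma rate_eigen x q : \sum_(k < x.+2) rate x.+1 k * eigen k q = x.+1%:R * q * eigen x q.
Proof.
transitivity (\sum_(n < x.+2) 'C(x.+1, n)%:R * c n * (eigen_coef n * q ^+ n)).
  under eq_bigr => k _ do rewrite (@eigenE k x.+1) ?mulr_sumr -1?ltnS//.
  rewrite exchange_big; apply: eq_bigr => n _ /=.
  rewrite -bin_ndiff; last by rewrite -ltnS.
  rewrite mulr_suml; apply: eq_bigr => k _.
  by rewrite /rate !mulrA.
rewrite big_ord_recl c0 mulr0 mul0r add0r /eigen mulr_sumr.
apply: eq_bigr => n _; rewrite /= /bump /= add1n.
rewrite mulrA -(mulrA _ (c _)) eigen_coefS mulrA -natrM mulnC -mul_bin_diag natrM exprS.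
by ring.
Qed.

Lemma rate_sum x : \sum_(k < x.+2) rate x.+1 k = 0.
Proof.
have := @bin_ndiff R c 0 x.+1 (leq0n _); rewrite c0 mulr0 => H.
rewrite -[RHS]H; apply: eq_bigr => k _.
by rewrite bin0 mulr1.
Qed.

(** Induct on the target x of the passage. The eigenvalue equation reads c x.+1 eigen x.+1 = (c x.+1
    + A + x.+1 q - G q) eigen x, where [G] mixes the transforms of the passages back to x after a
    jump down, known by induction; the bracket is inverted by [laplace_resolvent]. *)
Lemma eigen_ratio_laplace x k : (k <= x)%N ->
  laplace_cone (fun q => eigen k q / eigen x q).
Proof.
elim: x k => [|x IH] k.
  rewrite leqn0 => /eqP ->; apply: cone_ext (laplace_cst ler01) => q q0.
  by rewrite divff// gt_eqF// eigen_gt0.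
rewrite leq_eqVlt => /predU1P[->|].
  apply: cone_ext (laplace_cst ler01) => q q0.
  by rewrite divff// gt_eqF// eigen_gt0.
rewrite ltnS => kx.
have rate0 j : (j < x)%N -> 0 <= rate x.+1 j.
  move=> jx; rewrite mulr_ge0//.
  have -> : (x.+1 - j = (x - j.+1).+2)%N by move: jx; lia.
  exact: c_alt.
pose A := \sum_(j < x) rate x.+1 j.
pose G q := \sum_(j < x) rate x.+1 j * (eigen j q / eigen x q).
have A0 : 0 <= A by apply: sumr_ge0 => j _; exact: rate0.
have cG : laplace_cone G.
  by apply: cone_sum => j _; apply: cone_scale; [exact: rate0|apply: IH; exact: ltnW].
have G0A q : 0 <= q -> 0 <= G q <= A.
  move=> q0; have ex := eigen_gt0 x q0; apply/andP; split.
    apply: sumr_ge0 => j _; rewrite mulr_ge0 ?rate0// divr_ge0 ?ltW//.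
    exact: eigen_gt0.
  apply: ler_sum => j _; rewrite -[leRHS]mulr1 ler_wpM2l ?rate0//.
  by rewrite ler_pdivrMr// mul1r eigen_le// ltnW.
have Ac : A < c x.+1 + A by rewrite ltrDr.
have x0 : 0 <= x.+1%:R :> R by [].
apply: cone_ext (laplace_mul (IH _ kx) (cone_scale (ltW (c_gt0 x))
  (laplace_resolvent A0 Ac x0 cG G0A))) => q q0 /=.
have ex := eigen_gt0 x q0; have eSx := eigen_gt0 x.+1 q0.
have E : c x.+1 * eigen x.+1 q = (c x.+1 + A + x.+1%:R * q - G q) * eigen x q.
  rewrite mulrBl [G q * _]mulr_suml.
  have -> : \sum_(j < x) rate x.+1 j * (eigen j q / eigen x q) * eigen x q =
      \sum_(j < x) rate x.+1 j * eigen j q.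
    by apply: eq_bigr => j _; rewrite -mulrA divfK// gt_eqF.
  have := rate_eigen x q; rewrite !big_ord_recr /=.
  have := rate_sum x; rewrite !big_ord_recr /=.
  have -> : rate x.+1 x.+1 = c x.+1 by rewrite /rate binn subnn mul1r.
  rewrite -/A => H; have -> : rate x.+1 x = - c x.+1 - A by move: H; lra.
  by move=> H2; move: H2; move: (\sum_(j < x) _) => T; nra.
have Z0 : 0 < c x.+1 + A + x.+1%:R * q - G q.
  by rewrite -(pmulr_lgt0 _ ex) -E mulr_gt0.
have -> : eigen x.+1 q = (c x.+1 + A + x.+1%:R * q - G q) * eigen x q / c x.+1.
  by rewrite -E [c _ * _]mulrC mulfK// gt_eqF.
move: (_ - G q) Z0 => Z Z0.
by field; rewrite !gt_eqF.
Qed.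

End SkipFreeChain.

(** * From the chain to the entire series *)

Section Tannery.
Variable R : realType.

(** Dominated convergence for series, when [E] j is only known to lie between the partial sums of
    [F] j and the sum of [b]. *)
Lemma tannery (F : nat -> nat -> R) (b E : nat -> R) :
  (forall n, F j n @[j --> \oo] --> b n) -> cvgn (series b) ->
  (forall j N, \sum_(n < N) F j n <= E j) -> (forall j, E j <= limn (series b)) ->
  E j @[j --> \oo] --> limn (series b).
Proof.
move=> Fb cb FE Eb; apply/cvgrPdist_le => e e0.
have e2 : 0 < e / 2 by rewrite divr_gt0.
have cb' : series b @ \oo --> limn (series b) by exact: cb.
have /cvgrPdist_le/(_ _ e2)[N _ HN] := cb'.
have FN : \sum_(n < N) F j n @[j --> \oo] --> series b N.
  by rewrite /series /= big_mkord; apply: cvg_sum_seq => n _; exact: Fb.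
have /cvgrPdist_le/(_ _ e2) := FN; apply: filterS => j h.
have := HN N (leqnn N); have := FE j N; have := Eb j; move: h.
move=> h h1 h2 h3; rewrite ger0_norm ?subr_ge0//.
have k1 := le_trans (ler_norm _) h; have k2 := le_trans (ler_norm _) h3.
have : limn (series b) - E j <= e / 2 + e / 2 by move: h2 k1 k2; lra.
by rewrite -splitr.
Qed.

Lemma ffact_mul_cvg k n :
  ((k * j.+1) ^_ n)%:R / j.+1%:R ^+ n @[j --> \oo] --> (k%:R ^+ n : R).
Proof.
elim: n => [|n IH].
  rewrite expr0 (_ : (fun _ => _) = fun=> 1); first exact: cvg_cst.
  by apply/funext => j; rewrite ffactn0 expr0 divr1.
rewrite exprSr (_ : (fun _ => _) = fun j => ((k * j.+1) ^_ n)%:R / j.+1%:R ^+ n *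
   ((k * j.+1 - n)%:R / j.+1%:R)); last first.
  by apply/funext => j; rewrite ffactnSr natrM exprSr invfM; ring.
apply: cvgM => //.
apply: (@squeeze_cvgr _ _ _ _ (fun j => k%:R - n%:R * j.+1%:R^-1) (fun=> k%:R)).
- apply: nearW => j; have j0 : 0 < j.+1%:R :> R by rewrite ltr0n.
  apply/andP; split; last by rewrite ler_pdivrMr// -natrM ler_nat leq_subr.
  rewrite ler_pdivlMr// mulrBl divfK ?gt_eqF// lerBlDr -natrM -natrD ler_nat.
  by move: (k * j.+1)%N => y; lia.
- have := cvgB (cvg_cst (k%:R : R)) (cvgM (cvg_cst (n%:R : R)) (@cvg_harmonic R)).
  by rewrite mulr0 subr0; exact.
- exact: cvg_cst.
Qed.

End Tannery.

Section EntireSeries.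
Variable R : realType.
Variable Psi : R -> R.
Hypothesis ND : classND Psi.

Definition Icoef n : R := (W Psi n.+1)^-1.
(** The variable is x = t^2: [JPsi] at t is [Iser] at - t^2, and [IPsi] at t is [Iser] at t^2. *)
Definition Iser (x : R) : R := limn (pseries Icoef x).

Lemma Icoef_gt0 n : 0 < Icoef n. Proof. by rewrite invr_gt0 W_gt0. Qed.

Lemma Icoef0 : Icoef 0 = 1. Proof. by rewrite /Icoef W1 invr1. Qed.

Lemma IcoefS n : Icoef n.+1 = Icoef n / Psi n.+1%:R.
Proof. by rewrite /Icoef WS invfM. Qed.

Lemma Icoef_le n : Icoef n <= (Psi 1)^-1 ^+ n / n`!%:R.
Proof.
have P1 : 0 < Psi 1 := classND_nat_gt0 ND 0.
elim: n => [|n IH]; first by rewrite Icoef0 expr0 fact0 divr1.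
rewrite IcoefS exprSr factS natrM invfM [n.+1%:R^-1 * _]mulrC mulrACA.
apply: ler_pM => //; first exact: ltW (Icoef_gt0 n).
  by rewrite invr_ge0 ltW// classND_nat_gt0.
rewrite -invfM lef_pV2 ?posrE ?mulr_gt0 ?classND_nat_gt0//.
by rewrite mulrC; exact: classND_linear_growth.
Qed.

Lemma Icoef_abs_cvg x : cvgn (series (fun n => `|Icoef n * x ^+ n|)).
Proof.
apply: (@series_le_cvg _ _ (exp_coeff (`|x| / Psi 1))) => [n|n|n|].
- exact: normr_ge0.
- rewrite /exp_coeff /= mulr_ge0// exprn_ge0// divr_ge0// ltW//.
  exact: (classND_nat_gt0 ND 0).
- rewrite normrM normrX (ger0_norm (ltW (Icoef_gt0 n))) /exp_coeff /=.
  have -> : (`|x| / Psi 1) ^+ n / n`!%:R = (Psi 1)^-1 ^+ n / n`!%:R * `|x| ^+ n.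
    by rewrite exprMn; ring.
  by rewrite ler_wpM2r ?exprn_ge0// Icoef_le.
- exact: is_cvg_series_exp_coeff.
Qed.

Lemma Iser_cvg x : cvgn (pseries Icoef x).
Proof. by apply: normed_cvg; exact: Icoef_abs_cvg. Qed.

Lemma Iser_partial_le x N : 0 <= x -> \sum_(n < N) Icoef n * x ^+ n <= Iser x.
Proof.
move=> x0; rewrite -(big_mkord xpredT (fun n => Icoef n * x ^+ n)).
apply: (nondecreasing_cvgn_le _ (@Iser_cvg x) N).
apply/nondecreasing_seqP => n; rewrite /pseries /series /= big_nat_recr//=.
by rewrite lerDl mulr_ge0 ?exprn_ge0// ltW// Icoef_gt0.
Qed.

Lemma Iser_ge1 x : 0 <= x -> 1 <= Iser x.
Proof.
move=> x0; apply: le_trans (Iser_partial_le 1 x0).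
by rewrite big_ord1 Icoef0 expr0 mulr1.
Qed.

Lemma Iser_gt0 x : 0 <= x -> 0 < Iser x.
Proof. by move=> x0; apply: lt_le_trans (Iser_ge1 x0). Qed.

Lemma Iser0 : Iser 0 = 1.
Proof.
apply: cvg_lim => //; rewrite -(cvg_shiftS (pseries Icoef 0)).
rewrite (_ : (fun _ => _) = fun=> 1); first exact: cvg_cst.
apply/funext => n; rewrite /pseries /series /= big_nat_recl//= Icoef0 expr0 mulr1.
by rewrite big1 ?addr0// => i _; rewrite expr0n mulr0.
Qed.

(** Psi with its value at 0 raised to 0, as the chain requires. Adding - Psi 0 >= 0 at the single
    point 0 keeps the alternating differences nonnegative. *)
Let c n : R := if n is 0%N then 0 else Psi n%:R.

Let c_gt0 n : 0 < c n.+1. Proof. exact: classND_nat_gt0. Qed.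

Let c_alt m k : 0 <= iter m.+2 (@ndiff R) c k.
Proof.
have [pos P0 cP _] := classND_regular ND.
rewrite (_ : c = fun n => Psi n%:R + - Psi 0 * 0 ^+ n); last first.
  apply/funext => -[|n]; first by rewrite expr0 mulr1 subrr.
  by rewrite expr0n mulr0 addr0.
rewrite iter_ndiffD iter_ndiffZ addr_ge0 ?levy_alternating//.
by rewrite mulr_ge0 ?oppr_ge0//; apply: cm_seq_geom; rewrite lexx ler01.
Qed.

Let eigen_coefE n : eigen_coef c n = n`!%:R * Icoef n.
Proof.
rewrite /eigen_coef /Icoef /W big_add1 /= big_mkord; congr (_ / _).
Qed.

(** Scaling limit: for x = k (j + 1) and q = s/(j + 1), 'C(x, n) n! q^n tends to (k s)^n and is
    dominated by it. *)
Lemma eigen_cvg k s : 0 <= s ->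
  eigen c (k * j.+1) (j.+1%:R^-1 * s) @[j --> \oo] --> Iser (k%:R * s).
Proof.
move=> s0.
pose F j n := ((k * j.+1) ^_ n)%:R / j.+1%:R ^+ n * (Icoef n * s ^+ n).
have EF j N : (k * j.+1 < N)%N -> eigen c (k * j.+1) (j.+1%:R^-1 * s) = \sum_(n < N) F j n.
  case: N => // N kN; rewrite (@eigenE _ _ _ N)//; apply: eq_bigr => n _.
  by rewrite eigen_coefE /F -bin_ffact natrM exprMn exprVn; ring.
have F0 j n : 0 <= F j n.
  apply: mulr_ge0; first by apply: divr_ge0 => //; exact: exprn_ge0.
  by apply: mulr_ge0; [exact: ltW (Icoef_gt0 n)|exact: exprn_ge0].
have FI j n : F j n <= Icoef n * (k%:R * s) ^+ n.
  rewrite /F exprMn mulrCA ler_wpM2l ?(ltW (Icoef_gt0 n))// ler_wpM2r ?exprn_ge0//.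
  rewrite ler_pdivrMr ?exprn_gt0 ?ltr0n// -!natrX -natrM ler_nat -expnMn.
  rewrite ffact_prod -[X in (_ <= _ ^ X)%N]card_ord -prod_nat_const.
  by apply: leq_prod => i _; exact: leq_subr.
apply: (@tannery _ F (fun n => Icoef n * (k%:R * s) ^+ n)).
- move=> n; rewrite exprMn mulrCA; apply: cvgM; first exact: ffact_mul_cvg.
  exact: cvg_cst.
- exact: Iser_cvg.
- move=> j N; rewrite (EF j (maxn N (k * j.+1).+1)) ?leq_max ?ltnSn ?orbT//.
  rewrite (big_ord_widen _ (F j) (leq_maxl N (k * j.+1).+1)).
  rewrite [leRHS](bigID (fun i : 'I__ => (i < N)%N))/= lerDl.
  exact: sumr_ge0.
- move=> j; rewrite (EF j (k * j.+1).+1)//.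
  apply: le_trans (Iser_partial_le (k * j.+1).+1 _); last by rewrite mulr_ge0.
  by apply: ler_sum => n _; exact: FI.
Qed.

(* Self-decomposability of the first passage law with Laplace transform [1 / I]. *)
Lemma Iser_ratio_laplace k m : (k <= m)%N ->
  laplace_cone (fun q => Iser (k%:R * (m.+1%:R^-1 * q)) / Iser q).
Proof.
move=> km; apply: (cone_lim (F := fun j q =>
   eigen c (k * j.+1) (j.+1%:R^-1 * (m.+1%:R^-1 * q)) /
   eigen c (m.+1 * j.+1) (j.+1%:R^-1 * (m.+1%:R^-1 * q)))).
  move=> j.
  have h := @eigen_ratio_laplace R c erefl c_gt0 c_alt _ _
    (leq_mul (leqW km) (leqnn j.+1)).
  have s0 : 0 <= j.+1%:R^-1 * m.+1%:R^-1 :> R by rewrite mulr_ge0// invr_ge0.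
  by apply: cone_ext (laplace_dilate s0 h) => q _; rewrite -!mulrA.
move=> q q0.
have mq : 0 <= m.+1%:R^-1 * q by rewrite mulr_ge0// invr_ge0.
apply: cvgM; first exact: eigen_cvg.
apply: cvgV; first by rewrite gt_eqF// Iser_gt0.
by have := @eigen_cvg m.+1 _ mq; rewrite mulVKf// pnatr_eq0.
Qed.

Lemma Iser_inv_laplace : laplace_cone (fun q => (Iser q)^-1).
Proof.
apply: cone_ext (Iser_ratio_laplace (leqnn 0)) => q _.
by rewrite mul0r Iser0 mul1r.
Qed.

End EntireSeries.

(** * Decreasing densities *)

Section Helly.
Variable R : realType.

(** [K] is a limit along an ultrafilter; a diagonal choice gives a sequence of indices converging to
    [K] at the positive rationals, and monotonicity extends this to all points where [K] does not
    jump. *)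
Lemma helly_selection (k : nat -> R -> R) (C : R -> R) :
  (forall n r, 0 < r -> 0 <= k n r <= C r) ->
  (forall n r s, 0 < r -> r <= s -> k n s <= k n r) ->
  exists (N : nat -> nat) (K : R -> R) (B : set R),
    [/\ forall m, (m <= N m)%N, countable B, forall r, 0 < r -> 0 <= K r,
        forall r s, 0 < r -> r <= s -> K s <= K r
      & forall r, 0 < r -> ~ B r -> k (N m) r @[m --> \oo] --> K r].
Proof.
move=> k0C kmono.
have [U [UU sU]] := @ultraFilterLemma _ \oo _.
have limU r : exists l : R, 0 < r -> k n r @[n --> U] --> l.
  have [r0|r0] := ltP 0 r; last by exists 0.
  have /(_ (k n r @[n --> U]) _)[] := @segment_compact R 0 (C r).
    by apply: sU; exists 0%N => // n _; rewrite /= in_itv /=; exact: k0C.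
  move=> l [_ kl]; exists l => _ V lV.
  have [//|UV] := in_ultra_setVsetC ((k ^~ r) @^-1` V) UU.
  by have [x []] := kl (~` V) V UV lV.
have [K HK] := choice limU.
have Uproper : ProperFilter U by exact: ultra_proper.
have K0 r : 0 < r -> 0 <= K r.
  move=> r0; apply: (cvgr_to_ge (HK r r0)); apply: nearW => n.
  by case/andP: (k0C n r r0).
have Kmono r s : 0 < r -> r <= s -> K s <= K r.
  move=> r0 rs; apply: (ler_cvg_to (HK s (lt_le_trans r0 rs)) (HK r r0)).
  by apply: nearW => n; exact: kmono.
(* Enumerates the rationals; codes that decode to nothing yield 0, which the condition 0 < q i
   discards. *)
pose q i : R := ratr (odflt 0 (choice.unpickle i : option rat)).
have sel m : exists n, (m <= n)%N /\
    forall i, (i < m)%N -> 0 < q i -> `|k n (q i) - K (q i)| <= m.+1%:R^-1.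
  have : U [set n | (m <= n)%N /\
      forall i, (i < m)%N -> 0 < q i -> `|k n (q i) - K (q i)| <= m.+1%:R^-1].
    apply: filterI; first by apply: sU; exists m.
    have H : forall M, U [set n | forall i, (i < M)%N -> 0 < q i ->
        `|k n (q i) - K (q i)| <= m.+1%:R^-1].
      elim=> [|M IH]; first by apply: filterS filterT => n _ i.
      have HM : U [set n | 0 < q M -> `|k n (q M) - K (q M)| <= m.+1%:R^-1].
        have [q0|q0] := ltP 0 (q M); last by apply: filterS filterT.
        have /cvgrPdistC_le/(_ m.+1%:R^-1) := HK _ q0.
        rewrite invr_gt0 ltr0n => /(_ isT).
        by apply: filterS => n h _.
      apply: filterS2 HM IH => n hM hI i; rewrite ltnS leq_eqVlt => /predU1P[->//|].
      exact: hI.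
    exact: H.
  by move=> /filter_ex[n Hn]; exists n.
have [N HN] := choice sel.
(* The points where [K] jumps across a rational interval. A given interval is crossed at most once,
   hence countability. *)
pose B : set R := \bigcup_(p in [set p : rat * rat | p.1 < p.2])
  [set r | 0 < r /\ (forall s, 0 < s -> s < r -> ratr p.2 <= K s) /\
     (forall s, r < s -> K s <= ratr p.1)].
exists N, K, B; split => //.
- by move=> m; case: (HN m).
- apply: bigcup_countable => // -[y y'] /= yy'.
  have [[r0 Hr0]|Hn] := pselect (exists r, 0 < r /\ (forall s, 0 < s -> s < r -> ratr y' <= K s) /\
     (forall s, r < s -> K s <= ratr y)); last first.
    rewrite (_ : [set r | _] = set0)//; apply/seteqP; split => // r hr.
    by apply: Hn; exists r.
  have sub : [set r | 0 < r /\ (forall s, 0 < s -> s < r -> ratr y' <= K s) /\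
     (forall s, r < s -> K s <= ratr y)] `<=` [set r0].
    have key a b : 0 < a -> a < b -> (forall s, 0 < s -> s < b -> ratr y' <= K s) ->
        (forall s, a < s -> K s <= ratr y) -> False.
      move=> a0 ab h1 h2; have [l1 l2] := midf_lt ab.
      have := le_trans (h1 _ (lt_trans a0 l1) l2) (h2 _ l1).
      by rewrite leNgt ltr_rat yy'.
    move=> r [r1 [h1 h2]] /=; case: Hr0 => [r2 [h3 h4]].
    case: (ltgtP r r0) => // rr; first by case: (key r r0).
    by case: (key r0 r).
  exact: (sub_countable (subset_card_le sub)).
move=> r r0 nB.
have close (e : R) : 0 < e -> exists s1 s2, [/\ 0 < s1, s1 < r, r < s2 & K s1 - K s2 <= e].
  move=> e0; apply: contrapT => Hno; apply: nB.
  pose S := [set K s | s in [set s | r < s]].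
  have Sub : has_sup S.
    split; first by exists (K (r + 1)), (r + 1) => //=; rewrite ltrDl.
    by exists (K r) => _ [s /= rs <-]; apply: Kmono => //; exact: ltW.
  pose A := sup S.
  have left s : 0 < s -> s < r -> A + e <= K s.
    move=> s0 sr; rewrite -lerBrDr; apply: ge_sup; first exact: Sub.1.
    move=> _ [s2 /= rs2 <-]; rewrite lerBrDr leNgt; apply/negP => h; apply: Hno.
    by exists s, s2; split => //; move: h; lra.
  have right s : r < s -> K s <= A.
    by move=> rs; apply: ub_le_sup; [exact: Sub.2|exists s].
  have Ae : A < A + e by rewrite ltrDl.
  have [y] := rat_in_itvoo Ae; rewrite in_itv /= => /andP[y1 y2].
  have [y'] := rat_in_itvoo y2; rewrite in_itv /= => /andP[y3 y4].
  exists (y, y') => /=; first by rewrite -(@ltr_rat R).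
  split => //; split => [s s0 sr|s rs].
    by apply: le_trans (left s s0 sr); exact: ltW.
  by apply: le_trans (right s rs) _; exact: ltW.
have qcvg (p : rat) : 0 < (ratr p : R) -> k (N m) (ratr p) @[m --> \oo] --> K (ratr p).
  move=> p0; apply/cvgrPdistC_le => e e0.
  have qE : q (choice.pickle p) = ratr p by rewrite /q choice.pickleK.
  have /cvgr0_norm_le/(_ _ e0) := @cvg_harmonic R.
  move=> h; near=> m.
  have [_ /(_ (choice.pickle p))] := HN m; rewrite qE => /(_ _ p0) h'.
  apply: le_trans (h' _) _; first by near: m; exact: nbhs_infty_gt.
  by apply: (le_trans (ler_norm _)); near: m.
apply/cvgrPdistC_le => e e0.
have e2 : 0 < e / 2 by rewrite divr_gt0.
have [s1 [s2 [s10 s1r rs2 h]]] := close _ e2.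
have [p1] := rat_in_itvoo s1r; rewrite in_itv /= => /andP[a1 a2].
have [p2] := rat_in_itvoo rs2; rewrite in_itv /= => /andP[b1 b2].
have p10 : 0 < (ratr p1 : R) by exact: lt_trans a1.
have p20 : 0 < (ratr p2 : R) by exact: lt_trans b1.
have c1 := qcvg _ p10; have c2 := qcvg _ p20.
move/cvgrPdistC_le/(_ _ e2) : c1 => c1; move/cvgrPdistC_le/(_ _ e2) : c2 => c2.
near=> m.
have /ler_normlP[_ d1] : `|k (N m) (ratr p1) - K (ratr p1)| <= e / 2 by near: m.
have /ler_normlP[d2 _] : `|k (N m) (ratr p2) - K (ratr p2)| <= e / 2 by near: m.
have m1 := kmono (N m) _ _ p10 (ltW a2).
have m2 := kmono (N m) _ _ r0 (ltW b1).
have m3 := Kmono _ _ s10 (ltW a1).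
have m4 := Kmono _ _ p20 (ltW b2).
have m5 := Kmono _ _ p10 (ltW a2).
have m6 := Kmono _ _ r0 (ltW b1).
have E := splitr e.
by apply/ler_normlP; split; move: d1 d2 m1 m2 m3 m4 m5 m6 h; lra.
Unshelve. all: by end_near.
Qed.
End Helly.

Section DecreasingDensity.
Variable R : realType.
Implicit Types (G k : R -> R).
Let mu : {measure set _ -> \bar R} := @lebesgue_measure R.
Let D : set (measurableTypeR R) := `]0, +oo[%classic.

Definition nonincreasing_pos k := forall r s, 0 < r -> r <= s -> k s <= k r.

(** The Laplace transform of a measure with an atom d at 0 and density k; the atom is present
    because limits can concentrate mass at 0. *)
Definition has_decreasing_density G := exists (d : R) (k : R -> R),
  [/\ 0 <= d, forall r, 0 < r -> 0 <= k r, nonincreasing_pos k &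
      forall u, 0 < u -> (G u)%:E =
        (d%:E + \int[mu]_(r in D) (expR (- (u * r)) * k r)%:E)%E].

(** Superlevel sets of a monotone function are intervals. *)
Lemma nonincreasing_pos_measurable k : nonincreasing_pos k ->
  measurable_fun D (k : measurableTypeR R -> R).
Proof.
move=> km mD; apply: (measurability _ (RGenOInfty.measurableE R)) => //.
move=> _ [_ [y ->] <-]; apply: is_interval_measurable => a b [] Da ka [] Db kb c /andP[ac cb].
move: Da ka Db kb; rewrite /D /= !in_itv /= !andbT => a0 ka b0 kb.
have c0 := lt_le_trans a0 ac.
by split => //; apply: (lt_le_trans kb); exact: km.
Qed.

Let mD : measurable D. Proof. exact: measurable_itv. Qed.

Lemma measurable_expRNk k u (A : set (measurableTypeR R)) : nonincreasing_pos k -> measurable A -> A `<=` D ->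
  measurable_fun A (fun r : measurableTypeR R => (expR (- (u * r)) * k r)%:E).
Proof.
move=> km mA AD; apply/measurable_EFinP; apply: measurable_funM.
  by apply: measurable_funTS; apply: measurableT_comp => //; apply: measurableT_comp => //;
    exact: measurable_funM.
by apply: measurable_funS mD AD _; exact: nonincreasing_pos_measurable.
Qed.

Lemma integral_expRN u r : 0 < u -> 0 < r ->
  (\int[mu]_(s in `]0%R, r[) (expR (- (u * s)))%:E)%E = ((1 - expR (- (u * r))) / u)%:E.
Proof.
move=> u0 r0.
have mE (A : set (measurableTypeR R)) : measurable_fun A (fun s : measurableTypeR R => (expR (- (u * s)))%:E).
  apply: measurable_funTS; apply/measurable_EFinP; apply: measurableT_comp => //.
  by apply: measurableT_comp => //; exact: measurable_funM.
rewrite integral_itv_bndo_bndc//; last exact: mE.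
rewrite integral_itv_obnd_cbnd//; last exact: mE.
have dF (x : R) : is_derive x 1 (fun s => - (u^-1 * expR (- (u * s)))) (expR (- (u * x))).
  apply: is_derive_eq.
  rewrite /GRing.scale /=; field. by rewrite gt_eqF.
rewrite (@continuous_FTC2 _ _ (fun s => - (u^-1 * expR (- (u * s)))))//.
- by rewrite mulr0 oppr0 expR0 -EFinB; congr EFin; field; rewrite gt_eqF.
- apply: continuous_subspaceT => x.
  apply: continuous_cvg; first exact: continuous_expR.
  by apply: cvgN; apply: cvgM => //; exact: cvg_cst.
- have cF : continuous (fun s => - (u^-1 * expR (- (u * s)))).
    move=> x; apply: differentiable_continuous; apply/derivable1_diffP.
    by have [] := dF x.
  split.
  + by move=> x _; have [] := dF x.
  + by apply: cvg_at_right_filter; exact: cF.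
  + by apply: cvg_at_left_filter; exact: cF.
- by move=> x _; rewrite derive1E; exact: derive_val.
Qed.

Lemma integral_expRN_finite u : 0 < u ->
  (\int[mu]_(s in D) (expR (- (u * s)))%:E <= (u^-1)%:E)%E.
Proof.
move=> u0.
have mE (A : set (measurableTypeR R)) : measurable_fun A (fun s : measurableTypeR R => (expR (- (u * s)))%:E).
  apply: measurable_funTS; apply/measurable_EFinP; apply: measurableT_comp => //.
  by apply: measurableT_comp => //; exact: measurable_funM.
pose F (n : nat) : set (measurableTypeR R) := `]0%R, (n.+1%:R : R)[%classic.
pose f (s : measurableTypeR R) : \bar R := (expR (- (u * s)))%:E.
have DE : D = \bigcup_n F n.
  apply/seteqP; split => r; rewrite /D /F /= in_itv /=.
    rewrite andbT => r0; exists (Num.truncn r) => //=; rewrite in_itv /= r0 /=.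
    exact: truncnS_gt.
  by move=> [n _ /=]; rewrite in_itv /= => /andP[->].
have ndF : nondecreasing_seq F.
  apply/nondecreasing_seqP => n; apply/subsetPset => r; rewrite /F /= !in_itv /=.
  by move=> /andP[-> /lt_le_trans]; apply; rewrite ler_nat.
have mF i : measurable (F i) by exact: measurable_itv.
have mfF i : measurable_fun (F i) f by exact: mE.
have f0 i x : F i x -> (0 <= f x)%E by move=> _; rewrite lee_fin expR_ge0.
rewrite DE; have h := @ge0_nondecreasing_set_cvg_integral _ _ _ F f mu ndF mF mfF f0.
rewrite -(cvg_lim _ h)//; apply: lime_le; first by apply/cvg_ex; eexists; exact: h.
apply: nearW => n; rewrite /F /f integral_expRN ?ltr0n// lee_fin.
by rewrite ler_pdivrMr// mulVf ?gt_eqF// gerBl expR_ge0.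
Qed.

Lemma decreasing_density_exp r : 0 <= r ->
  has_decreasing_density (fun u => (1 - expR (- (r * u))) / u).
Proof.
rewrite le_eqVlt => /predU1P[<-|r0].
  exists 0, (fun=> 0); split => // u u0.
  rewrite mul0r oppr0 expR0 subrr mul0r.
  by under eq_integral do rewrite mulr0; rewrite integral0 adde0.
exists 0, (fun s : R => (s < r)%R%:R); split => //.
  move=> s t s0 st; rewrite ler_nat.
  by case: (ltP t r) => // tr; rewrite (le_lt_trans st tr).
move=> u u0; rewrite add0e [r * u]mulrC -integral_expRN//.
rewrite integral_mkcond [RHS]integral_mkcond; apply: eq_integral => s _.
rewrite /patch !mem_setE /D !in_itv /= andbT.
by case: (0 < s) => //=; case: (s < r); rewrite ?mulr1 ?mulr0.
Qed.

Lemma decreasing_density0 : has_decreasing_density (fun=> 0).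
Proof.
exists 0, (fun=> 0); split => // u u0.
by under eq_integral do rewrite mulr0; rewrite integral0 adde0.
Qed.

Lemma decreasing_densityD G H : has_decreasing_density G -> has_decreasing_density H ->
  has_decreasing_density (fun u => G u + H u).
Proof.
move=> [d [k [d0 k0 km Gk]]] [e [l [e0 l0 lm Hl]]].
exists (d + e), (fun r => k r + l r); split.
- exact: addr_ge0.
- by move=> r r0; rewrite addr_ge0 ?k0 ?l0.
- by move=> r s r0 rs; rewrite lerD ?km ?lm.
move=> u u0; rewrite EFinD Gk// Hl// EFinD.
have -> : (\int[mu]_(r in D) (expR (- (u * r)) * (k r + l r))%:E =
  \int[mu]_(r in D) (expR (- (u * r)) * k r)%:E +
  \int[mu]_(r in D) (expR (- (u * r)) * l r)%:E)%E.
  rewrite -ge0_integralD//.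
  - by apply: eq_integral => r _; rewrite mulrDr EFinD.
  - by move=> r; rewrite /D /= in_itv /= andbT => r0; rewrite lee_fin mulr_ge0 ?expR_ge0 ?k0.
  - exact: measurable_expRNk.
  - by move=> r; rewrite /D /= in_itv /= andbT => r0; rewrite lee_fin mulr_ge0 ?expR_ge0 ?l0.
  - exact: measurable_expRNk.
by rewrite addeACA.
Qed.

Lemma decreasing_densityZ a G : 0 <= a -> has_decreasing_density G ->
  has_decreasing_density (fun u => a * G u).
Proof.
move=> a0 [d [k [d0 k0 km Gk]]].
exists (a * d), (fun r => a * k r); split.
- exact: mulr_ge0.
- by move=> r r0; rewrite mulr_ge0 ?k0.
- by move=> r s r0 rs; rewrite ler_wpM2l ?km.
move=> u u0; rewrite EFinM Gk// ge0_muleDr ?lee_fin//; last first.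
  apply: integral_ge0 => r; rewrite /D /= in_itv /= andbT => r0.
  by rewrite lee_fin mulr_ge0 ?expR_ge0 ?k0.
rewrite -ge0_integralZl//.
- by congr (_ + _)%E; apply: eq_integral => r _; rewrite -EFinM mulrCA.
- exact: measurable_expRNk.
- by move=> r; rewrite /D /= in_itv /= andbT => r0; rewrite lee_fin mulr_ge0 ?expR_ge0 ?k0.
Qed.

Lemma decreasing_density_ext G H : (forall u, 0 < u -> G u = H u) ->
  has_decreasing_density G -> has_decreasing_density H.
Proof.
move=> GH [d [k [d0 k0 km Gk]]]; exists d, k; split => // u u0.
by rewrite -GH// Gk.
Qed.

End DecreasingDensity.

Section DecreasingDensityLimit.
Variable R : realType.
Implicit Types (G k : R -> R).
Let mu : {measure set (measurableTypeR R) -> \bar R} := @lebesgue_measure R.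
Let D : set (measurableTypeR R) := `]0, +oo[%classic.
Let A (e : R) : set (measurableTypeR R) := `]0%R, e[%classic.
Let B (e : R) : set (measurableTypeR R) := `[e, +oo[%classic.
Let mD : measurable D. Proof. exact: measurable_itv. Qed.
Let mA e : measurable (A e). Proof. exact: measurable_itv. Qed.
Let mB e : measurable (B e). Proof. exact: measurable_itv. Qed.
Let AD e : A e `<=` D.
Proof. by move=> r; rewrite /A /D /= !in_itv /= andbT => /andP[]. Qed.
Let BD e : 0 < e -> B e `<=` D.
Proof. by move=> e0 r; rewrite /B /D /= !in_itv /= !andbT; exact: lt_le_trans. Qed.
Let ABD e : 0 < e -> A e `|` B e = D.
Proof.
move=> e0; apply/seteqP; split => [r [/AD//|/(BD e0)//]|r].
rewrite /A /B /D /= !in_itv /= !andbT => r0.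
by have [re|re] := ltP r e; [left; rewrite r0|right].
Qed.
Let ABdisj e : [disjoint A e & B e].
Proof.
apply/disj_setPLR => r; rewrite /A /B /= !in_itv /= andbT.
by move=> /andP[_ r1]; apply/negP; rewrite -ltNge.
Qed.

Let L k (S : set (measurableTypeR R)) u : \bar R :=
  \int[mu]_(r in S) (expR (- (u * r)) * k r)%:E.

Let f0 k u (S : set (measurableTypeR R)) : (forall r, 0 < r -> 0 <= k r) -> S `<=` D ->
  forall r, S r -> (0 <= (expR (- (u * r)) * k r)%:E)%E.
Proof.
move=> k0 SD r /SD; rewrite /D /= in_itv /= andbT => r0.
by rewrite lee_fin mulr_ge0 ?expR_ge0 ?k0.
Qed.

Let L_ge0 k S u : (forall r, 0 < r -> 0 <= k r) -> S `<=` D -> (0 <= L k S u)%E.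
Proof. by move=> k0 SD; apply: integral_ge0 => r Sr; exact: f0 Sr. Qed.

Let L_split k e u : 0 < e -> (forall r, 0 < r -> 0 <= k r) -> nonincreasing_pos k ->
  L k D u = (L k (A e) u + L k (B e) u)%E.
Proof.
move=> e0 k0 km; rewrite /L -{1}(ABD e0) ge0_integral_setU//.
- by rewrite ABD//; exact: measurable_expRNk.
- by rewrite ABD//; exact: f0.
Qed.

Let L_head k e u : 0 < e -> (forall r, 0 < r -> 0 <= k r) -> nonincreasing_pos k ->
  0 < u -> ((expR (- (u * e)) * k e * e)%:E <= L k (A e) u)%E.
Proof.
move=> e0 k0 km u0.
have muA : mu (A e) = e%:E.
  by rewrite /mu /A /= lebesgue_measure_itv /= lte_fin e0 sube0.
have -> : (expR (- (u * e)) * k e * e)%:E =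
    (\int[mu]_(r in A e) (cst (expR (- (u * e)) * k e)%:E r))%E.
  by rewrite integral_cst// muA EFinM.
apply: ge0_le_integral => //.
- by move=> r _; rewrite lee_fin mulr_ge0 ?expR_ge0 ?k0.
- by apply: measurable_expRNk => //; exact: AD.
- move=> r; rewrite /A /= in_itv /= => /andP[r0 re].
  rewrite lee_fin; apply: ler_pM; rewrite ?expR_ge0 ?k0//.
    by rewrite ler_expR lerN2 ler_pM2l// ltW.
  by apply: km => //; exact: ltW.
Qed.

(** On (0, e) one has exp(-u r) <= 1 <= exp(v e) exp(-v r): near 0 the transform hardly depends on
    its argument. *)
Let L_exp k e u v : 0 <= u -> 0 <= v -> 0 < e -> (forall r, 0 < r -> 0 <= k r) ->
  nonincreasing_pos k -> (L k (A e) u <= (expR (v * e))%:E * L k (A e) v)%E.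
Proof.
move=> u0 v0 e0 k0 km.
rewrite /L -ge0_integralZl//; [|by apply: measurable_expRNk => //; exact: AD|
  by apply: f0 => //; exact: AD].
apply: ge0_le_integral => //.
- by apply: f0 => //; exact: AD.
- by apply: measurable_expRNk => //; exact: AD.
- apply: emeasurable_funM; first exact: measurable_cst.
  by apply: measurable_expRNk => //; exact: AD.
- move=> r; rewrite /A /= in_itv /= => /andP[r0 re].
  rewrite -EFinM lee_fin mulrA ler_wpM2r ?k0// -expRD ler_expR.
  have : 0 <= u * r by rewrite mulr_ge0// ltW.
  have : v * r <= v * e by rewrite ler_wpM2l// ltW.
  lra.
Qed.

(** Helly's selection provides the density [K]. On [e, +oo) the transforms converge by domination.
    The rest, atom plus mass in (0, e), has a limit that becomes independent of u as e tends to 0: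
    it is the new atom. *)
Lemma decreasing_density_lim (G : nat -> R -> R) H :
  (forall n, has_decreasing_density (G n)) ->
  (forall u, 0 < u -> G n u @[n --> \oo] --> H u) -> has_decreasing_density H.
Proof.
move=> dG GH.
have /choice[dk Hdk] : forall n, exists dk : R * (R -> R),
    [/\ 0 <= dk.1, forall r, 0 < r -> 0 <= dk.2 r, nonincreasing_pos dk.2 &
      forall u, 0 < u -> (G n u)%:E = (dk.1%:E + L dk.2 D u)%E].
  by move=> n; have [d [k [d0 k0 km Gk]]] := dG n; exists (d, k).
pose d n := (dk n).1; pose k n := (dk n).2.
have d0 n : 0 <= d n by case: (Hdk n).
have k0 n r : 0 < r -> 0 <= k n r by case: (Hdk n) => _ + _ _; apply.
have km n : nonincreasing_pos (k n) by case: (Hdk n).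
have Gk n u : 0 < u -> (G n u)%:E = ((d n)%:E + L (k n) D u)%E.
  by case: (Hdk n) => _ _ _; apply.
have /choice[C HC] : forall r : R, exists c : R, 0 < r -> forall n, k n r <= c.
  move=> r.
  have [r0|r0] := ltP 0 r; last by exists 0.
  have ri : 0 < r^-1 by rewrite invr_gt0.
  have cG : cvgn (G ^~ r^-1) by apply/cvg_ex; exists (H r^-1); exact: GH.
  have [M [_ HM]] := cvg_seq_bounded cG.
  (* At u = 1/r the integral over (0, r) is at least exp(-1) k(r) r, so k(r) <= e G(1/r)/r. *)
  exists ((M + 1) * expR 1 / r) => _ n.
  have GM : G n r^-1 <= M + 1.
    by apply: (le_trans (ler_norm _)); apply: HM => //; rewrite ltrDl.
  have : ((expR (- (r^-1 * r)) * k n r * r)%:E <= (G n r^-1)%:E)%E.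
    apply: (le_trans (L_head r0 (k0 n) (km n) ri)).
    rewrite Gk// (L_split _ r0 (k0 n) (km n)).
    apply: (@le_trans _ _ (L (k n) (A r) r^-1 + L (k n) (B r) r^-1)%E).
      by rewrite leeDl//; exact: (L_ge0 _ (k0 n) (BD r0)).
    by rewrite leeDr// lee_fin.
  rewrite lee_fin mulVf ?gt_eqF// => h.
  rewrite ler_pdivlMr//.
  have E1 : expR 1 * expR (-1) = 1 :> R by rewrite -expRD subrr expR0.
  have -> : k n r * r = expR (- 1) * k n r * r * expR 1.
    by rewrite -[LHS]mul1r -{1}E1; ring.
  by rewrite ler_pM2r ?expR_gt0//; exact: le_trans h _.
have [N [K [Z [Nm Z0 K0 Km KN]]]] := @helly_selection R k C
  (fun n r r0 => ltac:(by rewrite k0//= HC)) km.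
pose g m := k (N m); pose e m := d (N m).
have GN u : 0 < u -> G (N m) u @[m --> \oo] --> H u.
  move=> u0; apply: (cvg_comp N (G ^~ u) _ (GH u u0)).
  by move=> P [M _ HP]; exists M => // m /= Mm; apply: HP => /=; exact: leq_trans (Nm m).
have g0 m r : 0 < r -> 0 <= g m r by exact: k0.
have gm m : nonincreasing_pos (g m) by exact: km.
have Gg m u : 0 < u -> (G (N m) u)%:E = ((e m)%:E + L (g m) D u)%E by exact: Gk.
have Lfin k' S u : (0 <= L k' S u)%E -> (L k' S u < +oo)%E -> L k' S u = (fine (L k' S u))%:E.
  by move=> h1 h2; rewrite fineK// ge0_fin_numE.
have gBfin m u ep : 0 < u -> 0 < ep -> (L (g m) (B ep) u < +oo)%E.
  move=> u0 ep0; apply: (@le_lt_trans _ _ (G (N m) u)%:E); last exact: ltry.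
  rewrite Gg// (L_split _ ep0 (g0 m) (gm m)).
  apply: (@le_trans _ _ (L (g m) (A ep) u + L (g m) (B ep) u)%E).
    by rewrite leeDr//; exact: (L_ge0 _ (g0 m) (@AD _)).
  by rewrite leeDr// lee_fin; exact: d0.
have domi u ep : 0 < u -> 0 < ep ->
    mu.-integrable (B ep) (fun r : measurableTypeR R => (C ep * expR (- (u * r)))%:E).
  move=> u0 ep0.
  have mE (S : set (measurableTypeR R)) :
      measurable_fun S (fun s : measurableTypeR R => (expR (- (u * s)))%:E).
    apply: measurable_funTS; apply/measurable_EFinP; apply: measurableT_comp => //.
    by apply: measurableT_comp => //; exact: measurable_funM.
  under eq_fun do rewrite EFinM.
  apply: integrableZl => //; apply/integrableP; split; first exact: mE.
  under eq_integral do rewrite abse_EFin ger0_norm ?expR_ge0//.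
  apply: (@le_lt_trans _ _ (u^-1)%:E); last exact: ltry.
  apply: le_trans (integral_expRN_finite u0).
  by apply: ge0_subset_integral => //; exact: BD.
have [cvgB_ KBfin] : (forall u ep, 0 < u -> 0 < ep ->
      L (g m) (B ep) u @[m --> \oo] --> L K (B ep) u) /\
    (forall u ep, 0 < u -> 0 < ep -> (L K (B ep) u < +oo)%E).
  have H1 u ep : 0 < u -> 0 < ep -> mu.-integrable (B ep)
        (fun r : measurableTypeR R => (expR (- (u * r)) * K r)%:E) /\
      L (g m) (B ep) u @[m --> \oo] --> L K (B ep) u.
    move=> u0 ep0.
    have mgm m : measurable_fun (B ep) (fun r : measurableTypeR R => (expR (- (u * r)) * g m r)%:E).
      by apply: measurable_expRNk => //; exact: BD.
    have mK : measurable_fun (B ep) (fun r : measurableTypeR R => (expR (- (u * r)) * K r)%:E).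
      by apply: measurable_expRNk => //; exact: BD.
    have aec : {ae mu, forall r, B ep r ->
        (expR (- (u * r)) * g m r)%:E @[m --> \oo] --> (expR (- (u * r)) * K r)%:E}.
      exists Z; split.
      - exact: countable_measurable.
      - exact: countable_lebesgue_measure0.
      - move=> r /=; apply: contra_notP => nZ Br.
        have r0 : 0 < r by move: (BD ep0 Br); rewrite /D /= in_itv /= andbT.
        apply: cvg_EFin; first exact: nearW.
        by apply: cvgM; [exact: cvg_cst|exact: KN].
    have aed : {ae mu, forall r m, B ep r ->
        (`|(expR (- (u * r)) * g m r)%:E| <= (C ep * expR (- (u * r)))%:E)%E}.
      apply: aeW => r m Br.
      have r0 : 0 < r by move: (BD ep0 Br); rewrite /D /= in_itv /= andbT.
      rewrite abse_EFin lee_fin ger0_norm ?mulr_ge0 ?expR_ge0 ?g0//.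
      rewrite mulrC ler_wpM2r ?expR_ge0//.
      apply: le_trans (HC ep ep0 (N m)); apply: gm => //.
      by move: Br; rewrite /B /= in_itv /= andbT.
    have [i1 _ i2] := dominated_convergence (mB ep) mgm mK aec (domi u ep u0 ep0) aed.
    by split.
  split => u ep u0 ep0; first by case: (H1 u ep u0 ep0).
  have [/integrableP[_ h] _] := H1 u ep u0 ep0.
  rewrite /L; apply: le_lt_trans h.
  apply: ge0_le_integral => //.
  - by apply: f0 => //; exact: BD.
  - by apply: measurable_expRNk => //; exact: BD.
  - by apply: measurableT_comp => //; apply: measurable_expRNk => //; exact: BD.
  - by move=> r Br; exact: lee_abs.
pose T ep u := fine (L K (B ep) u).
have TE ep u : 0 < u -> 0 < ep -> L K (B ep) u = (T ep u)%:E.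
  by move=> u0 ep0; apply: Lfin; [apply: L_ge0 => //; exact: BD|exact: KBfin].
(* The atom plus the integral over (0, ep), written as a difference so that its limit in m is
   visible. *)
pose Am m ep u := G (N m) u - fine (L (g m) (B ep) u).
have AmE m ep u : 0 < u -> 0 < ep -> (Am m ep u)%:E = ((e m)%:E + L (g m) (A ep) u)%E.
  move=> u0 ep0; have h : L (g m) (B ep) u = (fine (L (g m) (B ep) u))%:E.
    by apply: Lfin; [exact: (L_ge0 _ (g0 m) (BD ep0))|exact: gBfin].
  rewrite /Am EFinB Gg// (L_split _ ep0 (g0 m) (gm m)) -h addeA addeK//.
  by rewrite h.
have Amc ep u : 0 < u -> 0 < ep -> Am m ep u @[m --> \oo] --> H u - T ep u.
  move=> u0 ep0; apply: cvgB; first exact: GN.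
  by apply: fine_cvg; rewrite -TE//; exact: cvgB_.
have R0 ep u : 0 < u -> 0 < ep -> 0 <= H u - T ep u.
  move=> u0 ep0; apply: (cvgr_to_ge (Amc ep u u0 ep0)); apply: nearW => m.
  rewrite -lee_fin AmE//; apply: adde_ge0; first by rewrite lee_fin; exact: d0.
  exact: (L_ge0 _ (g0 m) (@AD _)).
(* The limit of [L_exp]; with ep tending to 0 and the roles of u and v exchanged, it makes the
   remainder constant. *)
have Rexp ep u v : 0 < u -> 0 < v -> 0 < ep ->
    H u - T ep u <= expR (v * ep) * (H v - T ep v).
  move=> u0 v0 ep0.
  apply: (ler_cvg_to (Amc ep u u0 ep0)
    (cvgM (cvg_cst (expR (v * ep))) (Amc ep v v0 ep0))).
  apply: nearW => m; rewrite -lee_fin EFinM !AmE// ge0_muleDr ?lee_fin//; last 2 first.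
  - exact: d0.
  - exact: (L_ge0 _ (g0 m) (@AD _)).
  apply: leeD; last exact: (L_exp (ltW u0) (ltW v0) ep0 (g0 m) (gm m)).
  rewrite -EFinM lee_fin ler_peMl//; first exact: d0.
  by rewrite -expR0 ler_expR mulr_ge0// ltW.
pose ep i : R := i.+1%:R^-1.
have ep0 i : 0 < ep i by rewrite invr_gt0 ltr0n.
have DU : D = \bigcup_i B (ep i).
  apply/seteqP; split => r; last by move=> [i _]; exact: BD.
  rewrite /D /= in_itv /= andbT => r0; exists (Num.truncn r^-1) => //.
  rewrite /B /= in_itv /= andbT /ep -[leRHS]invrK lef_pV2 ?posrE ?invr_gt0 ?ltr0n//.
  exact: ltW (truncnS_gt _).
have Tcvg u : 0 < u -> (T (ep i) u)%:E @[i --> \oo] --> L K D u.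
  move=> u0; have ndB : nondecreasing_seq (fun i => B (ep i)).
    apply/nondecreasing_seqP => i; apply/subsetPset => r; rewrite /B /= !in_itv /= !andbT.
    by apply: le_trans; rewrite /ep lef_pV2 ?posrE ?ltr0n// ler_nat.
  have h := @ge0_nondecreasing_set_cvg_integral _ _ _ (fun i => B (ep i))
    (fun r : measurableTypeR R => (expR (- (u * r)) * K r)%:E) mu ndB (fun i => mB _)
    (fun i => measurable_expRNk u Km (mB _) (BD (ep0 i)))
    (fun i => f0 u K0 (BD (ep0 i))).
  rewrite -DU in h.
  by rewrite (_ : (fun i => _) = fun i => L K (B (ep i)) u)//; apply/funext => i; rewrite TE.
have Kfin u : 0 < u -> (L K D u <= (H u)%:E)%E.
  move=> u0; rewrite -(cvg_lim _ (Tcvg u u0))//; apply: lime_le.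
    by apply/cvg_ex; eexists; exact: Tcvg.
  by apply: nearW => i; rewrite lee_fin -subr_ge0; exact: R0.
pose T0 u := fine (L K D u).
have T0E u : 0 < u -> L K D u = (T0 u)%:E.
  move=> u0; apply: Lfin; first exact: L_ge0.
  by apply: le_lt_trans (Kfin u u0) _; exact: ltry.
have Tc u : 0 < u -> H u - T (ep i) u @[i --> \oo] --> H u - T0 u.
  move=> u0; apply: cvgB; first exact: cvg_cst.
  by have := Tcvg u u0; rewrite T0E// => /fine_cvg.
have Rle u v : 0 < u -> 0 < v -> H u - T0 u <= H v - T0 v.
  move=> u0 v0.
  have ec : expR (v * ep i) @[i --> \oo] --> (1 : R).
    have hc : v * ep i @[i --> \oo] --> (0 : R).
      by have := cvgM (cvg_cst v) (@cvg_harmonic R); rewrite mulr0; exact.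
    by have := cvg_comp _ _ hc (@continuous_expR R 0); rewrite expR0; exact.
  have := cvgM ec (Tc v v0); rewrite mul1r => h.
  apply: (ler_cvg_to (Tc u u0) (h _)); apply: nearW => i.
  exact: Rexp.
exists (H 1 - T0 1), K; split => //.
  by apply: (cvgr_to_ge (Tc 1 ltr01)); apply: nearW => i; exact: R0.
move=> u u0; rewrite -/(L K D u) T0E// -EFinD; congr EFin.
have : H 1 - T0 1 = H u - T0 u by apply/eqP; rewrite eq_le !Rle.
by move=> ->; rewrite subrK.
Qed.

(** If f is the transform of nu, the quotient is the transform of the tail r |-> nu((r, +oo]). For a
    single exponential the tail is an indicator, and limits are handled by
    [decreasing_density_lim]. *)
Lemma laplace_decreasing_density (f : R -> R) : laplace_cone f ->
  has_decreasing_density (fun u => (f 0 - f u) / u).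
Proof.
elim=> {f}[f [r r0 ->]||f g _ IH1 _ IH2|a f a0 _ IH|F f _ IH Ff].
- apply: decreasing_density_ext (decreasing_density_exp r0) => u u0.
  by rewrite mulr0 oppr0 expR0.
- by apply: decreasing_density_ext (decreasing_density0 R) => u u0; rewrite subrr mul0r.
- apply: decreasing_density_ext (decreasing_densityD IH1 IH2) => u u0.
  by rewrite -mulrDl; congr (_ / _); ring.
- apply: decreasing_density_ext (decreasing_densityZ a0 IH) => u u0.
  by rewrite mulrA mulrBr.
- apply: (decreasing_density_lim IH) => u u0.
  apply: cvgM; last exact: cvg_cst.
  by apply: cvgB; apply: Ff => //=; exact: ltW.
Qed.

End DecreasingDensityLimit.

(** * The Bernstein function log I *)

Section EntireDerivatives.
Variable R : realType.
Implicit Types (b : nat -> R) (f g : R -> R).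

Definition entire_coef b := forall x, cvgn (pseries b x).

Lemma entire_coef_abs b x : entire_coef b -> 0 <= x -> cvgn (series (fun n => `|b n| * x ^+ n)).
Proof.
move=> eb x0; have h : `|x| < `|x + 1| by rewrite !ger0_norm ?addr_ge0// ltrDl.
exact: (is_cvg_pseries_inside_norm (eb (x + 1)) h).
Qed.

Lemma entire_coef_diffs b : entire_coef b -> entire_coef (pseries_diffs b).
Proof.
move=> eb x; apply: normed_cvg.
(* The factor 2 pays for n.+1 <= 2^(n.+1), the summand 1 for the extra power. *)
pose rho := 2 * (`|x| + 1).
have r0 : 0 <= rho by rewrite mulr_ge0// addr_ge0.
apply: (@series_le_cvg _ _ (fun n => `|b n.+1| * rho ^+ n.+1)).
- by move=> n; exact: normr_ge0.
- by move=> n; rewrite mulr_ge0// exprn_ge0.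
- move=> n; rewrite /= /pseries_diffs !normrM normrX normr_nat.
  rewrite [leLHS](_ : _ = `|b n.+1| * (n.+1%:R * `|x| ^+ n)); last by ring.
  rewrite ler_wpM2l// /rho exprMn; apply: ler_pM => //; rewrite ?exprn_ge0 //.
    by rewrite -natrX ler_nat ltnW// ltn_expl.
  apply: (@le_trans _ _ ((`|x| + 1) ^+ n)).
    by apply: lerXn2r; rewrite ?nnegrE ?addr_ge0// lerDl.
  by rewrite exprSr ler_peMr ?exprn_ge0 ?addr_ge0// lerDr.
pose v n : R := `|b n| * rho ^+ n.
have h : series v n.+1 @[n --> \oo] --> limn (series v).
  by rewrite (cvg_shiftS (series v)); exact: entire_coef_abs.
rewrite (_ : series _ = fun n => series v n.+1 - `|b 0%N|).
  by apply/cvg_ex; eexists; exact: cvgB h (cvg_cst `|b 0%N|).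
apply/funext => n; rewrite /series /v /= [in RHS]big_nat_recl//= expr0 mulr1.
by rewrite [in RHS]addrC addKr.
Qed.

Lemma is_derive_pseries b (x : R) : entire_coef b ->
  is_derive x 1 (fun x => limn (pseries b x)) (limn (pseries (pseries_diffs b) x)).
Proof.
move=> eb; apply: (@pseries_snd_diffs _ b (`|x| + 1)).
- exact: eb.
- exact: entire_coef_diffs.
- by do 2 apply: entire_coef_diffs.
- by rewrite [ltRHS]ger0_norm ?addr_ge0// ltrDl.
Qed.

(** Each derivative is carried as a witness, so closure under sums, products and inverses is a plain
    induction without iterated [derive1]. *)
Fixpoint Cn_pos n f : Prop := if n is m.+1 then
  exists2 f', (forall u : R, 0 < u -> is_derive u 1 f (f' u)) & Cn_pos m f' else True.

Lemma Cn_posW n f : Cn_pos n.+1 f -> Cn_pos n f.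
Proof.
elim: n f => [//|n IH] f [f' df cf']; exists f' => //; exact: IH.
Qed.

Lemma Cn_posD n f g : Cn_pos n f -> Cn_pos n g -> Cn_pos n (fun u => f u + g u).
Proof.
elim: n f g => [//|n IH] f g [f' df cf'] [g' dg cg'].
exists (fun u => f' u + g' u); last exact: IH.
by move=> u u0; have := df u u0; have := dg u u0 => d1 d2; exact: is_deriveD.
Qed.

Lemma Cn_posM n f g : Cn_pos n f -> Cn_pos n g -> Cn_pos n (fun u => f u * g u).
Proof.
elim: n f g => [//|n IH] f g cf cg.
have cf1 := Cn_posW cf; have cg1 := Cn_posW cg.
case: cf => f' df cf'; case: cg => g' dg cg'.
exists (fun u => f u * g' u + g u * f' u); last by apply: Cn_posD; apply: IH.
by move=> u u0; have := df u u0; have := dg u u0 => d1 d2; exact: is_deriveM.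
Qed.

Lemma Cn_posN n f : Cn_pos n f -> Cn_pos n (fun u => - f u).
Proof.
elim: n f => [//|n IH] f [f' df cf'].
exists (fun u => - f' u); last exact: IH.
by move=> u u0; have := df u u0 => d1; exact: is_deriveN.
Qed.

Lemma Cn_posV n f : (forall u, 0 < u -> f u != 0) -> Cn_pos n f ->
  Cn_pos n (fun u => (f u)^-1).
Proof.
move=> f0; elim: n f f0 => [//|n IH] f f0 cf.
have cV := IH _ f0 (Cn_posW cf).
case: cf => f' df cf'.
exists (fun u => - ((f u)^-1 * (f u)^-1) * f' u).
  move=> u u0; have := df u u0 => d1; have := is_deriveV (f0 u u0) d1.
  by rewrite /GRing.scale /= expr2 invfM.
by apply: Cn_posM => //; apply: Cn_posN; exact: Cn_posM.
Qed.

Lemma Cn_pos_pseries n b : entire_coef b -> Cn_pos n (fun x => limn (pseries b x)).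
Proof.
elim: n b => [//|n IH] b eb.
exists (fun x => limn (pseries (pseries_diffs b) x)); last exact: IH (entire_coef_diffs eb).
by move=> u _; exact: is_derive_pseries.
Qed.

Lemma derive1n_eq_pos n f g : (forall u, 0 < u -> f u = g u) ->
  forall u, 0 < u -> (f^`(n))%classic u = (g^`(n))%classic u.
Proof.
elim: n f g => [//|n IH] f g fg u u0; rewrite !derive1Sn.
apply: IH => // {}u {}u0; rewrite !derive1E; apply: near_eq_derive.
by near=> z; apply: fg; near: z; exact: lt_nbhsr.
Unshelve. all: by end_near.
Qed.

Lemma derivable_derive1n_pos n f : Cn_pos n.+1 f ->
  forall u, 0 < u -> derivable (f^`(n))%classic u 1.
Proof.
elim: n f => [|n IH] f [f' df cf'] u u0; first by have [] := df u u0.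
rewrite derive1Sn; have d := IH _ cf' u u0.
have h := derivableP d; have [] // : is_derive u 1 ((f^`())^`(n))%classic ('D_1 (f'^`(n))%classic u).
apply: near_eq_is_derive h; near=> z.
have z0 : 0 < z by near: z; exact: lt_nbhsr.
apply: derive1n_eq_pos => // v v0.
by rewrite derive1E; have := df v v0 => d1; rewrite derive_val.
Unshelve. all: by end_near.
Qed.

(* Alternating signs are propagated from finite differences with arbitrary
   steps to derivatives: [- f'] is a limit of scaled differences of [f]. *)
Definition dstep (h : R) f u := f u - f (u + h).

Definition alternating_pos f := forall hs : seq R, all (fun h => 0 < h) hs ->
  forall u, 0 < u -> 0 <= foldr dstep f hs u.

Lemma foldr_dstepD hs f g u :
  foldr dstep (fun u => f u + g u) hs u = foldr dstep f hs u + foldr dstep g hs u.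
Proof. by elim: hs u => [//|h hs IH] u /=; rewrite /dstep !IH; ring. Qed.

Lemma foldr_dstepZ hs a f u :
  foldr dstep (fun u => a * f u) hs u = a * foldr dstep f hs u.
Proof. by elim: hs u => [//|h hs IH] u /=; rewrite /dstep !IH; ring. Qed.

Lemma foldr_dstep_cvg hs (F : nat -> R -> R) f : all (fun h => 0 < h) hs ->
  (forall u, 0 < u -> F n u @[n --> \oo] --> f u) ->
  forall u, 0 < u -> foldr dstep (F n) hs u @[n --> \oo] --> foldr dstep f hs u.
Proof.
move=> + Ff; elim: hs => [_|h hs IH /= /andP[h0 hs0]] u u0; first exact: Ff.
by apply: cvgB; apply: IH => //; exact: addr_gt0.
Qed.

Lemma alternating_pos_lim (F : nat -> R -> R) f : (forall n, alternating_pos (F n)) ->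
  (forall u, 0 < u -> F n u @[n --> \oo] --> f u) -> alternating_pos f.
Proof.
move=> aF Ff hs hs0 u u0.
apply: (limr_ge0 (foldr_dstep_cvg hs0 Ff u0)).
by apply: nearW => n; exact: aF.
Qed.

(** On exp(-r q) each step h multiplies by 1 - exp(-r h) >= 0. *)
Lemma alternating_cone f : cone [set u : R | 0 < u]
  [set f | exists2 r : R, 0 <= r & f = fun q => expR (- (r * q))] f -> alternating_pos f.
Proof.
elim=> {f}[f [r r0 ->]||f g _ IH1 _ IH2|a f a0 _ IH|F f _ IH Ff] => [hs hs0 u u0|hs hs0 u u0|hs hs0 u u0|hs hs0 u u0|].
- have [c c0 ->] : exists2 c, 0 <= c & foldr dstep (fun q => expR (- (r * q))) hs =
      fun q => c * expR (- (r * q)).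
    elim: hs hs0 => [_|h hs IH /= /andP[h0 hs0]].
      by exists 1 => //; apply/funext => q; rewrite mul1r.
    have [c c0 E] := IH hs0; exists (c * (1 - expR (- (r * h)))).
      by rewrite mulr_ge0// subr_ge0 expR_le1 oppr_le0 mulr_ge0// ltW.
    apply/funext => q; rewrite E /dstep mulrDr opprD expRD; ring.
  by rewrite mulr_ge0 ?expR_ge0.
- have -> : foldr dstep (fun=> 0) hs u = foldr dstep (fun u : R => 0 * u) hs u.
    by congr (foldr _ _ _ _); apply/funext => q; rewrite mul0r.
  by rewrite foldr_dstepZ mul0r.
- by rewrite foldr_dstepD addr_ge0 ?IH1 ?IH2.
- by rewrite foldr_dstepZ mulr_ge0 ?IH.
- exact: (alternating_pos_lim IH).
Qed.

Lemma alternating_derive f f' : alternating_pos f ->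
  (forall u : R, 0 < u -> is_derive u 1 f (f' u)) -> alternating_pos (fun u => - f' u).
Proof.
move=> af df.
apply: (@alternating_pos_lim (fun n u => n.+1%:R * dstep n.+1%:R^-1 f u)) => [n hs hs0 u u0|u u0].
  rewrite foldr_dstepZ mulr_ge0// -foldr_rcons; apply: af => //.
  by rewrite all_rcons hs0 invr_gt0 ltr0n.
have [dfu <-] := df u u0.
have sc : n.+1%:R^-1 @[n --> \oo] --> (0 : R)^'.
  move=> A /(@cvg_harmonic R) [N _ HN]; exists N => // n /HN; apply.
  by rewrite invr_eq0 pnatr_eq0.
have dfu' : h^-1 *: (f (h *: 1 + u) - f u) @[h --> (0 : R)^'] --> 'D_1 f u by exact: dfu.
have h0 := cvg_comp _ _ sc dfu'.
rewrite (_ : (fun n => _) = fun n => - (n.+1%:R^-1^-1 *: (f (n.+1%:R^-1 *: 1 + u) - f u))).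
  exact: cvgN h0.
apply/funext => n; rewrite invrK /GRing.scale /= mulr1 /dstep [u + _]addrC; ring.
Qed.

(** The exponent j records the signs already spent, one per derivative. *)
Lemma alternating_derive1n n j f : alternating_pos (fun u => (-1) ^+ j * f u) ->
  Cn_pos n f -> forall u, 0 < u -> 0 <= (-1) ^+ (n + j) * (f^`(n))%classic u.
Proof.
elim: n j f => [|n IH] j f af; first by move=> _ u u0; exact: (af [::] isT).
case=> f' df cf' u u0.
rewrite derive1Sn (@derive1n_eq_pos n _ f')//; last first.
  by move=> v v0; rewrite derive1E; have := df v v0 => d1; rewrite derive_val.
rewrite addSnnS; apply: IH => //.
have daf (v : R) : 0 < v -> is_derive v 1 (fun u => (-1) ^+ j * f u) ((-1) ^+ j * f' v).
  move=> v0; have := df v v0 => d1.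
  exact: is_deriveZ.
have := alternating_derive af daf.
rewrite (_ : (fun u => - _) = (fun u => (-1) ^+ j.+1 * f' u))//.
by apply/funext => v; rewrite exprS mulN1r mulNr.
Qed.

End EntireDerivatives.

(** * Gaussian mixtures and negative definite kernels *)

Section GaussianMixtures.
Variable R : realType.
Implicit Types (f g F : R -> R).

(** The quotient of [laplace_decreasing_density], now as a mixture of exponentials on the open
    half-line, so that alternation can be read off; Riemann sums replace the indicator density. *)
Lemma laplace_slope f : laplace_cone f -> cone [set u : R | 0 < u]
  [set f | exists2 r : R, 0 <= r & f = fun q => expR (- (r * q))] (fun u => (f 0 - f u) / u).
Proof.
elim=> {f}[f [r r0 ->]||f g _ IH1 _ IH2|a f a0 _ IH|F f _ IH Ff].
- move: r0; rewrite le_eqVlt => /predU1P[<-|r0].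
    by apply: cone_ext (cone_zero _ _) => u u0; rewrite !mul0r subrr mul0r.
  apply: (cone_lim (F := fun n u => r / n.+1%:R *
      \sum_(j < n.+1) expR (- (u * (j%:R * (r / n.+1%:R)))))); last first.
    move=> u u0; rewrite mulr0 oppr0 expR0 [r * u]mulrC; apply: expR_average_cvg => //.
    by rewrite gt_eqF.
  move=> n; apply: cone_scale; first by rewrite divr_ge0// ltW.
  apply: cone_sum => j _; apply: cone_gen; exists (j%:R * (r / n.+1%:R)).
    by rewrite mulr_ge0// divr_ge0// ltW.
  by apply/funext => u; rewrite mulrC.
- by apply: cone_ext (cone_zero _ _) => u u0; rewrite subrr mul0r.
- apply: cone_ext (cone_add IH1 IH2) => u u0.
  by rewrite -mulrDl; congr (_ / _); ring.
- apply: cone_ext (cone_scale a0 IH) => u u0.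
  by rewrite mulrA mulrBr.
- apply: (cone_lim IH) => u u0.
  apply: cvgM; last exact: cvg_cst.
  by apply: cvgB; apply: Ff => //=; exact: ltW.
Qed.

Lemma rpd_lim (F : nat -> R -> R) f : (forall n, rpd (F n)) ->
  (forall t, F n t @[n --> \oo] --> f t) -> rpd f.
Proof.
move=> pF Ff N t c.
apply: (@limr_ge0 _ (fun i => \sum_(j < N) \sum_(k < N) F i (t j - t k) * c j * c k)).
  apply: cvg_sum_seq => j _; apply: cvg_sum_seq => k _.
  by do 2! (apply: cvgM; last exact: cvg_cst); exact: Ff.
by apply: nearW => i; exact: pF.
Qed.

Lemma rpd_cst1 : rpd (fun=> 1 : R).
Proof.
move=> N t c; rewrite (_ : \sum_(j < N) _ = (\sum_(j < N) c j) ^+ 2); first exact: sqr_ge0.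
rewrite expr2 mulr_suml; apply: eq_bigr => j _; rewrite mulr_sumr.
by apply: eq_bigr => k _; rewrite mul1r.
Qed.

(** Split exp(-r (s - t)^2) as exp(-r s^2) exp(-r t^2) exp(2 r s t). Each power of s t in the
    expansion of the last factor only reweights the coefficients c. *)
Lemma rpd_gauss r F : 0 <= r -> rpd F -> rpd (fun t => F t * expR (- (r * t ^+ 2))).
Proof.
move=> r0 pF N t c.
apply: (@limr_ge0 _ (fun M => \sum_(j < N) \sum_(k < N) F (t j - t k) *
  (expR (- (r * t j ^+ 2)) * expR (- (r * t k ^+ 2)) *
    series (exp_coeff (2 * r * t j * t k)) M) * c j * c k)).
  apply: cvg_sum_seq => j _; apply: cvg_sum_seq => k _.
  do 2! (apply: cvgM; last exact: cvg_cst); apply: cvgM; first exact: cvg_cst.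
  have -> : expR (- (r * (t j - t k) ^+ 2)) =
     expR (- (r * t j ^+ 2)) * expR (- (r * t k ^+ 2)) * expR (2 * r * t j * t k).
    by rewrite -!expRD; congr expR; ring.
  by apply: cvgM; [exact: cvg_cst|exact: is_cvg_series_exp_coeff].
apply: nearW => M.
pose w i j := c j * expR (- (r * t j ^+ 2)) * t j ^+ i.
rewrite (_ : \sum_(j < N) _ = \sum_(i < M) (2 * r) ^+ i / i`!%:R *
    \sum_(j < N) \sum_(k < N) F (t j - t k) * w i j * w i k).
  apply: sumr_ge0 => i _; rewrite mulr_ge0 ?pF//.
  by rewrite divr_ge0// exprn_ge0// mulr_ge0.
under [RHS]eq_bigr do rewrite mulr_sumr; rewrite [RHS]exchange_big; apply: eq_bigr => j _ /=.
under [RHS]eq_bigr do rewrite mulr_sumr; rewrite [RHS]exchange_big; apply: eq_bigr => k _ /=.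
rewrite /series /= big_mkord !mulr_sumr !mulr_suml; apply: eq_bigr => i _.
by rewrite /w /exp_coeff /= -!mulrA !exprMn; ring.
Qed.

Lemma rpd_laplace f F : laplace_cone f -> rpd F -> rpd (fun t => F t * f (t ^+ 2)).
Proof.
move=> cf pF; elim: cf => {f}[f [r r0 ->]||f g _ IH1 _ IH2|a f a0 _ IH|H f _ IH Hf].
- exact: rpd_gauss.
- by move=> N t c; rewrite big1// => j _; rewrite big1// => k _; rewrite mulr0 !mul0r.
- move=> N t c; have := addr_ge0 (IH1 N t c) (IH2 N t c).
  rewrite -big_split (eq_bigr (fun j => \sum_(k < N) F (t j - t k) *
     (f ((t j - t k) ^+ 2) + g ((t j - t k) ^+ 2)) * c j * c k))// => j _.
  by rewrite /= -big_split; apply: eq_bigr => k _ /=; ring.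
- move=> N t c; have := mulr_ge0 a0 (IH N t c).
  rewrite mulr_sumr (eq_bigr (fun j => \sum_(k < N) F (t j - t k) *
     (a * f ((t j - t k) ^+ 2)) * c j * c k))// => j _.
  by rewrite mulr_sumr; apply: eq_bigr => k _ /=; ring.
- apply: (rpd_lim IH) => t; apply: cvgM; first exact: cvg_cst.
  by apply: Hf; exact: sqr_ge0.
Qed.

Definition rnd F := forall (n : nat) (t c : 'I_n -> R),
  0 <= \sum_(j < n) \sum_(k < n) (F (t j) + F (t k) - F (t j - t k)) * c j * c k.

(* Adjoin the point [0] with the weight that makes the weights sum to [0]. *)
Lemma rnd_rpd F : (forall t, F (- t) = F t) -> rpd F -> rnd (fun t => F 0 - F t).
Proof.
move=> ev pF n t c.
pose S := \sum_(j < n) c j.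
pose t' (i : 'I_n.+1) := oapp t 0 (unlift ord0 i).
pose c' (i : 'I_n.+1) := oapp c (- S) (unlift ord0 i).
have := pF _ t' c'.
rewrite big_ord_recl [X in X + _]big_ord_recl /t' /c' !unlift_none /= subrr.
under eq_bigr do rewrite liftK /= sub0r ev.
under [X in _ + X]eq_bigr do rewrite big_ord_recl liftK /= unlift_none /= subr0.
under [X in _ + X]eq_bigr do under eq_bigr do rewrite !liftK /=.
set X := (X in 0 <= X -> _); set Y := (Y in _ -> 0 <= Y).
suff -> : X = Y by [].
rewrite {}/X {}/Y big_split /=.
have -> : F 0 * - S * - S = \sum_(j < n) \sum_(k < n) F 0 * c j * c k.
  transitivity (\sum_(j < n) F 0 * c j * S).
    by rewrite -mulr_suml -mulr_sumr -/S; ring.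
  by apply: eq_bigr => j _; rewrite -mulr_sumr.
have -> : \sum_(i < n) F (t i) * - S * c i = - \sum_(j < n) \sum_(k < n) F (t k) * c j * c k.
  rewrite exchange_big -[RHS]sumrN /=; apply: eq_bigr => k _.
  by rewrite -mulr_suml -mulr_sumr -/S; ring.
have -> : \sum_(i < n) F (t i) * c i * - S = - \sum_(j < n) \sum_(k < n) F (t j) * c j * c k.
  rewrite -[RHS]sumrN; apply: eq_bigr => j _.
  by rewrite -mulr_sumr -/S; ring.
rewrite -!sumrN -!big_split /=; apply: eq_bigr => j _.
rewrite -!sumrN -!big_split /=; apply: eq_bigr => k _; ring.
Qed.

Lemma rnd_lim (F : nat -> R -> R) f : (forall n, rnd (F n)) ->
  (forall t, F n t @[n --> \oo] --> f t) -> rnd f.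
Proof.
move=> pF Ff N t c.
apply: (@limr_ge0 _ (fun i => \sum_(j < N) \sum_(k < N)
    (F i (t j) + F i (t k) - F i (t j - t k)) * c j * c k)).
  apply: cvg_sum_seq => j _; apply: cvg_sum_seq => k _.
  do 2! (apply: cvgM; last exact: cvg_cst).
  by apply: cvgB; [apply: cvgD|]; exact: Ff.
by apply: nearW => i; exact: pF.
Qed.

Lemma rndZ a F : 0 <= a -> rnd F -> rnd (fun t => a * F t).
Proof.
move=> a0 nF N t c; have := mulr_ge0 a0 (nF N t c).
rewrite mulr_sumr (eq_bigr (fun j => \sum_(k < N)
   (a * F (t j) + a * F (t k) - a * F (t j - t k)) * c j * c k))// => j _.
by rewrite mulr_sumr; apply: eq_bigr => k _ /=; ring.
Qed.

End GaussianMixtures.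

Section LogSeries.
Variable R : realType.
Variable Psi : R -> R.
Hypothesis ND : classND Psi.

Let I := Iser Psi.
Let dI (x : R) := limn (pseries (pseries_diffs (Icoef Psi)) x).
Definition logI (u : R) : R := ln (Iser Psi u).
Definition dlogI (u : R) : R :=
  limn (pseries (pseries_diffs (Icoef Psi)) u) / Iser Psi u.

Let ec : entire_coef (Icoef Psi). Proof. by move=> x; exact: Iser_cvg. Qed.

Lemma is_derive_Iser (x : R) : is_derive x 1 I (dI x).
Proof. exact: is_derive_pseries. Qed.

Lemma continuous_Iser : continuous I.
Proof.
move=> x; apply: differentiable_continuous; apply/derivable1_diffP.
by have [] := is_derive_Iser x.
Qed.

Lemma is_derive_logI (x : R) : 0 <= x -> is_derive x 1 logI (dlogI x).
Proof.
move=> x0; have d1 := is_derive_Iser x.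
have d2 := is_derive1_ln (Iser_gt0 ND x0).
have := is_derive1_comp d2 d1; rewrite mulrC; exact.
Qed.

Lemma logI_ge0 u : 0 <= u -> 0 <= logI u.
Proof. by move=> u0; apply: ln_ge0; exact: Iser_ge1. Qed.

Lemma logI0 : logI 0 = 0.
Proof. by rewrite /logI Iser0 ln1. Qed.

Lemma expR_logI u : 0 <= u -> expR (logI u) = I u.
Proof. by move=> u0; rewrite /logI lnK// posrE; exact: Iser_gt0. Qed.

(* [I'/I] as a limit of slopes of the Laplace transforms [I (c u) / I u], c -> 1. *)
Let ratio (m : nat) (q : R) := I (m%:R * (m.+1%:R^-1 * q)) / I q.

Let ratio_laplace m : laplace_cone (ratio m).
Proof. exact: (Iser_ratio_laplace ND (leqnn m)). Qed.

Let ratio0 m : ratio m 0 = 1.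
Proof. by rewrite /ratio !mulr0 divff// gt_eqF// Iser_gt0. Qed.

(** A difference quotient of I at u, with increment -u/(m + 1). *)
Lemma ratio_slope u : 0 < u ->
  m.+1%:R * ((ratio m 0 - ratio m u) / u) @[m --> \oo] --> dlogI u.
Proof.
move=> u0; have Iu : I u != 0 by rewrite gt_eqF// Iser_gt0// ltW.
have [dfu E] := is_derive_Iser u.
have dfu' : h^-1 *: (I (h *: 1 + u) - I u) @[h --> (0 : R)^'] --> 'D_1 I u by exact: dfu.
have sc : - u * n.+1%:R^-1 @[n --> \oo] --> (0 : R)^'.
  have h : - u * n.+1%:R^-1 @[n --> \oo] --> (0 : R).
    by have := cvgM (cvg_cst (- u)) (@cvg_harmonic R); rewrite mulr0; exact.
  move=> A /h [N _ HN]; exists N => // n /HN; apply.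
  by rewrite mulf_neq0 ?oppr_eq0 ?gt_eqF// invr_gt0 ltr0n.
have h0 := cvg_comp _ _ sc dfu'; rewrite E in h0.
rewrite /dlogI -/I -/(dI u).
rewrite (_ : (fun m => _) = fun n => (- u * n.+1%:R^-1)^-1 *: (I ((- u * n.+1%:R^-1) *: 1 + u) - I u) / I u).
  by apply: cvgM h0 (cvg_cst _).
apply/funext => n; rewrite ratio0 /ratio /GRing.scale /= mulr1.
have n0 : n.+1%:R != 0 :> R by rewrite pnatr_eq0.
have -> : - u * n.+1%:R^-1 + u = n%:R * (n.+1%:R^-1 * u).
  by rewrite -natr1 in n0 *; field.
move: (I (n%:R * (n.+1%:R^-1 * u))) => z.
move: (I u) Iu (n.+1%:R) n0 => w w0 y y0.
by field; rewrite w0 y0 gt_eqF.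
Qed.

Lemma dlogI_density : has_decreasing_density dlogI.
Proof.
apply: (decreasing_density_lim (G := fun m u => m.+1%:R * ((ratio m 0 - ratio m u) / u))).
  move=> m; apply: decreasing_densityZ => //.
  exact: laplace_decreasing_density.
exact: ratio_slope.
Qed.

Lemma dlogI_alternating : alternating_pos dlogI.
Proof.
apply: alternating_cone.
apply: (cone_lim (F := fun m u => m.+1%:R * ((ratio m 0 - ratio m u) / u))).
  by move=> m; apply: cone_scale => //; exact: laplace_slope.
by move=> u u0; exact: ratio_slope.
Qed.

(** I'/I is alternating as a limit of mixtures of exponentials, and has all derivatives as a
    quotient of entire series; this settles every sign. *)
Lemma logI_bernstein : bernstein logI.
Proof.
have cI n : Cn_pos n I by exact: Cn_pos_pseries.
have cdI n : Cn_pos n dI by exact: Cn_pos_pseries (entire_coef_diffs ec).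
have cd n : Cn_pos n dlogI.
  apply: Cn_posM => //; apply: Cn_posV => // u u0.
  by rewrite gt_eqF// Iser_gt0// ltW.
have dl (u : R) : 0 < u -> is_derive u 1 logI (dlogI u).
  by move=> u0; apply: is_derive_logI; exact: ltW.
split.
- by move=> u u0; apply: logI_ge0; exact: ltW.
- by move=> n u u0; apply: derivable_derive1n_pos => //; exists dlogI.
- move=> [//|n] u _ u0; rewrite derive1Sn (@derive1n_eq_pos _ n _ dlogI)//; last first.
    by move=> v v0; rewrite derive1E; have := dl v v0 => d1; rewrite derive_val.
  rewrite !exprS mulN1r mulN1r opprK.
  have := @alternating_derive1n _ n 0 dlogI; rewrite addn0; apply => //.
  rewrite (_ : (fun u => _) = dlogI)//; first exact: dlogI_alternating.
  by apply/funext => v; rewrite expr0 mul1r.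
Qed.

(** By [ratio_slope], u I'(u)/I(u) at u = t^2 is a limit of multiples of F 0 - F t with F positive
    definite. *)
Let rnd_ulogI : rnd (fun t => t ^+ 2 * dlogI (t ^+ 2)).
Proof.
apply: (rnd_lim (F := fun m t => m.+1%:R * (ratio m 0 - ratio m (t ^+ 2)))).
  move=> m; apply: rndZ => //.
  have h : rpd (fun t => ratio m (t ^+ 2)).
    have := rpd_laplace (ratio_laplace m) (@rpd_cst1 R).
    by rewrite (_ : (fun t => 1 * _) = fun t => ratio m (t ^+ 2))//; apply/funext => t; rewrite mul1r.
  have ev t : ratio m ((- t) ^+ 2) = ratio m (t ^+ 2) by rewrite sqrrN.
  have := rnd_rpd (F := fun t => ratio m (t ^+ 2)) ev h.
  by rewrite expr0n.
move=> t; have [->|t0] := eqVneq t 0.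
  rewrite expr0n mul0r (_ : (fun m => _) = fun=> 0); first exact: cvg_cst.
  by apply/funext => m; rewrite subrr mulr0.
have t2 : 0 < t ^+ 2 by rewrite exprn_even_gt0.
rewrite (_ : (fun m => m.+1%:R * _) = fun m => t ^+ 2 * (m.+1%:R * ((ratio m 0 - ratio m (t ^+ 2)) / t ^+ 2))).
  exact: cvgM (cvg_cst (t ^+ 2)) (ratio_slope t2).
by apply/funext => m; field; rewrite ?t0.
Qed.

(** Differentiate in s the form built on log I(s t^2): s times the derivative is the form of
    [rnd_ulogI] at the points sqrt(s) t j. The form therefore increases from 0 at s = 0 to the
    required value at s = 1. *)
Lemma rnd_logI : rnd (fun t => logI (t ^+ 2)).
Proof.
move=> n t c.
pose Q (s : R) := \sum_(j < n) \sum_(k < n)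
  (logI (s * t j ^+ 2) + logI (s * t k ^+ 2) - logI (s * (t j - t k) ^+ 2)) * c j * c k.
pose dQ (s : R) := \sum_(j < n) \sum_(k < n)
  (t j ^+ 2 * dlogI (s * t j ^+ 2) + t k ^+ 2 * dlogI (s * t k ^+ 2) -
    (t j - t k) ^+ 2 * dlogI (s * (t j - t k) ^+ 2)) * c j * c k.
have dl (s a : R) : 0 <= s -> 0 <= a ->
    is_derive s 1 (fun s => logI (s * a)) (a * dlogI (s * a)).
  move=> s0 a0; have d1 := is_derive_logI (mulr_ge0 s0 a0).
  have d2 : is_derive s 1 (fun s : R => s * a) a.
    by apply: is_derive_eq; rewrite /GRing.scale /= mulr0 mulr1 add0r.
  by have := @is_derive1_comp _ logI (fun s : R => s * a) s _ _ d1 d2; rewrite mulrC; exact.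
have dsum (J : finType) (f : J -> R -> R) (df : J -> R) (s : R) :
    (forall j, is_derive s 1 (f j) (df j)) ->
    is_derive s 1 (fun s => \sum_j f j s) (\sum_j df j).
  move=> H; elim: (index_enum J) => [|j r IH].
    rewrite big_nil (_ : (fun s => _) = cst 0); first exact: is_derive_cst.
    by apply/funext => x; rewrite big_nil.
  rewrite big_cons (_ : (fun s => _) = fun s => f j s + \sum_(i <- r) f i s).
    by have := H j => d1; exact: is_deriveD.
  by apply/funext => x; rewrite big_cons.
have dQs (s : R) : 0 <= s -> is_derive s 1 Q (dQ s).
  move=> s0; apply: (@dsum) => j; apply: (@dsum) => k.
  have d1 := dl s _ s0 (sqr_ge0 (t j)); have d2 := dl s _ s0 (sqr_ge0 (t k)).
  have d3 := dl s _ s0 (sqr_ge0 (t j - t k)).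
  rewrite (_ : (fun s => _) = fun s => (c j * c k) *: (logI (s * t j ^+ 2) +
     logI (s * t k ^+ 2) - logI (s * (t j - t k) ^+ 2))); last first.
    by apply/funext => x; rewrite /GRing.scale /=; ring.
  rewrite (_ : _ * c j * c k = (c j * c k) *: (t j ^+ 2 * dlogI (s * t j ^+ 2) +
    t k ^+ 2 * dlogI (s * t k ^+ 2) - (t j - t k) ^+ 2 * dlogI (s * (t j - t k) ^+ 2))); last first.
    by rewrite /GRing.scale /=; ring.
  by apply: is_deriveZ; apply: is_deriveB.
have dQ0 (s : R) : 0 < s -> 0 <= dQ s.
  move=> s0; have := rnd_ulogI (fun j => Num.sqrt s * t j) c.
  have -> : \sum_(j < n) \sum_(k < n)
     ((Num.sqrt s * t j) ^+ 2 * dlogI ((Num.sqrt s * t j) ^+ 2) +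
      (Num.sqrt s * t k) ^+ 2 * dlogI ((Num.sqrt s * t k) ^+ 2) -
      (Num.sqrt s * t j - Num.sqrt s * t k) ^+ 2 *
        dlogI ((Num.sqrt s * t j - Num.sqrt s * t k) ^+ 2)) * c j * c k = s * dQ s.
    rewrite mulr_sumr; apply: eq_bigr => j _; rewrite mulr_sumr; apply: eq_bigr => k _.
    rewrite -!mulrBr !exprMn !sqr_sqrtr ?(ltW s0)//; ring.
  by rewrite pmulr_rge0.
have Q0 : Q 0 = 0.
  by rewrite /Q big1// => j _; rewrite big1// => k _; rewrite !mul0r logI0 addr0 subr0 !mul0r.
have <- : Q 1 = \sum_(j < n) \sum_(k < n)
    (logI (t j ^+ 2) + logI (t k ^+ 2) - logI ((t j - t k) ^+ 2)) * c j * c k.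
  by apply: eq_bigr => j _; apply: eq_bigr => k _; rewrite !mul1r.
suff : Q 0 <= Q 1 by rewrite Q0.
have in0 : (0 : R) \in `[0, 1] by rewrite in_itv /= lexx ler01.
have in1 : (1 : R) \in `[0, 1] by rewrite in_itv /= lexx ler01.
apply: (@ger0_derive1_le_cc _ Q 0 1 _ _ _ 0 1 in0 in1 ler01).
- move=> x; rewrite in_itv /= => /andP[x0 _].
  by have [] := dQs x (ltW x0).
- move=> x; rewrite in_itv /= => /andP[x0 _].
  by rewrite derive1E; have := dQs x (ltW x0) => d1; rewrite derive_val dQ0.
- apply: derivable_within_continuous => x; rewrite in_itv /= => /andP[x0 _].
  by have [] := dQs x x0.
Qed.

End LogSeries.

Section LogSeriesRepresentation.
Variable R : realType.
Variable Psi : R -> R.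
Hypothesis ND : classND Psi.
Let mu : {sigma_finite_measure set (measurableTypeR R) -> \bar R} := @lebesgue_measure R.
Let D : set (measurableTypeR R) := `]0%R, +oo[%classic.
Let A (q : R) : set (measurableTypeR R) := `]0%R, q[%classic.
Let mD : measurable D. Proof. exact: measurable_itv. Qed.
Let mA q : measurable (A q). Proof. exact: measurable_itv. Qed.

Lemma continuous_dlogI (x : R) : 0 <= x -> {for x, continuous (dlogI Psi)}.
Proof.
move=> x0.
have ec : entire_coef (Icoef Psi) by move=> y; exact: Iser_cvg.
have d1 := is_derive_pseries x (entire_coef_diffs ec).
have d2 := is_derive_pseries x ec.
apply: cvgM.
  by apply: differentiable_continuous; apply/derivable1_diffP; case: d1.
apply: cvgV; first by rewrite gt_eqF// Iser_gt0.
by apply: differentiable_continuous; apply/derivable1_diffP; case: d2.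
Qed.

Lemma measurable_dlogI (B : set (measurableTypeR R)) : measurable B ->
  B `<=` `[0%R, +oo[ -> measurable_fun B (dlogI Psi : measurableTypeR R -> R).
Proof.
move=> mB sB; apply: (measurable_funS _ sB); first exact: measurable_itv.
apply: subspace_continuous_measurable_fun; first exact: measurable_itv.
apply: continuous_in_subspaceT => x; rewrite inE /= in_itv /= andbT.
exact: continuous_dlogI.
Qed.

Lemma integral_dlogI q : 0 < q ->
  (\int[mu]_(u in A q) (dlogI Psi u)%:E)%E = (logI Psi q)%:E.
Proof.
move=> q0.
have mf : measurable_fun (`[0%R, +oo[%classic : set (measurableTypeR R))
    (fun u : measurableTypeR R => (dlogI Psi u)%:E).
  by apply/measurable_EFinP; apply: measurable_dlogI => //; exact: measurable_itv.
rewrite /A integral_itv_bndo_bndc//; last first.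
  apply: measurable_funS mf; first exact: measurable_itv.
  by move=> x; rewrite /= !in_itv /= andbT => /andP[/ltW].
rewrite integral_itv_obnd_cbnd//; last first.
  apply: measurable_funS mf; first exact: measurable_itv.
  by move=> x; rewrite /= !in_itv /= andbT => /andP[/ltW].
rewrite (@continuous_FTC2 _ _ (logI Psi))//.
- by rewrite logI0// oppe0 adde0.
- apply: continuous_in_subspaceT => x; rewrite inE /= in_itv /= => /andP[x0 _]; exact: continuous_dlogI.
- have cl (x : R) : 0 <= x -> {for x, continuous (logI Psi)}.
    move=> x0; apply: differentiable_continuous; apply/derivable1_diffP.
    by have [] := is_derive_logI ND x0.
  split.
  + by move=> x; rewrite in_itv /= => /andP[x0 _]; have [] := is_derive_logI ND (ltW x0).
  + by apply: cvg_at_right_filter; apply: cl.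
  + by apply: cvg_at_left_filter; apply: cl; exact: ltW.
- move=> x; rewrite in_itv /= => /andP[x0 _].
  by rewrite derive1E; have := is_derive_logI ND (ltW x0) => d1; rewrite derive_val.
Qed.

Lemma tonelli_expRN q (k : R -> R) : 0 < q -> (forall r, 0 < r -> 0 <= k r) ->
  nonincreasing_pos k ->
  (\int[mu]_(u in A q) \int[mu]_(r in D) (expR (- (u * r)) * k r)%:E)%E =
  (\int[mu]_(r in D) ((1 - expR (- (q * r))) * (k r / r))%:E)%E.
Proof.
move=> q0 k0 km.
pose kD : measurableTypeR R -> R := (k : measurableTypeR R -> R) \_ D.
pose f (p : measurableTypeR R * measurableTypeR R) : \bar R :=
  (\1_(A q) p.1 * expR (- (p.1 * p.2)) * kD p.2)%:E.
have mkD : measurable_fun setT kD.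
  exact: ((measurable_restrictT (k : measurableTypeR R -> R) mD).1 (@nonincreasing_pos_measurable R k km)).
have mf : measurable_fun setT f.
  apply/measurable_EFinP; apply: measurable_funM; first apply: measurable_funM.
  - apply: (@measurableT_comp _ _ _ _ _ _ (\1_(A q) : measurableTypeR R -> R) _ fst).
      exact: measurable_indic.
    exact: measurable_fst.
  - apply: measurableT_comp => //; apply: measurableT_comp => //.
    by apply: measurable_funM; [exact: measurable_fst|exact: measurable_snd].
  - by apply: measurableT_comp => //; exact: measurable_snd.
have kD0 r : 0 <= kD r.
  by rewrite /kD patchE; case: ifPn => //; rewrite inE /D /= in_itv /= andbT; exact: k0.
have f0 p : (0 <= f p)%E.
  by rewrite lee_fin !mulr_ge0 ?expR_ge0// indicE.
have := @fubini_tonelli _ _ _ _ _ mu mu f mf f0.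
rewrite /fubini_F /fubini_G /f /= => E.
rewrite [LHS]integral_mkcond [RHS]integral_mkcond.
transitivity (\int[mu]_u (\int[mu]_r (\1_(A q) u * expR (- (u * r)) * kD r)%:E))%E.
  apply: eq_integral => u _; rewrite patchE; case: ifPn => uA.
    rewrite integral_mkcond; apply: eq_integral => r _.
    rewrite indicE uA mul1r /kD !patchE; case: ifP => //.
    by rewrite mulr0.
  rewrite integral0_eq// => r _.
  by rewrite indicE (negbTE uA) !mul0r.
rewrite E; apply: eq_integral => r _; rewrite patchE; case: ifPn => rD; last first.
  rewrite integral0_eq// => u _.
  by rewrite /kD patchE (negbTE rD) mulr0.
have r0 : 0 < r by move: rD; rewrite inE /D /= in_itv /= andbT.
have -> : ((1 - expR (- (q * r))) * (k r / r))%:E =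
   ((k r)%:E * \int[mu]_(u in A q) (expR (- (r * u)))%:E)%E.
  by rewrite /mu /A integral_expRN// -EFinM [r * q]mulrC; congr EFin; ring.
rewrite -ge0_integralZl//.
- rewrite [RHS]integral_mkcond; apply: eq_integral => u _.
  rewrite patchE indicE /kD patchE rD; case: ifPn => _.
    by congr EFin; rewrite [u * r]mulrC mulr1n mul1r; exact: mulrC.
  by rewrite mulr0n !mul0r.
- apply/measurable_EFinP; apply: measurable_funTS; apply: measurableT_comp => //.
  by apply: measurableT_comp => //; exact: measurable_funM.
- by rewrite lee_fin k0.
Qed.

(** Integrate I'/I = d + int exp(-u r) k(r) dr over (0, q). By Tonelli mubar(r) = k(r)/r, and r
    mubar(r) = k(r) is nonincreasing. *)
Lemma logI_representation : exists (sigma : R) (mubar : R -> R),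
  BJ_representation (logI Psi) 0 sigma mubar /\
  forall r s : R, 0 < r -> r <= s -> s * mubar s <= r * mubar r.
Proof.
have [d [k [d0 k0 km dk]]] := dlogI_density ND.
have rep u : 0 < u -> (logI Psi u)%:E = ((d * u)%:E +
    \int[mu]_(r in D) ((1 - expR (- (u * r))) * (k r / r))%:E)%E.
  move=> u0; rewrite -integral_dlogI// -tonelli_expRN//.
  have hE v : A u v -> (dlogI Psi v)%:E =
      (d%:E + \int[mu]_(r in D) (expR (- (v * r)) * k r)%:E)%E.
    by rewrite /A /= in_itv /= => /andP[v0 _]; exact: dk.
  rewrite (eq_integral (fun v : measurableTypeR R => d%:E + \int[mu]_(r in D) (expR (- (v * r)) * k r)%:E)%E); last first.
    by move=> v; rewrite inE; exact: hE.
  have mh : measurable_fun (A u) (fun v : measurableTypeR R =>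
      \int[mu]_(r in D) (expR (- (v * r)) * k r)%:E)%E.
    apply: (eq_measurable_fun (fun v : measurableTypeR R => (dlogI Psi v - d)%:E)).
      move=> v; rewrite inE => Av; rewrite EFinB hE// addeAC subee// add0e//.
    apply/measurable_EFinP; apply: measurable_funB => //; apply: (measurable_dlogI (mA u)).
    by move=> x; rewrite /A /= !in_itv /= andbT => /andP[/ltW].
  rewrite ge0_integralD//.
  - rewrite integral_cst//; congr (_ + _)%E.
    by rewrite [X in (_ * X)%E](_ : _ = u%:E)// /mu /A /= lebesgue_measure_itv /= lte_fin u0 sube0.
  - move=> v _; apply: integral_ge0 => r; rewrite /D /= in_itv /= andbT => r0.
    by rewrite lee_fin mulr_ge0 ?expR_ge0 ?k0.
(* The choice sigma = sqrt(2 d) turns the drift d into sigma^2/2. *)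
have sd : Num.sqrt (2 * d) ^+ 2 / 2 = d.
  by rewrite sqr_sqrtr ?mulr_ge0//; field.
exists (Num.sqrt (2 * d)), (fun r => k r / r); split; last first.
  move=> r s r0 rs; have s0 := lt_le_trans r0 rs.
  rewrite mulrC divfK ?gt_eqF// mulrC divfK ?gt_eqF//; exact: km.
split.
- by split=> //; exact: sqrtr_ge0.
- by move=> r r0; rewrite divr_ge0 ?k0// ltW.
- move=> r s r0 rs; have s0 := lt_le_trans r0 rs.
  by apply: ler_pM; rewrite ?k0 ?invr_ge0 ?(ltW s0)//; [exact: km|rewrite lef_pV2].
(* Uses min(1, r) <= 2 (1 - exp(-r)); the integral on the right is bounded by log I(1). *)
- apply: (@le_lt_trans _ _ (2%:E * \int[mu]_(r in D) ((1 - expR (- (1 * r))) * (k r / r))%:E)%E).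
    have mk : measurable_fun D (fun r : measurableTypeR R => k r / r).
      apply: nonincreasing_pos_measurable => r s r0 rs; have s0 := lt_le_trans r0 rs.
      by apply: ler_pM; rewrite ?k0 ?invr_ge0 ?(ltW s0)//; [exact: km|rewrite lef_pV2].
    have mr : measurable_fun D (fun r : measurableTypeR R => ((1 - expR (- (1 * r))) * (k r / r))%:E).
      apply/measurable_EFinP; apply: measurable_funM => //; apply: measurable_funB => //.
      apply: measurable_funTS; apply: measurableT_comp => //.
      by apply: measurableT_comp => //; exact: measurable_funM.
    have e1 r : 0 < r -> 0 <= 1 - expR (- (1 * r)).
      by move=> r0; rewrite subr_ge0 expR_le1 oppr_le0 mul1r ltW.
    rewrite -ge0_integralZl//.
    + apply: ge0_le_integral => //.
      * move=> r; rewrite /D /= in_itv /= andbT => r0.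
        by rewrite lee_fin mulr_ge0 ?divr_ge0 ?k0 ?(ltW r0)// le_min ler01 ltW.
      * by apply/measurable_EFinP; apply: measurable_funM => //; apply: measurable_funTS; exact: measurable_minr.
      * by apply: emeasurable_funM => //; exact: measurable_cst.
      * move=> r; rewrite /D /= in_itv /= andbT => r0.
        rewrite -EFinM lee_fin [leRHS]mulrA; apply: ler_wpM2r; first by rewrite divr_ge0 ?k0// ltW.
        rewrite mul1r.
        have : expR (- r) <= (1 + r)^-1.
          by rewrite expRN lef_pV2 ?posrE ?expR_gt0 ?addr_gt0// expR_ge1Dx.
        have p1 : 0 < 1 + r by rewrite addr_gt0.
        have : Num.min 1 r <= 2 * (1 - (1 + r)^-1).
          have -> : 1 - (1 + r)^-1 = r / (1 + r) by field; rewrite gt_eqF.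
          rewrite mulrA ler_pdivlMr//; have [r1|r1] := leP 1 r; [lra|nra].
        lra.
    + move=> r; rewrite /D /= in_itv /= andbT => r0.
      by rewrite lee_fin mulr_ge0 ?e1// divr_ge0 ?k0// ltW.
  have h := rep 1 ltr01.
  have fin : (\int[mu]_(r in D) ((1 - expR (- (1 * r))) * (k r / r))%:E < +oo)%E.
    apply: (@le_lt_trans _ _ (logI Psi 1)%:E); last exact: ltry.
    by rewrite h leeDr// lee_fin mulr1.
  by rewrite lte_mul_pinfty.
- move=> u; rewrite le_eqVlt => /predU1P[<-|u0].
    rewrite logI0// mulr0 addr0 (eq_integral (cst 0%E)); last first.
      by move=> r _; rewrite mul0r oppr0 expR0 subrr mul0r.
    by rewrite integral0 adde0.
  by rewrite rep// add0r sd.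
Qed.

End LogSeriesRepresentation.

Local Open Scope complex_scope.
Import ComplexField.Normc.

(** * Complex power series *)

Section ComplexLimits.
Variable R : realType.
Implicit Types (z w : C R) (b : nat -> C R).

Lemma norm_normc z : `|z| = (normc z)%:C.
Proof. by []. Qed.

Lemma normc_ge0 z : 0 <= normc z.
Proof. by rewrite -ler0c -norm_normc. Qed.

Lemma normcD_le z w : normc (z + w) <= normc z + normc w.
Proof. exact: le_normcD. Qed.

Lemma normcB z w : normc (z - w) = normc (w - z).
Proof. by rewrite -[LHS]normcN opprB. Qed.

Lemma normcX z n : normc (z ^+ n) = normc z ^+ n.
Proof. by elim: n => [|n IH]; rewrite ?normc1// !exprS normcM IH. Qed.

Lemma normcR (x : R) : normc x%:C = `|x|.
Proof. by rewrite /normc /= expr0n addr0 sqrtr_sqr. Qed.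

Lemma le_normc_ReIm (x y : R) : normc (x +i* y) <= `|x| + `|y|.
Proof.
have -> : x +i* y = x%:C + y%:C * (0 +i* 1) by simpc.
by rewrite (le_trans (normcD_le _ _))// normcM !normcR /normc expr0n expr1n add0r sqrtr1 mulr1.
Qed.

Lemma normc_Re (z : R[i]) : `|complex.Re z| <= normc z.
Proof. by have := normc_ge_Re z; rewrite norm_normc lecR. Qed.

Lemma normc_Im (z : R[i]) : `|complex.Im z| <= normc z.
Proof.
case: z => x y; rewrite /normc /= -sqrtr_sqr ler_wsqrtr//.
by rewrite lerDr sqr_ge0.
Qed.

(** A positive radius in [C R] is a real number, so real tolerances suffice. *)
Lemma cvgCP (T : Type) (F : set_system T) (FF : Filter F) (f : T -> C R) (l : C R) :
  f @ F --> l <-> forall e : R, 0 < e -> \forall x \near F, normc (l - f x) <= e.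
Proof.
split=> [/cvgrPdist_le h e e0|h].
  have e0' : 0 < e%:C by rewrite ltcR.
  by apply: filterS (h _ e0') => x; rewrite norm_normc lecR.
apply/cvgrPdist_le => e e0.
have [d dE] : exists d : R, e = d%:C.
  by move: e0; rewrite ltcE /= => /andP[/eqP e1 _]; exists (complex.Re e); case: e e1 => u v /= ->.
move: e0; rewrite dE ltcR => e0.
by apply: filterS (h _ e0) => x; rewrite norm_normc lecR.
Qed.

Lemma cvg_ReIm (T : Type) (F : set_system T) (FF : Filter F) (f g : T -> R) (x y : R) :
  f @ F --> x -> g @ F --> y -> ((f t +i* g t) : C R) @[t --> F] --> (x +i* y : C R).
Proof.
move=> /cvgrPdist_le fx /cvgrPdist_le gy; apply/cvgCP => e e0.
have e2 : 0 < e / 2 by rewrite divr_gt0.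
apply: filterS2 (fx _ e2) (gy _ e2) => t h1 h2.
have -> : (x +i* y) - (f t +i* g t) = (x - f t) +i* (y - g t) by simpc.
by rewrite (le_trans (le_normc_ReIm _ _))// (splitr e) lerD.
Qed.

Lemma cvg_real_complex (T : Type) (F : set_system T) (FF : Filter F) (f : T -> R) (x : R) :
  f @ F --> x -> ((f t)%:C : C R) @[t --> F] --> (x%:C : C R).
Proof. by move=> fx; apply: cvg_ReIm => //; exact: cvg_cst. Qed.

Lemma normc_lim_le (f : nat -> C R) (l : C R) (B : R) :
  f @ \oo --> l -> (forall n, normc (f n) <= B) -> normc l <= B.
Proof.
move=> /cvgCP fl fB; apply/ler_addgt0Pr => e e0.
have [N _ /(_ N (leqnn N)) h] := fl _ e0.
rewrite addrC -(subrK (f N) l) (le_trans (normcD_le _ _))//.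
by apply: lerD => //; exact: h.
Qed.

Lemma continuousCP (f : C R -> C R) z : {for z, continuous f} <->
  forall e : R, 0 < e -> \forall w \near z, normc (f z - f w) <= e.
Proof. exact: (@cvgCP _ (nbhs z)). Qed.

Lemma near_normc z (e : R) : 0 < e -> \forall w \near z, normc (z - w) <= e.
Proof. by move=> e0; apply: ((@cvgCP _ (nbhs z) _ id z).1 _ e e0); exact: cvg_id. Qed.

End ComplexLimits.

Section ComplexPowerSeries.
Variable R : realType.
Implicit Types (z w : C R) (b : nat -> C R).

(** Bounds at every radius, rather than convergence, since slopes inherit them with explicit
    constants. *)
Definition entire b := forall rho : R, 0 < rho ->
  exists B : R, forall n, normc (b n) * rho ^+ n <= B.

Definition cseries b z : nat -> C R := fun N => \sum_(0 <= n < N) b n * z ^+ n.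
Definition csum b z : C R := limn (cseries b z).

Lemma cseries_le b z (rho B : R) : 2 * normc z <= rho -> 0 < rho ->
  (forall n, normc (b n) * rho ^+ n <= B) -> forall n, normc (b n * z ^+ n) <= B * 2^-1 ^+ n.
Proof.
move=> zr r0 bB n; rewrite normcM normcX.
apply: (@le_trans _ _ (normc (b n) * (rho / 2) ^+ n)).
  apply: ler_wpM2l; first exact: normc_ge0.
  apply: lerXn2r; rewrite ?nnegrE ?normc_ge0 ?divr_ge0 ?(ltW r0)//.
  by rewrite ler_pdivlMr// mulrC.
by rewrite exprMn mulrA ler_wpM2r ?exprn_ge0.
Qed.

Lemma cseries_cvg b z : entire b -> cseries b z @ \oo --> csum b z.
Proof.
move=> eb.
have r0 : 0 < 2 * normc z + 1 by have := normc_ge0 z; lra.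
have [B bB] := eb _ r0.
have h := @cseries_le b z _ B _ r0 bB.
have {}h n : normc (b n * z ^+ n) <= B * 2^-1 ^+ n by apply: h; rewrite lerDl.
have cR (f : C R -> R) : (forall w, `|f w| <= normc w) ->
    cvgn (series (fun n => f (b n * z ^+ n))).
  move=> fn; apply: normed_cvg.
  apply: (@series_le_cvg _ _ (fun n => B * 2^-1 ^+ n)) => [n|n|n|].
  - exact: normr_ge0.
  - exact: le_trans (normc_ge0 _) (h n).
  - exact: le_trans (fn _) (h n).
  - by apply: is_cvg_geometric_series; rewrite ger0_norm; lra.
have c1 := cR _ (@normc_Re R); have c2 := cR _ (@normc_Im R).
have E : cseries b z = fun N => (series (fun n => complex.Re (b n * z ^+ n)) N) +i*
                              (series (fun n => complex.Im (b n * z ^+ n)) N).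
  apply/funext; elim=> [|N IH]; first by rewrite /cseries /series /= !big_geq.
  rewrite /cseries big_nat_recr//= -/(cseries b z N) IH /series /= !big_nat_recr//=.
  by case: (b N * z ^+ N).
apply: cvgP; rewrite E; exact: cvg_ReIm c1 c2.
Qed.

Lemma csumP b z l : cseries b z @ \oo --> l -> csum b z = l.
Proof. exact: cvg_lim. Qed.

Lemma csum_le b z (rho B : R) : entire b -> 2 * normc z <= rho -> 0 < rho ->
  (forall n, normc (b n) * rho ^+ n <= B) -> normc (csum b z) <= 2 * B.
Proof.
move=> eb zr r0 bB; apply: (normc_lim_le (cseries_cvg (z := z) eb)) => N.
have B0 : 0 <= B by have := bB 0; rewrite expr0 mulr1; apply: le_trans; exact: normc_ge0.
suff : normc (cseries b z N) <= B * (2 - 2 * 2^-1 ^+ N).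
  move=> h; apply: (le_trans h); rewrite mulrC ler_wpM2r//.
  by rewrite gerBl mulr_ge0 ?exprn_ge0.
elim: N => [|N IH]; first by rewrite /cseries big_geq// normc0 expr0 mulr1 subrr mulr0.
rewrite /cseries big_nat_recr//= (le_trans (normcD_le _ _))//.
apply: (le_trans (lerD IH (cseries_le zr r0 bB N))).
by rewrite exprS -subr_ge0 (_ : _ - _ = 0)//; field.
Qed.

Lemma csum0 b : entire b -> csum b 0 = b 0.
Proof.
move=> eb; apply: csumP; apply: cvg_near_cst; exists 1 => // -[//|N] _.
apply/eqP; rewrite /cseries big_nat_recl//= expr0 mulr1 big1_seq ?addr0// => i _.
by rewrite exprS mul0r mulr0.
Qed.

Definition cshift b : nat -> C R := fun n => b n.+1.

Lemma csumS b z : entire b -> entire (cshift b) /\ csum b z = b 0 + z * csum (cshift b) z.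
Proof.
move=> eb.
have es : entire (cshift b).
  move=> rho r0; have [B bB] := eb _ r0; exists (B / rho) => n.
  rewrite ler_pdivlMr// -mulrA -exprSr; exact: bB.
split => //; apply: csumP.
rewrite -(@cvg_shiftS (C R)) /=.
rewrite (_ : (fun n => _) = fun N => b 0 + z * cseries (cshift b) z N).
  by apply: cvgD; [exact: cvg_cst|apply: cvgM; [exact: cvg_cst|exact: cseries_cvg]].
apply/funext => N; rewrite /cseries big_nat_recl//= expr0 mulr1 mulr_sumr; congr (_ + _).
by apply: eq_bigr => i _; rewrite exprS mulrCA.
Qed.

(* Coefficients of [(f z - f z0) / (z - z0)]. *)
Definition cslope b z0 : nat -> C R := fun m => csum (fun n => b (m.+1 + n)%N) z0.

Lemma cslope_le b z0 (rho B : R) : entire b -> 2 * normc z0 <= rho -> 0 < rho ->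
  (forall n, normc (b n) * rho ^+ n <= B) ->
  forall n, normc (cslope b z0 n) * rho ^+ n <= 2 * B / rho.
Proof.
move=> eb zr r0 bB m.
have p0 k : 0 < rho ^+ k by rewrite exprn_gt0.
have h : forall n, normc (b (m.+1 + n)%N) * rho ^+ n <= B / rho ^+ m.+1.
  by move=> n; rewrite ler_pdivlMr// -mulrA -exprD addnC.
have es : entire (fun n => b (m.+1 + n)%N).
  move=> r r1; have [B' bB'] := eb _ r1; exists (B' / r ^+ m.+1) => n.
  by rewrite ler_pdivlMr ?exprn_gt0// -mulrA -exprD addnC.
have := csum_le es zr r0 h; rewrite -/(cslope b z0 m) => k.
rewrite -ler_pdivlMr//; apply: (le_trans k); rewrite exprSr.
by rewrite le_eqVlt (_ : _ == _)//; apply/eqP; field; rewrite !gt_eqF.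
Qed.

Lemma cslope_entire b z0 : entire b -> entire (cslope b z0).
Proof.
move=> eb rho r0.
pose r := Num.max rho (2 * normc z0).
have r1 : 0 < r by rewrite lt_max r0.
have [B bB] := eb _ r1.
have rz : 2 * normc z0 <= r by rewrite le_max lexx orbT.
have h := cslope_le eb rz r1 bB.
exists (2 * B / r) => n; apply: le_trans (h n).
apply: ler_wpM2l; first exact: normc_ge0.
by apply: lerXn2r; rewrite ?nnegrE ?(ltW r0) ?(ltW r1)// le_max lexx.
Qed.

(** The tails e m = sum_n b (m + n) z0^n satisfy e m = b m + z0 e m.+1, so the product with z - z0
    telescopes. *)
Lemma csum_cslope b z0 z : entire b ->
  csum b z - csum b z0 = (z - z0) * csum (cslope b z0) z.
Proof.
move=> eb; have es := cslope_entire z0 eb.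
pose e m := csum (fun n => b (m + n)%N) z0.
have eE m : e m = b m + z0 * e m.+1.
  have ebm : entire (fun n => b (m + n)%N).
    elim: m => [//|m IH]; have [h _] := csumS 0 IH.
    rewrite (_ : (fun n => _) = cshift (fun n => b (m + n)%N))//.
    by apply/funext => n; rewrite /cshift addnS.
  have [_] := csumS z0 ebm; rewrite addn0 /e => ->; congr (_ + _ * csum _ _).
  by apply/funext => n; rewrite /cshift addnS.
have tele N : (z - z0) * cseries (cslope b z0) z N = cseries b z N - e 0 + e N * z ^+ N.
  elim: N => [|N IH]; first by rewrite /cseries !big_geq// mulr0 add0r expr0 mulr1 addNr.
  rewrite /cseries !big_nat_recr//= -/(cseries b z N) -/(cseries (cslope b z0) z N).
  rewrite mulrDr IH -[cslope b z0 N]/(e N.+1) (eE N) exprS; ring.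
(* e N.+1 z^N is a term of the convergent series of [cslope], hence tends to 0. *)
have t0 : e N * z ^+ N @[N --> \oo] --> (0 : C R).
  rewrite -(@cvg_shiftS (C R)) /=.
  have c1 := cseries_cvg (z := z) es.
  have c2 := c1; rewrite -(@cvg_shiftS (C R)) /= in c2.
  have c3 := cvgM (cvg_cst z) (cvgB c2 c1); rewrite subrr mulr0 in c3.
  rewrite (_ : (fun n => _) = fun n => z * (cseries (cslope b z0) z n.+1 - cseries (cslope b z0) z n)).
    exact: c3.
  apply/funext => n; rewrite /cseries big_nat_recr//= addrAC subrr add0r exprS.
  by rewrite -[cslope b z0 n]/(e n.+1) mulrCA.
have l1 : (z - z0) * cseries (cslope b z0) z N @[N --> \oo] --> (z - z0) * csum (cslope b z0) z.
  by apply: cvgM; [exact: cvg_cst|exact: cseries_cvg].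
have l2 : (z - z0) * cseries (cslope b z0) z N @[N --> \oo] --> csum b z - csum b z0.
  rewrite (_ : (fun n => _) = fun N => cseries b z N - e 0 + e N * z ^+ N); last exact/funext.
  have h := cvgD (cvgB (cseries_cvg (z := z) eb) (cvg_cst (e 0))) t0.
  by rewrite addr0 in h; exact: h.
exact: (cvg_unique _ l2 l1).
Qed.

Lemma continuous_csum b : entire b -> continuous (csum b).
Proof.
move=> eb z0; apply/continuousCP => e e0.
have es := cslope_entire z0 eb.
have r0 : 0 < 2 * (normc z0 + 1) by have := normc_ge0 z0; lra.
have [B bB] := es _ r0.
have B0 : 0 <= B by have := bB 0; rewrite expr0 mulr1; apply: le_trans; exact: normc_ge0.
have d0 : 0 < Num.min 1 (e / (2 * B + 1)).
  by rewrite lt_min ltr01 divr_gt0// ltr_wpDl// mulr_ge0.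
apply: filterS (near_normc z0 d0) => z.
rewrite normcB le_min => /andP[h1 h2].
rewrite normcB csum_cslope// normcM.
have zb : normc z <= normc z0 + 1.
  have := normcD_le (z - z0) z0; rewrite subrK => /le_trans; apply.
  by rewrite addrC lerD2l.
have h := csum_le es (z := z) _ r0 bB.
apply: (@le_trans _ _ (e / (2 * B + 1) * (2 * B))).
  by apply: ler_pM => //; rewrite ?normc_ge0//; apply: h; rewrite ler_pM2l.
rewrite -mulrA ger_pMr// mulrC ler_pdivrMr ?mul1r ?lerDl//.
by rewrite ltr_wpDl// mulr_ge0.
Qed.

Lemma continuous_neq0 (f : C R -> C R) z0 : {for z0, continuous f} -> f z0 != 0 ->
  \forall z \near z0, f z != 0.
Proof.
move=> /continuousCP fc f0.
have n0 : 0 < normc (f z0).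
  by rewrite lt_neqAle normc_ge0 andbT eq_sym; apply: contra f0 => /eqP/eq0_normc ->.
have n2 : 0 < normc (f z0) / 2 by rewrite divr_gt0.
apply: filterS (fc _ n2) => z; apply: contraTN => /eqP ->.
by rewrite subr0 -ltNge gtr_pMr// invf_lt1// ltr1n.
Qed.

Lemma cvg_slope (f g : C R -> C R) z0 :
  (forall z, f z - f z0 = (z - z0) * g z) -> {for z0, continuous g} -> derivable f z0 1.
Proof.
move=> fg gc; apply/cvg_ex; exists (g z0).
apply: (@cvgCP R _ (0 : C R)^' _ _ _).2 => e e0.
have /nbhs_ballP[d d0 h] := (continuousCP g z0).1 gc e e0.
apply/nbhs_ballP; exists d => // x xd x0.
rewrite fg /GRing.scale /= mulr1 addrK mulKf//; apply: h.
by move: xd; rewrite /ball /= sub0r normrN opprD addrA addrAC subrr add0r normrN.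
Qed.

Lemma derivable_csum b z0 : entire b -> derivable (csum b) z0 1.
Proof.
move=> eb; apply: cvg_slope (fun z => csum_cslope z0 z eb) _.
exact: continuous_csum (cslope_entire z0 eb) _.
Qed.

(* If the slopes of all orders vanished at [z0], then [normc (f 0)] would be at most
   [B / 2^k] for all [k]. *)
Lemma csum_isolated b z0 : entire b -> b 0 = 1 ->
  \forall z \near z0^', csum b z != 0.
Proof.
move=> eb b0.
have f01 : csum b 0 = 1 by rewrite csum0.
have [z00|z00] := eqVneq z0 0.
  apply: nbhs_dnbhs; apply: continuous_neq0; first exact: continuous_csum.
  by rewrite z00 f01 oner_neq0.
(* At radius 4 |z0| each slope divides the coefficient bound by 2 |z0|, while the factor (0 - z0)^k
   brings back only |z0|^k; this leaves 2^-k. *)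
have r0 : 0 < 4 * normc z0.
  rewrite mulr_gt0// lt_neqAle normc_ge0 andbT eq_sym.
  by apply: contra z00 => /eqP/eq0_normc ->.
have [B bB] := eb _ r0.
apply: contrapT => nis.
have H k : exists b', [/\ entire b', (forall z, csum b z = (z - z0) ^+ k * csum b' z) &
     forall n, normc (b' n) * (4 * normc z0) ^+ n <= B / (2 * normc z0) ^+ k].
  elim: k => [|k [b' [eb' fb' bB']]].
    by exists b; split => // [z|n]; rewrite expr0 ?mul1r ?invr1 ?mulr1.
  have [fz0|fz0] := eqVneq (csum b' z0) 0; last first.
    exfalso; apply: nis; have := continuous_neq0 (@continuous_csum _ eb' z0) fz0.
    move=> h; apply: (@filterS _ (nbhs z0) _ _ _ _ h) => z hz zz0.
    by rewrite fb' mulf_neq0 ?expf_neq0 ?subr_eq0.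
  exists (cslope b' z0); split; first exact: cslope_entire.
    move=> z; rewrite fb' exprSr -mulrA; congr (_ * _).
    by rewrite -csum_cslope// fz0 subr0.
  move=> n; have := cslope_le eb' _ r0 bB' n; move/(_ z0) => h; apply: (le_trans (h _)).
    by rewrite ler_wpM2r ?normc_ge0// ler_nat.
  have n0 : normc z0 != 0 by move: r0; rewrite pmulr_rgt0// => /gt_eqF ->.
  rewrite exprS; have : (2 * normc z0) ^+ k != 0 by rewrite expf_neq0// mulf_neq0.
  by move: ((2 * normc z0) ^+ k) => p p0; move: (normc z0) n0 => q q0; rewrite le_eqVlt; apply/orP; left; apply/eqP; field; rewrite p0 ?q0.
have key k : 1 <= 2 * B * 2^-1 ^+ k.
  have [b' [eb' fb' bB']] := H k.
  have := fb' 0; rewrite f01 sub0r => /(congr1 (@normc R)); rewrite normc1 normcM normcX normcN => e1; rewrite [leLHS]e1.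
  have := csum_le (z := 0) eb' _ r0 bB'; rewrite normc0 mulr0 => /(_ (ltW r0)) h.
  have n0 : 0 < normc z0 by move: r0; rewrite pmulr_rgt0.
  apply: (le_trans (ler_wpM2l _ h)); first by rewrite exprn_ge0 ?normc_ge0.
  rewrite exprMn exprVn; have : normc z0 ^+ k != 0 by rewrite expf_neq0// gt_eqF.
  have : 2 ^+ k != 0 :> R by rewrite expf_neq0.
  move: (normc z0 ^+ k) => p; move: (2 ^+ k : R) => q q0 p0.
  by rewrite le_eqVlt; apply/orP; left; apply/eqP; field; rewrite p0 ?q0.
have c : 2 * B * 2^-1 ^+ k @[k --> \oo] --> (0 : R).
  have h1 : `|2^-1 : R| < 1 by rewrite ger0_norm; lra.
  by have h := cvgM (cvg_cst (2 * B)) (cvg_expr h1); rewrite mulr0 in h; exact: h.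
have : (1 : R) <= 0 by apply: (cvgr_to_ge c); exact: nearW.
by rewrite real_leNgt// ltr01.
Qed.

End ComplexPowerSeries.

Section EvenEntireFunctions.
Variable R : realType.
Implicit Types (z w s : C R) (b : nat -> C R).

Lemma cvg_dnbhs (f : C R -> C R) z : {for z, continuous f} -> f w @[w --> z^'] --> f z.
Proof. by move=> fc A /fc fA; exact: (@nbhs_dnbhs _ z _ fA). Qed.

Lemma for_continuousM (f g : C R -> C R) z : {for z, continuous f} -> {for z, continuous g} ->
  {for z, continuous (fun w => f w * g w)}.
Proof. by move=> fc gc; exact: (cvgM fc gc). Qed.

Lemma for_continuousV (f : C R -> C R) z : {for z, continuous f} -> f z != 0 ->
  {for z, continuous (fun w => (f w)^-1)}.
Proof. by move=> fc f0; exact: (cvgV f0 fc). Qed.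

Lemma for_continuousDr (a : C R) z : {for z, continuous (fun w => w + a)}.
Proof.
have h1 : {for z, continuous (fun w : C R => w)} by exact: cvg_id.
have h2 : {for z, continuous (fun _ : C R => a)} by exact: cst_continuous.
exact: (cvgD h1 h2).
Qed.

(** The plane is the union of the real lines through 0 and its points. *)
Lemma connected_setTC : connected [set: C R].
Proof.
have -> : [set: C R] = \bigcup_(z in [set: C R]) ((fun t : R => t%:C * z : C R) @` setT).
  by apply/seteqP; split => // z _; exists z => //; exists 1 => //; rewrite mul1r.
apply: bigcup_connected => [|z _].
  by exists 0 => z _; exists 0 => //; rewrite mul0r.
apply: connected_continuous_connected.
  by apply/connected_intervalP => x y _ _ t _.
apply: continuous_subspaceT => t; apply: cvgM; last exact: cvg_cst.
exact: cvg_real_complex.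
Qed.

Lemma continuous_scale_sqr s z : {for z, continuous (fun z : C R => s * z ^+ 2)}.
Proof.
apply: for_continuousM; first exact: cst_continuous.
by apply: for_continuousM; exact: cvg_id.
Qed.

Lemma derivable_csum_sqr b s z0 : entire b -> derivable (fun z => csum b (s * z ^+ 2)) z0 1.
Proof.
move=> eb.
apply: (@cvg_slope _ _ (fun z => s * (z + z0) * csum (cslope b (s * z0 ^+ 2)) (s * z ^+ 2))).
  by move=> z; rewrite csum_cslope//; ring.
apply: for_continuousM.
  by apply: for_continuousM; [exact: cst_continuous|exact: for_continuousDr].
apply: (@continuous_comp _ _ _ (fun z : C R => s * z ^+ 2)); first exact: continuous_scale_sqr.
exact: continuous_csum (cslope_entire _ eb) _.
Qed.

Lemma continuous_csum_sqr b s : entire b -> continuous (fun z => csum b (s * z ^+ 2)).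
Proof.
move=> eb z; apply: (@continuous_comp _ _ _ (fun z : C R => s * z ^+ 2)).
  exact: continuous_scale_sqr.
exact: continuous_csum.
Qed.

(** For z0 != 0, z near z0 and z != z0 give s z^2 != s z0^2, because z + z0 stays away from 0. *)
Lemma csum_sqr_isolated b s z0 : entire b -> b 0 = 1 -> s != 0 ->
  \forall z \near z0^', csum b (s * z ^+ 2) != 0.
Proof.
move=> eb b0 s0; have [->|z00] := eqVneq z0 0.
  apply: nbhs_dnbhs; apply: continuous_neq0; first exact: continuous_csum_sqr.
  by rewrite expr0n mulr0 csum0// b0 oner_neq0.
have h1 : \forall w \near s * z0 ^+ 2, w != s * z0 ^+ 2 -> csum b w != 0.
  exact: csum_isolated.
have h2 : \forall z \near z0, z + z0 != 0.
  apply: (@continuous_neq0 _ (fun z => z + z0)).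
    exact: for_continuousDr.
  by rewrite -mulr2n mulrn_eq0.
have h3 := continuous_scale_sqr h1.
apply: (@filterS2 _ (nbhs z0) _ _ _ _ _ h2 h3) => z zz0 h zn; apply: h.
by rewrite -subr_eq0 -mulrBr subr_sqr !mulf_neq0// subr_eq0.
Qed.

End EvenEntireFunctions.

Section ComplexSeries.
Variable R : realType.
Variable Psi : R -> R.
Hypothesis ND : classND Psi.

Let b (n : nat) : C R := (Icoef Psi n)%:C.

Lemma entire_Icoef : entire b.
Proof.
move=> rho r0; exists (Iser Psi rho) => n.
rewrite normcR ger0_norm ?(ltW (Icoef_gt0 ND n))//.
apply: le_trans (Iser_partial_le ND n.+1 (ltW r0)).
rewrite big_ord_recr /= lerDr; apply: sumr_ge0 => i _.
by rewrite mulr_ge0 ?exprn_ge0 ?(ltW r0) ?(ltW (Icoef_gt0 ND i)).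
Qed.

Let eb := entire_Icoef.

Let b0 : b 0 = 1. Proof. by rewrite /b Icoef0. Qed.

Lemma csum_real (x : R) : csum b x%:C = (Iser Psi x)%:C.
Proof.
apply: csumP; have h := @cvg_real_complex R _ _ _ _ _ (Iser_cvg ND (x := x)).
rewrite (_ : cseries b x%:C = fun N => (pseries (Icoef Psi) x N)%:C); first exact: h.
apply/funext => N; rewrite /cseries /pseries /series /= rmorph_sum /=; apply: eq_bigr => i _.
by rewrite rmorphM rmorphXn.
Qed.

Lemma JPsiE z : JPsi Psi z = csum b (-1 * z ^+ 2).
Proof.
rewrite /JPsi /csum; congr (lim (_ @ \oo)); apply/funext => N.
rewrite /cseries /series /=; apply: eq_bigr => i _.
by rewrite /b /Icoef fmorphV mulN1r (exprNn (z ^+ 2)) (exprM z 2 i) mulrA [_ * (-1) ^+ i]mulrC.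
Qed.

Lemma IPsiE z : IPsi Psi z = csum b (1 * z ^+ 2).
Proof.
rewrite /IPsi JPsiE; congr csum; rewrite exprMn mulrA.
by congr (_ * _); rewrite -['i]/(0 +i* 1) sqr_i mulN1r opprK.
Qed.

Lemma JPsi_real (t : R) : JPsi Psi t%:C = (Iser Psi (- t ^+ 2))%:C.
Proof. by rewrite JPsiE mulN1r -csum_real rmorphN rmorphXn. Qed.

Lemma IPsi_real (t : R) : IPsi Psi t%:C = (Iser Psi (t ^+ 2))%:C.
Proof. by rewrite IPsiE mul1r -csum_real rmorphXn. Qed.

Lemma mulic (t : R) : (0 +i* 1) * t%:C = (0 +i* t) :> C R.
Proof. by simpc. Qed.

Lemma JPsi_im (t : R) : JPsi Psi (0 +i* t) = (Iser Psi (t ^+ 2))%:C.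
Proof. by rewrite -IPsi_real /IPsi mulic. Qed.

Lemma JPsi_im_neq0 (t : R) : JPsi Psi (0 +i* t) != 0.
Proof.
by rewrite JPsi_im (inj_eq (@complexI R) _ 0) gt_eqF// Iser_gt0// sqr_ge0.
Qed.

Lemma IPsi_im (t : R) : IPsi Psi (0 +i* t) = (Iser Psi (- t ^+ 2))%:C.
Proof. by rewrite -JPsi_real IPsiE JPsiE -mulic exprMn sqr_i mul1r. Qed.

Lemma derivable_JPsi z : derivable (JPsi Psi) z 1.
Proof. by rewrite (_ : JPsi Psi = fun z => csum b (-1 * z ^+ 2)); [exact: derivable_csum_sqr|apply/funext => w; exact: JPsiE]. Qed.

Lemma derivable_IPsi z : derivable (IPsi Psi) z 1.
Proof. by rewrite (_ : IPsi Psi = fun z => csum b (1 * z ^+ 2)); [exact: derivable_csum_sqr|apply/funext => w; exact: IPsiE]. Qed.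

Lemma continuous_JPsi : continuous (JPsi Psi).
Proof. by rewrite (_ : JPsi Psi = fun z => csum b (-1 * z ^+ 2)); [exact: continuous_csum_sqr|apply/funext => w; exact: JPsiE]. Qed.

Lemma continuous_IPsi : continuous (IPsi Psi).
Proof. by rewrite (_ : IPsi Psi = fun z => csum b (1 * z ^+ 2)); [exact: continuous_csum_sqr|apply/funext => w; exact: IPsiE]. Qed.

(** The continuation is [JPsi] itself, which at it equals [IPsi] at t and is nonzero. *)
Lemma is_V_JPsi : is_V (fun t => JPsi Psi t%:C) (fun t => (IPsi Psi t%:C)^-1).
Proof.
exists setT, (JPsi Psi); split.
- by split => //; [exact: openT|exact: connected_setTC].
- move=> z0 _; exists (JPsi Psi), (cst 1); split.
  + by apply: filterE => z; exact: derivable_JPsi.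
  + by apply: filterE => z; exact: derivable_cst.
  + by apply: filterE => z; rewrite oner_neq0 divr1.
- by apply: filterE => z; exact: derivable_JPsi.
- by [].
- move=> t; rewrite /IPsi mulic.
  apply: (cvg_dnbhs (f := fun z => (JPsi Psi z)^-1)); apply: for_continuousV.
    exact: continuous_JPsi.
  exact: JPsi_im_neq0.
Qed.

(** Multiplication by i exchanges the two entire functions: [JPsi] at it is [IPsi] at t, and [IPsi]
    at it is [JPsi] at t. Their quotient is meromorphic on the plane since the zeros of [IPsi] are
    isolated. Its inverse is continuous at it, where [JPsi] is positive, and so has the right limit
    also at the poles of [FPsi]. *)
Lemma is_V_FPsi : is_V (fun t => FPsi Psi t%:C) (fun t => FPsi Psi t%:C).
Proof.
exists setT, (FPsi Psi); split.
- by split => //; [exact: openT|exact: connected_setTC].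
- move=> z0 _; exists (JPsi Psi), (IPsi Psi); split.
  + by apply: filterE => z; exact: derivable_JPsi.
  + by apply: filterE => z; exact: derivable_IPsi.
  + have := csum_sqr_isolated z0 eb b0 (oner_neq0 _).
    by apply: filterS => z; rewrite -IPsiE.
- have : \forall z \near (0 : C R), IPsi Psi z != 0.
    apply: continuous_neq0; first exact: continuous_IPsi.
    by rewrite IPsiE expr0n mulr0 csum0// b0 oner_neq0.
  apply: filterS => z z0; apply: derivableM; first exact: derivable_JPsi.
  by apply: derivableV => //; exact: derivable_IPsi.
- by [].
- move=> t.
  have J0 := JPsi_im_neq0 t.
  have -> : FPsi Psi t%:C = IPsi Psi (0 +i* t) / JPsi Psi (0 +i* t).
    by rewrite /FPsi JPsi_im IPsi_im JPsi_real IPsi_real.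
  have -> : (fun z => (FPsi Psi z)^-1) = fun z => IPsi Psi z / JPsi Psi z.
    by apply/funext => z; rewrite /FPsi invf_div.
  apply: (cvg_dnbhs (f := fun z => IPsi Psi z / JPsi Psi z)).
  apply: for_continuousM; first exact: continuous_IPsi.
  by apply: for_continuousV => //; exact: continuous_JPsi.
Qed.

Lemma FPsi_im (t : R) : JPsi Psi t%:C != 0 -> FPsi Psi t%:C * FPsi Psi (0 +i* t) = 1.
Proof.
rewrite /FPsi JPsi_im IPsi_im -IPsi_real -JPsi_real => J0.
have I0 : IPsi Psi t%:C != 0 by rewrite IPsi_real -(JPsi_im t); exact: JPsi_im_neq0.
by rewrite mulrA (divfK I0) (divff J0).
Qed.

End ComplexSeries.

(** * Real kernels on the complex side *)

Section RealKernels.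
Variable R : realType.
Implicit Types F : R -> R.

Lemma conj_conjc (z : R[i]) : Num.conj z = conjc z.
Proof. by []. Qed.

(** Split c into real and imaginary parts; the mixed terms cancel by symmetry of [K]. *)
Lemma psd_complex n (K : 'I_n -> 'I_n -> R) : (forall j k, K j k = K k j) ->
  (forall c : 'I_n -> R, 0 <= \sum_j \sum_k K j k * c j * c k) ->
  forall c : 'I_n -> C R, 0 <= \sum_j \sum_k (K j k)%:C * c j * (c k)^*.
Proof.
move=> sK pK c.
pose a j := complex.Re (c j); pose b j := complex.Im (c j).
have E j k : (K j k)%:C * c j * (c k)^* =
   (K j k * a j * a k + K j k * b j * b k)%:C +
   'i * ((K j k * b j * a k)%:C - (K j k * a j * b k)%:C) :> R[i].
  rewrite /a /b; case: (c j) (c k) => x y [u v] /=; simpc.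
  by congr (_ +i* _); ring.
have -> : \sum_j \sum_k (K j k)%:C * c j * (c k)^* =
   (\sum_j \sum_k K j k * a j * a k + \sum_j \sum_k K j k * b j * b k)%:C :> R[i].
  transitivity (\sum_j \sum_k ((K j k * a j * a k + K j k * b j * b k)%:C +
     'i * ((K j k * b j * a k)%:C - (K j k * a j * b k)%:C)) : R[i]).
    by apply: eq_bigr => j _; apply: eq_bigr => k _; exact: E.
  have -> : \sum_j \sum_k ((K j k * a j * a k + K j k * b j * b k)%:C +
     'i * ((K j k * b j * a k)%:C - (K j k * a j * b k)%:C)) =
     (\sum_j \sum_k (K j k * a j * a k + K j k * b j * b k))%:C +
     'i * ((\sum_j \sum_k K j k * b j * a k)%:C - (\sum_j \sum_k K j k * a j * b k)%:C) :> R[i].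
    rewrite !rmorph_sum -sumrB mulr_sumr -big_split; apply: eq_bigr => j _ /=.
    by rewrite !rmorph_sum -sumrB mulr_sumr -big_split.
  have -> : \sum_j \sum_k K j k * b j * a k = \sum_j \sum_k K j k * a j * b k.
    rewrite exchange_big; apply: eq_bigr => j _; apply: eq_bigr => k _.
    by rewrite sK mulrAC.
  rewrite subrr mulr0 addr0 -big_split; congr (_%:C).
  by apply: eq_bigr => j _; rewrite big_split.
by rewrite ler0c addr_ge0.
Qed.

Lemma rpd_positive_definite F : (forall t, F (- t) = F t) -> rpd F ->
  positive_definite (fun t => (F t)%:C).
Proof.
move=> ev pF n t c; apply: (@psd_complex n (fun j k => F (t j - t k))) => [j k|].
  by rewrite -opprB ev.
exact: pF.
Qed.

Lemma rnd_negative_definite F : (forall t, F (- t) = F t) -> rnd F ->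
  negative_definite (fun t => (F t)%:C).
Proof.
move=> ev nF n t c.
have := @psd_complex n (fun j k => F (t j) + F (t k) - F (t j - t k)) _ (nF n t) c.
have sK j k : F (t j) + F (t k) - F (t j - t k) = F (t k) + F (t j) - F (t k - t j).
  by rewrite -(opprB (t j)) ev [F (t k) + _]addrC.
move=> /(_ sK) h.
rewrite (eq_bigr (fun j => \sum_k (F (t j) + F (t k) - F (t j - t k))%:C * c j * (c k)^*))// => j _.
by apply: eq_bigr => k _; by rewrite (conj_conjc (F (t k))%:C) conjc_real rmorphB rmorphD.
Qed.

(** Test the form at the points t and 0 with weights 1 and s, for s = 1 and s = -1. *)
Lemma rpd_le1 F : (forall t, F (- t) = F t) -> rpd F -> F 0 = 1 -> forall t, `|F t| <= 1.
Proof.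
move=> ev pF F0 t.
have h (s : R) : s ^+ 2 = 1 -> 0 <= 2 + 2 * (s * F t).
  move=> s1.
  have := pF 2 (fun j => if j == ord0 then t else 0) (fun j => if j == ord0 then 1 else s).
  rewrite !big_ord_recl !big_ord0 /= !subrr !subr0 sub0r ev F0 !addr0 !mulr1 !mul1r.
  rewrite -expr2 s1; lra.
rewrite ler_norml; have := h 1 (expr1n _ _); have := h (-1) (sqrr_sign _ 1).
by rewrite mulN1r mul1r => h1 h2; apply/andP; split; lra.
Qed.

Lemma rpd_Pplus F : (forall t, F (- t) = F t) -> rpd F -> F 0 = 1 -> continuous F ->
  Pplus (fun t => (F t)%:C).
Proof.
move=> ev pF F0 cF; split.
- by move=> t; apply: cvg_real_complex; exact: cF.
- by exists 1 => t; rewrite norm_normc normcR lecR; exact: rpd_le1.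
- exact: rpd_positive_definite.
- by rewrite F0.
Qed.

Lemma rnd_NR F : (forall t, F (- t) = F t) -> rnd F -> continuous F ->
  NR (fun t => (F t)%:C : C R).
Proof.
move=> ev nF cF; split; last exact: rnd_negative_definite.
by move=> t; apply: cvg_real_complex; exact: cF.
Qed.

Lemma normc_cexp (z : C R) : normc (cexp z) = expR (complex.Re z).
Proof.
case: z => x y; rewrite /cexp /normc /= !exprMn -mulrDr cos2Dsin2 mulr1 sqrtr_sqr.
by rewrite ger0_norm// expR_ge0.
Qed.

(* Negative definiteness at the points [h], [-h]. *)
Lemma log_doubling F (psi : R -> C R) : (forall t, F (- t) = F t) ->
  is_log (fun t => (F t)%:C) psi -> NR (fun t => - psi t) ->
  forall h, `|F h| ^+ 4 <= `|F (2 * h)|.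
Proof.
move=> ev [_ psi0 Fpsi] [_ nd] h.
have nF t : `|F t| = expR (complex.Re (psi t)) by rewrite -normcR Fpsi normc_cexp.
have evr t : complex.Re (psi (- t)) = complex.Re (psi t).
  by apply: expR_inj; rewrite -!nF ev.
rewrite !nF -expRM_natl ler_expR.
have := nd 2 (fun j => if j == ord0 then h else - h) (fun=> 1).
rewrite !big_ord_recl !big_ord0 /= ?conj_conjc !conjc1 !mulr1 !addr0 !opprK !subrr.
rewrite addNr psi0 -opprD (_ : h + h = 2 * h) ?lecE; last by ring.
move=> /andP[_].
have := evr h; have := evr (2 * h).
case: (psi h) => x1 y1; case: (psi (- h)) => x2 y2.
case: (psi (2 * h)) => x3 y3; case: (psi (- (2 * h))) => x4 y4 /=.
lra.
Qed.

End RealKernels.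

(** * Positive definite pairs, and the obstruction to infinite divisibility *)

Section MainResults.
Variable R : realType.
Variable Psi : R -> R.
Hypothesis ND : classND Psi.

Let I := Iser Psi.
Let J (t : R) := I (- t ^+ 2).

Let ev (f : R -> R) (t : R) : f ((- t) ^+ 2) = f (t ^+ 2).
Proof. by rewrite sqrrN. Qed.

Let continuous_sqr : continuous (fun t : R => t ^+ 2).
Proof. by move=> t; exact: exprn_continuous. Qed.

Let continuous_comp_sqr (f : R -> R) : (forall x : R, 0 <= x -> {for x, continuous f}) ->
  continuous (fun t : R => f (t ^+ 2)).
Proof.
move=> cf t; apply: (@continuous_comp _ _ _ (fun t : R => t ^+ 2) f); first exact: continuous_sqr.
by apply: cf; exact: sqr_ge0.
Qed.

Let continuous_J : continuous J.
Proof.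
move=> t; apply: (@continuous_comp _ _ _ (fun t : R => - t ^+ 2) I); last exact: continuous_Iser.
by apply: cvgN; exact: continuous_sqr.
Qed.

Let continuous_VI : continuous (fun t : R => (I (t ^+ 2))^-1).
Proof.
apply: (continuous_comp_sqr (f := fun x => (I x)^-1)) => x x0.
by apply: cvgV; [rewrite gt_eqF// Iser_gt0|exact: continuous_Iser].
Qed.

Let rpd_J : rpd J.
Proof.
apply: even_series_rpd => [n|x|]; first exact: ltW (Icoef_gt0 ND n).
  exact: Iser_cvg.
exact: moment_W.
Qed.

Lemma Pplus_JPsi : Pplus (fun t : R => JPsi Psi t%:C).
Proof.
rewrite (_ : (fun t => _) = fun t : R => (J t)%:C); last by apply/funext => t; exact: JPsi_real.
apply: rpd_Pplus => //; first exact: (ev (fun x => I (- x))).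
by rewrite /J expr0n oppr0 /I Iser0.
Qed.

Lemma Pplus_invIPsi : Pplus (fun t : R => (IPsi Psi t%:C)^-1).
Proof.
rewrite (_ : (fun t => _) = fun t : R => ((I (t ^+ 2))^-1)%:C); last first.
  by apply/funext => t; rewrite IPsi_real// fmorphV.
apply: rpd_Pplus => //; first exact: (ev (fun x => (I x)^-1)).
- have := rpd_laplace (Iser_inv_laplace ND) (@rpd_cst1 R).
  by rewrite (_ : (fun t => _) = fun t => (I (t ^+ 2))^-1)//; apply/funext => t; rewrite mul1r.
- by rewrite expr0n /I Iser0// invr1.
Qed.

Lemma Pplus_FPsi : Pplus (fun t : R => FPsi Psi t%:C).
Proof.
rewrite (_ : (fun t => _) = fun t : R => (J t * (I (t ^+ 2))^-1)%:C); last first.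
  by apply/funext => t; rewrite /FPsi JPsi_real// IPsi_real// rmorphM fmorphV.
apply: rpd_Pplus => //.
- by move=> t; rewrite /J !ev.
- exact: rpd_laplace (Iser_inv_laplace ND) rpd_J.
- by rewrite /J expr0n oppr0 /I Iser0// invr1 mulr1.
- by move=> t; apply: cvgM; [exact: continuous_J|exact: continuous_VI].
Qed.

Lemma is_log_IPsi : is_log (fun t : R => IPsi Psi t%:C) (fun t : R => (logI Psi (t ^+ 2))%:C).
Proof.
split.
- move=> t; apply: cvg_real_complex.
  apply: (continuous_comp_sqr (f := logI Psi)) => x x0.
  apply: differentiable_continuous; apply/derivable1_diffP.
  by have [] := is_derive_logI ND x0.
- by rewrite expr0n logI0.
- move=> t; rewrite IPsi_real// /cexp /= cos0 sin0 mulr1 mulr0 expR_logI//.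
  exact: sqr_ge0.
Qed.

Lemma NR_logIPsi : NR (fun t : R => (logI Psi (t ^+ 2))%:C : C R).
Proof.
apply: rnd_NR; first exact: (ev (logI Psi)).
  exact: rnd_logI.
apply: (continuous_comp_sqr (f := logI Psi)) => x x0.
apply: differentiable_continuous; apply/derivable1_diffP.
by have [] := is_derive_logI ND x0.
Qed.

(** Peeling three coefficients off the series leaves x^3 times an entire series. The range 4
    accommodates the argument 4 h^2 of J(2h) for h <= 1. *)
Lemma Iser_taylor2 : exists2 B : R, 0 <= B & forall x, `|x| <= 4 ->
  `|I x - (1 + Icoef Psi 1 * x + Icoef Psi 2 * x ^+ 2)| <= B * `|x| ^+ 3.
Proof.
pose b (n : nat) : C R := (Icoef Psi n)%:C.
have eb : entire b := entire_Icoef ND.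
have [e1 _] := csumS 0 eb; have [e2 _] := csumS 0 e1; have [e3 _] := csumS 0 e2.
have r0 : 0 < 8 :> R by [].
have [B bB] := e3 _ r0.
have B0 : 0 <= B by have := bB 0; rewrite expr0 mulr1; apply: le_trans; exact: normc_ge0.
exists (2 * B); first by rewrite mulr_ge0.
move=> x x4; rewrite -normcR.
have -> : (I x - (1 + Icoef Psi 1 * x + Icoef Psi 2 * x ^+ 2))%:C =
    csum b x%:C - (1 + Icoef Psi 1 * x + Icoef Psi 2 * x ^+ 2)%:C.
  by rewrite (csum_real ND) rmorphB.
have [_ ->] := csumS x%:C eb; have [_ ->] := csumS x%:C e1; have [_ ->] := csumS x%:C e2.
have h : normc (csum (cshift (cshift (cshift b))) x%:C) <= 2 * B.
  by apply: csum_le e3 _ r0 bB; rewrite normcR; lra.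
rewrite (_ : _ - _ = x%:C ^+ 3 * csum (cshift (cshift (cshift b))) x%:C).
  by rewrite normcM normcX normcR mulrC ler_wpM2r ?exprn_ge0.
by rewrite /cshift /b Icoef0 !rmorphD !rmorphM rmorph1 /=; ring.
Qed.

(** By [log_doubling], J(h)^4 <= |J(2h)|. With x = h^2 and a1, a2 the first coefficients of I, the
    two sides are 1 - 4 a1 x + (6 a1^2 + 4 a2) x^2 and 1 - 4 a1 x + 16 a2 x^2 up to O(x^3). Hence 6
    a1^2 <= 12 a2, where a1 = 1/Psi(1) and a2 = 1/(Psi(1) Psi(2)). *)
Lemma not_NR_log_JPsi (psi : R -> C R) : is_log (fun t : R => JPsi Psi t%:C) psi ->
  NR (fun t => - psi t) -> Psi 2 <= 2 * Psi 1.
Proof.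
move=> lJ nJ.
have {lJ} lJ : is_log (fun t : R => (J t)%:C) psi.
  by case: lJ => h1 h2 h3; split => // t; rewrite -h3 JPsi_real.
have evJ : forall t, J (- t) = J t by exact: (ev (fun x => I (- x))).
have dJ := log_doubling evJ lJ nJ.
have dI x : 0 <= x -> I (- x) ^+ 4 <= `|I (- (4 * x))|.
  move=> x0; have := dJ (Num.sqrt x); rewrite /J exprMn sqr_sqrtr//.
  by rewrite -normrX ger0_norm ?exprn_even_ge0// -natrX.
have [B B0 taylor] := Iser_taylor2.
pose a1 := Icoef Psi 1; pose a2 := Icoef Psi 2.
pose x (n : nat) : R := n.+1%:R^-1.
have x0 n : 0 < x n by rewrite /x invr_gt0.
have x1 n : x n <= 1 by rewrite /x invf_le1// ler1n.
have cx : x n @[n --> \oo] --> (0 : R) by exact: cvg_harmonic.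
(* With this slope I(- x n) = 1 - x n s n holds exactly, and s n tends to a1. *)
pose s n := (1 - I (- x n)) / x n.
have s_near n : `|a1 - s n| <= a2 * x n + B * x n ^+ 2.
  have := taylor (- x n); rewrite normrN (gtr0_norm (x0 n)) => /(_ _).
  have x4 : x n <= 4 by apply: le_trans (x1 n) _; lra.
  move=> /(_ x4); rewrite /s -/a1 -/a2 => h.
  have e : s n * x n = 1 - I (- x n) by rewrite /s divfK ?gt_eqF.
  rewrite -(ler_pM2r (x0 n)).
  have -> : `|a1 - s n| * x n = `|a1 * x n - (1 - I (- x n))|.
    by rewrite -e -mulrBl normrM (gtr0_norm (x0 n)).
  have a20 : 0 <= a2 by exact: ltW (Icoef_gt0 ND 2).
  have t0 : 0 <= a2 * x n ^+ 2 by rewrite mulr_ge0// exprn_ge0// ltW.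
  by move: h; rewrite !ler_norml => /andP[h1 h2]; apply/andP; split; lra.
have cE : a2 * x n + B * x n ^+ 2 @[n --> \oo] --> (0 : R).
  have := cvgD (cvgM (cvg_cst a2) cx) (cvgM (cvg_cst B) (cvgM cx cx)).
  by rewrite !mulr0 addr0; exact.
have cs : s n @[n --> \oo] --> a1.
  have l := cvgB (cvg_cst a1) cE; have r := cvgD (cvg_cst a1) cE.
  rewrite subr0 in l; rewrite addr0 in r.
  apply: (@squeeze_cvgr _ _ _ _ (fun n => a1 - (a2 * x n + B * x n ^+ 2))
    (fun n => a1 + (a2 * x n + B * x n ^+ 2))); [|exact: l|exact: r].
  apply: nearW => n.
  by have := s_near n; rewrite ler_norml => /andP[h1 h2]; apply/andP; split; lra.
have pos : \forall n \near \oo, 0 <= I (- (4 * x n)).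
  have c4 : - (4 * x n) @[n --> \oo] --> (0 : R).
    by have := cvgN (cvgM (cvg_cst (4 : R)) cx); rewrite mulr0 oppr0; exact.
  have c : I (- (4 * x n)) @[n --> \oo] --> I 0.
    exact: (cvg_comp _ _ c4 (@continuous_Iser _ _ ND 0)).
  rewrite /I Iser0// in c.
  have h : \forall n \near \oo, 0 < I (- (4 * x n)) by apply: (cvgr_gt _ c); exact: ltr01.
  by apply: filterS h => n; exact: ltW.
(* Expand (1 - x s)^4 and divide by x^2. The constant 68 B is 64 B from the remainder at 4 x plus 4
   B from trading a1 for s. *)
have main : \forall n \near \oo, 6 * s n ^+ 2 <= 12 * a2 + 68 * B * x n + 4 * x n * s n ^+ 3.
  apply: filterS pos => n p.
  have := dI _ (ltW (x0 n)); rewrite (ger0_norm p) => d.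
  have e : I (- x n) = 1 - x n * s n.
    by rewrite /s mulrC divfK ?gt_eqF// subKr.
  have := taylor (- (4 * x n)); rewrite normrN gtr0_norm ?mulr_gt0//.
  have x4 : 4 * x n <= 4 by have := x1 n; lra.
  move=> /(_ x4); rewrite -/a1 -/a2 ler_norml => /andP[_ h1].
  have := taylor (- x n); rewrite normrN (gtr0_norm (x0 n)).
  have x4' : x n <= 4 by have := x1 n; lra.
  move=> /(_ x4'); rewrite -/a1 -/a2 e ler_norml => /andP[h2 _].
  rewrite e in d.
  have p2 : 0 < x n ^+ 2 by rewrite exprn_gt0.
  have p4 : 0 <= (x n * s n) ^+ 4 by rewrite exprn_even_ge0.
  rewrite -(ler_pM2r p2); lra.
have lim : 6 * a1 ^+ 2 <= 12 * a2.
  have l : 6 * s n ^+ 2 @[n --> \oo] --> (6 * a1 ^+ 2 : R).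
    exact: (cvgM (cvg_cst (6 : R)) (cvgM cs cs)).
  have r : 12 * a2 + 68 * B * x n + 4 * x n * s n ^+ 3 @[n --> \oo] --> 12 * a2.
    have := cvgD (cvgD (cvg_cst (12 * a2)) (cvgM (cvg_cst (68 * B)) cx))
      (cvgM (cvgM (cvg_cst (4 : R)) cx) (cvgM cs (cvgM cs cs))).
    by rewrite !mulr0 mul0r !addr0; exact.
  exact: (ler_cvg_to l r main).
have p1 := classND_nat_gt0 ND 0; have p2 := classND_nat_gt0 ND 1.
move: lim; rewrite /a1 /a2 !IcoefS// Icoef0//.
move: (Psi 1) (Psi 2) p1 p2 => u v u0 v0.
have -> : 6 * (1 / u) ^+ 2 = (6 * v) / (u ^+ 2 * v) by field; rewrite !gt_eqF.
have -> : 12 * (1 / u / v) = (12 * u) / (u ^+ 2 * v) by field; rewrite !gt_eqF.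
rewrite ler_pM2r ?invr_gt0 ?mulr_gt0 ?exprn_gt0//; lra.
Qed.

End MainResults.

Theorem theorem20 (R : realType) :
  @DP R `<=` @D R /\
  forall Psi : R -> R, classND Psi ->
    [/\ D2 (fun t : R => JPsi Psi t%:C, fun t : R => (IPsi Psi t%:C)^-1),
        (* the only exception to the first claim is the linear case, in which
           JPsi Psi is Gaussian *)
        ((~ exists a : R, forall u : R, 0 <= u -> Psi u = a * u) ->
           ~ exists2 psi : R -> C R,
               is_log (fun t : R => JPsi Psi t%:C) psi & NR (fun t : R => - psi t)) /\
        (exists phi : R -> R,
           [/\ is_log (fun t : R => IPsi Psi t%:C) (fun t : R => (phi (t ^+ 2))%:C),
               NR (fun t : R => (phi (t ^+ 2))%:C : C R),
               BJ phi
             & exists (nu sigma : R) (mubar : R -> R),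
                 BJ_representation phi nu sigma mubar /\
                 forall r s : R, 0 < r -> r <= s -> s * mubar s <= r * mubar r])
      & DS (fun t : R => FPsi Psi t%:C) /\
        forall t : R, JPsi Psi t%:C != 0 ->
          FPsi Psi t%:C * FPsi Psi (0 +i* t) = 1].
Proof.
split.
  move=> _ [Psi ND ->]; split; first exact: Pplus_JPsi.
  by exists (fun t => (IPsi Psi t%:C)^-1); [exact: is_V_JPsi|exact: Pplus_invIPsi].
move=> Psi ND; split.
- by split; [exact: Pplus_JPsi|exact: Pplus_invIPsi|exact: is_V_JPsi].
- have [P0 Plin] := classND_rigid ND.
  split.
    (* The doubling inequality and [classND_rigid] bound Psi 2 - 2 Psi 1 from both sides, so
       rigidity applies. *)
    move=> nlin [psi lJ nJ]; apply: nlin; apply: Plin; apply/eqP.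
    by rewrite eq_le (not_NR_log_JPsi _ lJ nJ)//= -subr_ge0.
  have [sigma [mubar [rep mono]]] := logI_representation ND.
  exists (logI Psi); split.
  + exact: is_log_IPsi.
  + exact: NR_logIPsi.
  + by split; [exact: logI_bernstein|exists 0, sigma, mubar].
  + by exists 0, sigma, mubar.
- split; first by split; [exact: Pplus_FPsi|exact: is_V_FPsi].
  exact: FPsi_im.
Qed.
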